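(* For every constant $K>0$ there exists $\eta_0>0$ such that for every $0<\eta\le\eta_0$ there exists $n_0$ such that the following holds for all $n\ge n_0$. Let $G$ be an oriented graph on $n$ vertices such that $\deg^+(x)+\deg^-(y)\ge (3n-3)/4$ for all distinct $x,y\in V(G)$ with $xy\notin E(G)$. If $G$ is $\eta$-extremal (with implied constant $K$), then $G$ contains a (directed) Hamilton cycle.
   Context: An oriented graph is a finite digraph without loops in which there is at most one arc between any two vertices. $xy$ denotes the edge directed from $x$ to $y$; $\deg^+(v)$, $\deg^-(v)$ are the outdegree and indegree of $v$. Cycles are directed. For vertex sets $X,Y$, $e(X,Y)$ is the number of edges $xy$ with $x\in X$, $y\in Y$, and $e(X)$ is the number of edges with both ends in $X$. Definition. Given $K,\eta>0$, an oriented graph $G$ on $n$ vertices is $\eta$-extremal (with implied constant $K$) if there are pairwise disjoint vertex subsets $A,B,C,D\subset V(G)$ (where $A$ or $C$ may be empty) such that $\big||A|+|C|-n/2\big|\le K\eta n$, $\big||B|-n/4\big|\le K\eta n$, $\big||D|-n/4\big|\le K\eta n$, and $e(A,B)>|A||B|-K\eta n^2$, $e(B,C)>|B||C|-K\eta n^2$, $e(C,D)>|C||D|-K\eta n^2$, $e(D,A)>|A||D|-K\eta n^2$, $e(B,D)>|A|n/8-K\eta n^2$, $e(D,B)>|C|n/8-K\eta n^2$, $e(A)>|A|^2/2-K\eta n^2$, $e(C)>|C|^2/2-K\eta n^2$, $e(A,C)<K\eta n^2$, $e(D)<K\eta n^2$. *)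

(* Defs.v *)
From mathcomp Require Import all_boot all_order all_algebra.
From mathcomp Require Import reals.

Set Implicit Arguments.
Unset Strict Implicit.
Unset Printing Implicit Defensive.

Import Order.TTheory GRing.Theory Num.Theory.

Local Open Scope ring_scope.

(* A digraph on the vertex set T is its arc relation g : rel T; [g x y] says
   that xy is an arc, directed from x to y. *)

Definition oriented_graph (T : finType) (g : rel T) : Prop :=
  irreflexive g /\ (forall x y : T, ~~ (g x y && g y x)).

Definition outdeg (T : finType) (g : rel T) (x : T) : nat :=
  #|[set y | g x y]|.

Definition indeg (T : finType) (g : rel T) (x : T) : nat :=
  #|[set y | g y x]|.

(* e(X, Y); e(X) is [arcs g X X]. *)
Definition arcs (T : finType) (g : rel T) (X Y : {set T}) : nat :=
  #|[set p : T * T in setX X Y | g p.1 p.2]|.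

Definition extremal_partition (R : realType) (K eta : R) (T : finType)
    (g : rel T) (A B C D : {set T}) : Prop :=
  let n : R := #|T|%:R in
  let a : R := #|A|%:R in
  let b : R := #|B|%:R in
  let c : R := #|C|%:R in
  let d : R := #|D|%:R in
  let e (X Y : {set T}) : R := (arcs g X Y)%:R in
  let err : R := K * eta * n ^+ 2 in
  [/\ [/\ [disjoint A & B], [disjoint A & C] & [disjoint A & D]],
      [/\ [disjoint B & C], [disjoint B & D] & [disjoint C & D]],
      [/\ `|a + c - n / 2| <= K * eta * n,
          `|b - n / 4| <= K * eta * n &
          `|d - n / 4| <= K * eta * n],
      [/\ e A B > a * b - err,
          e B C > b * c - err,
          e C D > c * d - err &
          e D A > a * d - err] &
      [/\ e B D > a * n / 8 - err /\ e D B > c * n / 8 - err,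
          e A A > a ^+ 2 / 2 - err,
          e C C > c ^+ 2 / 2 - err,
          e A C < err &
          e D D < err]].

Definition extremal (R : realType) (K eta : R) (T : finType) (g : rel T) :
    Prop :=
  exists A B C D : {set T}, extremal_partition K eta g A B C D.

(* [path.cycle] accepts the empty sequence, hence the first clause. *)
Definition has_hamilton_cycle (T : finType) (g : rel T) : Prop :=
  exists c : seq T,
    [/\ c != [::], cycle g c, uniq c & forall x : T, x \in c].

(* Main.v *)
(* Call a vertex of A or D an out-vertex of type alpha, one of B or C an
   out-vertex of type gamma; call a vertex of A or B an in-vertex of type alpha,
   one of C or D an in-vertex of type gamma.  Almost all arcs of an extremal
   graph join types alpha to alpha or gamma to gamma, and a Hamilton cycle exists
   only if the two types are balanced: with X the out-vertices of type alpha and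
   Y the in-vertices of type gamma, |X| + |Y| - n must be the number of arcs
   X -> Y minus the number of arcs V \ X -> V \ Y on the cycle.  Atypical vertices
   are typed by their degrees, separately for in and out, and those whose degrees
   allow both types are used to reduce the imbalance k.  If k > 0 remains, the
   bad arcs contain a linear forest with k arcs: otherwise König's theorem gives
   sets X1, Y1 with |X1| + |Y1| > n and (almost) no arc X1 -> Y1, and averaging
   the Ore condition over non-adjacent pairs contradicts this; this is where the
   exact bound (3n - 3)/4 is used.  The paths of the forest and the remaining
   atypical vertices are absorbed into one path from B to B.  The balance then
   forces equality of the numbers of free vertices in B and D, and the rest is
   covered by perfect matchings between nearly complete pairs and closed up by a
   Hamilton cycle in a nearly complete digraph.  Reversing all arcs exchanges A
   and C. *)

Require Import Defs.
From mathcomp Require Import all_boot all_order all_algebra.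
From mathcomp Require Import reals.
From mathcomp Require Import zify lra.

Set Implicit Arguments.
Unset Strict Implicit.
Unset Printing Implicit Defensive.

(** * König's theorem *)

(** The cycle is closed in m rounds through D, A, B, C, each meeting B and D once, so only |B| and
    |D| have to agree exactly; the absorbing path counts as one vertex of B. The sizes of A and C
    are adjusted: a class with more than m vertices is cut into m paths, being almost a tournament,
    and a class with fewer is skipped in some rounds along a matching from D to B (for A) or from B
    to D (for C), which König's theorem extracts from e(D,B) > |C|n/8 or e(B,D) > |A|n/8 up to
    errors. The obstacle is that only one of A and C may be skipped; extra rounds avoiding A are
    therefore spliced into the absorbing path until A or C has as many vertices as D. To skip A
    about (n/4 - |A|)n/4 arcs are needed and about (n/2 - |A|)n/8 exist, a margin of |A|n/8. It
    beats the errors, multiples of qn with q a small fixed fraction of n, only if |A| is a large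
    multiple of q. Otherwise all of A is treated as atypical, and D to B is then nearly complete.
    The Ore condition forces all degrees to be at least (n - 1)/8, so every atypical vertex can be
    typed. *)

Lemma exists_subset_card (T : finType) (A : {set T}) k :
  k <= #|A| -> exists2 B : {set T}, B \subset A & #|B| = k.
Proof.
move=> kA; have /card_gt0P[B] : 0 < #|[set B : {set T} | B \subset A & #|B| == k]|.
  by rewrite cards_draws bin_gt0.
by rewrite inE => /andP[BA /eqP cB]; exists B.
Qed.

Section Konig.
Variables T1 T2 : finType.
Implicit Types (E M : {set T1 * T2}) (X : {set T1}) (Y : {set T2}).

(** With [T1 = T2] this is a matching of the bipartite double cover: a vertex may be the head of one
    pair and the tail of another, so such a set of arcs is a union of directed paths and cycles. *)
Definition is_matching M :=
  {in M &, injective (@fst T1 T2)} /\ {in M &, injective (@snd T1 T2)}.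

Definition covers E X Y := [forall e in E, (e.1 \in X) || (e.2 \in Y)].

Definition has_cover E k :=
  [exists X : {set T1}, [exists Y : {set T2}, covers E X Y && (#|X| + #|Y| < k)]].

Lemma has_coverP E k :
  reflect (exists X Y, (forall x y, (x, y) \in E -> (x \in X) || (y \in Y)) /\
             #|X| + #|Y| < k)
          (has_cover E k).
Proof.
apply: (iffP existsP) => [[X /existsP[Y /andP[/forallP c s]]]|[X [Y [c s]]]].
  by exists X, Y; split=> // x y xyE; have := c (x, y); rewrite xyE.
exists X; apply/existsP; exists Y; rewrite s andbT.
by apply/forallP => -[x y]; apply/implyP => /c.
Qed.

(* Of the covers (X1 :&: X2, Y1 :|: Y2) and (x |: X1 :|: X2, Y1 :&: Y2) one is
   smaller than k. *)
Lemma cover_exchange_left E k x y z : (x, y) \in E -> y != z ->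
  has_cover (E :\ (x, y)) k -> has_cover (E :\ (x, z)) k -> has_cover E k.
Proof.
move=> xyE yz /has_coverP[X1 [Y1 [c1 s1]]] /has_coverP[X2 [Y2 [c2 s2]]].
have c1' u v : (u, v) \in E -> (u, v) != (x, y) -> (u \in X1) || (v \in Y1).
  by move=> uvE ne; apply: c1; rewrite !inE ne.
have c2' u v : (u, v) \in E -> (u, v) != (x, z) -> (u \in X2) || (v \in Y2).
  by move=> uvE ne; apply: c2; rewrite !inE ne.
have Xs := cardsUI X1 X2; have Ys := cardsUI Y1 Y2.
have cx : #|x |: (X1 :|: X2)| <= #|X1 :|: X2| + 1.
  by rewrite cardsU1; case: (x \notin _) => /=; lia.
apply/has_coverP; case: (boolP ((x \in X1) || (x \in X2))) => [xX|].
  case/orP: xX => xX.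
    exists X1, Y1; split=> // u v uvE.
    by case: (eqVneq (u, v) (x, y)) => [[-> _]|ne]; [rewrite xX | apply: c1'].
  exists X2, Y2; split=> // u v uvE.
  by case: (eqVneq (u, v) (x, z)) => [[-> _]|ne]; [rewrite xX | apply: c2'].
rewrite negb_or => /andP[xX1 xX2].
have [le|gt] := leqP (#|X1 :&: X2| + #|Y1 :|: Y2|) k.-1.
  exists (X1 :&: X2), (Y1 :|: Y2); split; last by lia.
  move=> u v uvE; rewrite !inE.
  case: (eqVneq (u, v) (x, y)) => [[eu ev]|ne1].
    subst u v; have := c2' _ _ uvE; rewrite (negbTE xX2) xpair_eqE eqxx yz /=.
    by move=> ->; rewrite ?orbT.
  have h1 := c1' _ _ uvE ne1.
  case: (eqVneq (u, v) (x, z)) h1 => [[eu ev]|ne2] h1.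
    by move: h1; rewrite eu (negbTE xX1) /= => ->; rewrite ?orbT.
  by have := c2' _ _ uvE ne2; case/orP: h1 => ->; case/orP=> ->; rewrite ?orbT.
exists (x |: (X1 :|: X2)), (Y1 :&: Y2); split; last by lia.
move=> u v uvE; rewrite !inE; case: (eqVneq u x) => //= nux.
have h1 : (u \in X1) || (v \in Y1) by apply: c1' => //; rewrite xpair_eqE (negbTE nux).
have h2 : (u \in X2) || (v \in Y2) by apply: c2' => //; rewrite xpair_eqE (negbTE nux).
by case/orP: h1 => ->; case/orP: h2 => ->; rewrite ?orbT.
Qed.

End Konig.

Definition swap_set (T1 T2 : finType) (E : {set T1 * T2}) : {set T2 * T1} :=
  [set p | (p.2, p.1) \in E].

Lemma has_cover_swap (T1 T2 : finType) (E : {set T1 * T2}) k :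
  has_cover (swap_set E) k -> has_cover E k.
Proof.
move=> /has_coverP[Y [X [c s]]]; apply/has_coverP; exists X, Y.
split; last by rewrite addnC.
by move=> x y xyE; rewrite orbC; apply: c; rewrite inE.
Qed.

Lemma cover_exchange_right (T1 T2 : finType) (E : {set T1 * T2}) k x y z :
  (x, z) \in E -> x != y ->
  has_cover (E :\ (x, z)) k -> has_cover (E :\ (y, z)) k -> has_cover E k.
Proof.
move=> xE xy h1 h2.
have sw u : swap_set (E :\ (u, z)) = swap_set E :\ (z, u).
  by apply/setP => -[p q]; rewrite !inE !xpair_eqE andbC [(q == _) && _]andbC
    -!(andbC (_ \in E)).
apply: has_cover_swap; apply: (@cover_exchange_left _ _ _ k z x y) => //.
- by rewrite inE.
- rewrite -sw; apply: has_cover_swap.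
  suff -> : swap_set (swap_set (E :\ (x, z))) = E :\ (x, z) by [].
  by apply/setP => -[p q]; rewrite !inE.
- rewrite -sw; apply: has_cover_swap.
  suff -> : swap_set (swap_set (E :\ (y, z))) = E :\ (y, z) by [].
  by apply/setP => -[p q]; rewrite !inE.
Qed.

(* A bipartite graph all of whose arcs are critical for the cover number is a
   matching. *)
Theorem konig (T1 T2 : finType) (E : {set T1 * T2}) k :
  (exists M : {set T1 * T2}, [/\ M \subset E, is_matching M & #|M| = k]) \/
  (exists (X : {set T1}) (Y : {set T2}),
     (forall x y, (x, y) \in E -> (x \in X) || (y \in Y)) /\ #|X| + #|Y| < k).
Proof.
have [m] := ubnP #|E|; elim: m E => // m IH E; rewrite ltnS => Em.
case: (boolP (has_cover E k)) => [/has_coverP c|nc]; first by right.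
case: (boolP [exists e in E, ~~ has_cover (E :\ e) k]) => [/exists_inP[e eE ce]|].
  have lt : #|E :\ e| < m by move: Em; rewrite (cardsD1 e E) eE; lia.
  case: (IH _ lt) => [[M [ME iM cM]]|/has_coverP]; last by rewrite (negbTE ce).
  by left; exists M; split=> //; apply: subset_trans ME (subsetDl _ _).
rewrite negb_exists => /forallP crit; left.
have {}crit e : e \in E -> has_cover (E :\ e) k.
  by move=> eE; have := crit e; rewrite eE /= negbK.
have mE : is_matching E.
  split=> -[x y] [u v] /= e1 e2 eq.
    subst u; case: (eqVneq y v) => [->//|ne]; case/negP: nc.
    by apply: (@cover_exchange_left _ _ _ _ x y v) => //; apply: crit.
  subst v; case: (eqVneq x u) => [->//|ne]; case/negP: nc.
  by apply: (@cover_exchange_right _ _ _ _ x u y) => //; apply: crit.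
(* The first ends cover [E], so fewer than [k] arcs would leave a cover smaller than [k]. *)
have kE : k <= #|E|.
  rewrite leqNgt; apply/negP => lt; case/negP: nc; apply/has_coverP.
  exists [set e.1 | e in E], set0; rewrite cards0 addn0; split.
    by move=> x y xyE; apply/orP; left; apply/imsetP; exists (x, y).
  exact: leq_ltn_trans (leq_imset_card _ _) lt.
have [M ME cM] := exists_subset_card kE; exists M; split=> //.
by split=> e f eM fM; [apply: mE.1 | apply: mE.2]; apply: (subsetP ME).
Qed.

(** * Matchings and cycles in nearly complete digraphs *)

Lemma count_lt_exists (U : eqType) (P : pred U) (s : seq U) t :
  count (fun u => ~~ P u) s <= t -> t < size s -> exists2 u, u \in s & P u.
Proof.
move=> ct ts; apply/hasP; rewrite -[has _ _]negbK; apply/negP.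
rewrite -all_predC all_count => /eqP e.
by move: ct; rewrite (eq_count (a2 := predC P)) // e; lia.
Qed.

Lemma count2_lt_exists (U : eqType) (P Q : pred U) (s : seq U) t t' :
  count (fun u => ~~ P u) s <= t -> count (fun u => ~~ Q u) s <= t' ->
  t + t' < size s -> exists u, [/\ u \in s, P u & Q u].
Proof.
move=> cP cQ ts.
have [||u us /andP[Pu Qu]] := @count_lt_exists U (fun u => P u && Q u) s (t + t').
- apply: leq_trans (leq_add cP cQ); rewrite -count_predUI.
  by apply: leq_trans (leq_addr _ _); apply: sub_count => u /=; rewrite negb_and.
- by [].
by exists u.
Qed.

(** Greedy matching with exchange. While at most 2t pairs are made, more than t vertices of [vs] are
    free and one of them suits [u]. Afterwards some pair [p] satisfies [r u p.2] and [r p.1 v], as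
    at most t pairs fail each condition; it is replaced by the pairs (u, p.2) and (p.1, v). *)
Lemma pairing (U V : eqType) (r : U -> V -> bool) us vs t :
  size us = size vs ->
  (forall u, u \in us -> count (fun v => ~~ r u v) vs <= t) ->
  (forall v, v \in vs -> count (fun u => ~~ r u v) us <= t) ->
  3 * t + 1 <= size us ->
  exists ps : seq (U * V), [/\ perm_eq (unzip1 ps) us, perm_eq (unzip2 ps) vs &
    all (fun p => r p.1 p.2) ps].
Proof.
move=> suv cu cv tm.
have step j : j <= size us -> exists (ps : seq (U * V)) us' vs',
    [/\ size ps = j, perm_eq (unzip1 ps ++ us') us, perm_eq (unzip2 ps ++ vs') vs &
    all (fun p => r p.1 p.2) ps].
  elim: j => [_|j IH jm]; first by exists [::], us, vs.
  have [ps [us' [vs' [sj pu pv al]]]] := IH (ltnW jm).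
  have su := perm_size pu; have sv := perm_size pv.
  rewrite !size_cat !size_map in su sv.
  case: us' pu su => [|u us'] pu su; first by rewrite /= in su; lia.
  case: vs' pv sv => [|v vs'] pv sv; first by rewrite /= in sv; lia.
  have uus : u \in us by rewrite -(perm_mem pu) mem_cat inE eqxx orbT.
  have vvs : v \in vs by rewrite -(perm_mem pv) mem_cat inE eqxx orbT.
  have [le|gt] := leqP (size ps) (2 * t).
    have [||w wv ruw] := @count_lt_exists _ (r u) (v :: vs') t.
    - apply: leq_trans (cu _ uus); rewrite -(permP pv) count_cat; exact: leq_addl.
    - by move: sv => /=; lia.
    exists ((u, w) :: ps), us', (rem w (v :: vs')); split.
    + by rewrite /= sj.
    + by rewrite -(permPr pu) /= perm_sym -cat1s perm_catCA.
    + rewrite -(permPr pv) /= perm_sym.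
      apply: (@perm_trans _ (unzip2 ps ++ w :: rem w (v :: vs'))).
        by rewrite perm_cat2l perm_to_rem.
      by rewrite -cat1s perm_catCA.
    + by rewrite /= ruw.
  have [|||p [pp rup rpv]] :=
      @count2_lt_exists _ (fun p => r u p.2) (fun p => r p.1 v) ps t t.
  - apply: leq_trans (cu _ uus); rewrite -(permP pv) count_cat count_map.
    exact: leq_addr.
  - apply: leq_trans (cv _ vvs); rewrite -(permP pu) count_cat count_map.
    exact: leq_addr.
  - by rewrite addnn -mul2n.
  have pr := perm_to_rem pp.
  exists ((u, p.2) :: (p.1, v) :: rem p ps), us', vs'; split.
  + by rewrite /= size_rem //; case: (ps) pp sj => //= *; lia.
  + rewrite -(permPr pu) /= perm_sym.
    apply: (@perm_trans _ ((p.1 :: unzip1 (rem p ps)) ++ u :: us')).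
      by rewrite perm_cat2r; exact: (perm_map (@fst U V) pr).
    by rewrite -(cat1s u us') perm_catCA.
  + rewrite -(permPr pv) /= perm_sym.
    apply: (@perm_trans _ ((p.2 :: unzip2 (rem p ps)) ++ v :: vs')).
      by rewrite perm_cat2r; exact: (perm_map (@snd U V) pr).
    by rewrite /= perm_cons -(cat1s v vs') perm_catCA.
  + rewrite /= rup rpv /=; apply/allP => z zr; apply: (allP al).
    exact: mem_rem zr.
have [ps [us' [vs' [sj pu pv al]]]] := step _ (leqnn _).
have su := perm_size pu; have sv := perm_size pv.
rewrite !size_cat !size_map in su sv.
have e1 : us' = [::] by apply: size0nil; lia.
have e2 : vs' = [::] by apply: size0nil; lia.
by exists ps; rewrite -(permPr pu) -(permPr pv) e1 e2 !cats0.
Qed.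

(* If [u] fits into no arc of the cycle, each arc is spoiled at one of its ends. *)
Lemma cycle_insert (U : eqType) (r : rel U) (c : seq U) u t :
  cycle r c -> count (fun v => ~~ r v u) c <= t -> count (fun v => ~~ r u v) c <= t ->
  2 * t < size c -> exists2 c', perm_eq c' (u :: c) & cycle r c'.
Proof.
move=> cyc c1 c2 tc.
have cnt (P : pred U) (s : seq U) : count P s = count (fun i => P (nth u s i)) (iota 0 (size s)).
  by rewrite -(count_map (nth u s) P) map_nth_iota0 // take_size.
have [|||i [ii r1 r2]] := @count2_lt_exists _ (fun i => r (nth u c i) u)
    (fun i => r u (nth u (rot 1 c) i)) (iota 0 (size c)) t t.
- by rewrite -(cnt (fun v => ~~ r v u)).
- rewrite -{1}(size_rot 1 c) -(cnt (fun v => ~~ r u v)).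
  by have /permP-> : perm_eq (rot 1 c) c by rewrite perm_rot.
- by rewrite size_iota; lia.
rewrite mem_iota add0n /= in ii.
have cr : cycle r (rot i c) by rewrite rot_cycle.
have sr : rot i c = nth u c i :: behead (rot i c).
  by rewrite /rot (drop_nth u ii).
have hd : head u (rcons (behead (rot i c)) (nth u c i)) = nth u (rot 1 c) i.
  have e : nth u (rot 1 (rot i c)) 0 = nth u (rot 1 c) i.
    rewrite rot_rot; have : i < size (rot 1 c) by rewrite size_rot.
    by move=> li; rewrite /(rot i) (drop_nth u li).
  by rewrite -e sr rot1_cons nth0.
move: cr hd; rewrite sr /=; set p := behead _ => cr hd.
exists (u :: rcons p (nth u c i)).
  by rewrite perm_cons perm_rcons -sr perm_rot.
rewrite /= rcons_path last_rcons r1 andbT.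
by case: p cr hd {sr} => [|v p] /=; [move=> _ -> ; rewrite r2 | move=> /andP[_ ->] ->; rewrite r2].
Qed.

(** A greedy path is closed to a cycle through one vertex that fits both ends; the other vertices
    are then inserted one at a time, which [cycle_insert] permits on any cycle longer than 2t. *)
Lemma near_complete_cycle (U : eqType) (r : rel U) (s : seq U) t :
  (forall u, u \in s -> count (fun v => ~~ r u v) s <= t) ->
  (forall v, v \in s -> count (fun u => ~~ r u v) s <= t) ->
  5 * t + 5 <= size s -> exists2 c, perm_eq c s & cycle r c.
Proof.
move=> c1 c2 ts.
have lng j : t + j + 1 <= size s -> exists x p rest,
    [/\ size p = j, perm_eq ((x :: p) ++ rest) s & path r x p].
  elim: j => [_|j IH js].
    by case: s ts {c1 c2} => [|x s] /= ts; [lia | exists x, [::], s].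
  have [|x [p [rest [sp pe pt]]]] := IH; first by lia.
  have sz := perm_size pe; rewrite size_cat /= in sz.
  have [||w wr rw] := @count_lt_exists _ (r (last x p)) rest t.
  - have ls : last x p \in s by rewrite -(perm_mem pe) mem_cat mem_last.
    by apply: leq_trans (c1 _ ls); rewrite -(permP pe) count_cat leq_addl.
  - by lia.
  exists x, (rcons p w), (rem w rest); split.
  + by rewrite size_rcons sp.
  + rewrite -(permPr pe) -rcons_cons cat_rcons perm_sym perm_cat2l.
    exact: perm_to_rem.
  + by rewrite rcons_path pt.
(* The path has 2t + 2 vertices, so closing it gives a cycle long enough for insertions; at least 3t
   + 3 vertices are left to choose the closing one from. *)
have [|x [p [rest [sp pe pt]]]] := lng (2 * t + 1); first by lia.
have sz := perm_size pe; rewrite size_cat /= in sz.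
have [|||w [wr r1 r2]] := @count2_lt_exists _ (r (last x p)) (fun w => r w x) rest t t.
- have ls : last x p \in s by rewrite -(perm_mem pe) mem_cat mem_last.
  by apply: leq_trans (c1 _ ls); rewrite -(permP pe) count_cat leq_addl.
- have xs : x \in s by rewrite -(perm_mem pe) inE eqxx.
  by apply: leq_trans (c2 _ xs); rewrite -(permP pe) count_cat leq_addl.
- by lia.
have ins rs c : perm_eq (c ++ rs) s -> cycle r c -> 2 * t < size c ->
    exists2 c', perm_eq c' s & cycle r c'.
  elim: rs c => [|u rs IH] c; first by rewrite cats0; exists c.
  move=> pc cc tc.
  have us : u \in s by rewrite -(perm_mem pc) mem_cat inE eqxx orbT.
  have [||||c' pc' cc'] := @cycle_insert _ r c u t.
  - exact: cc.
  - by apply: leq_trans (c2 _ us); rewrite -(permP pc) count_cat leq_addr.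
  - by apply: leq_trans (c1 _ us); rewrite -(permP pc) count_cat leq_addr.
  - exact: tc.
  apply: (IH c') => //; last by rewrite (perm_size pc') /=; apply: leq_trans tc _.

  apply: perm_trans pc; apply: (@perm_trans _ ((u :: c) ++ rs)).
    by rewrite perm_cat2r.
  by rewrite -(cat1s u rs) perm_sym perm_catCA.
apply: (ins (rem w rest) (x :: rcons p w)).
- rewrite -(permPr pe) -rcons_cons cat_rcons perm_sym perm_cat2l.
  exact: perm_to_rem.
- by rewrite /= !rcons_path pt r1 last_rcons r2.
- by rewrite /= size_rcons; lia.
Qed.

(** * Disjoint directed paths *)

Lemma set_pick (T : finType) (R : {set T}) (P : pred T) t :
  #|[set x in R | ~~ P x]| <= t -> t < #|R| -> exists2 x, x \in R & P x.
Proof.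
move=> c tR; have /subsetPn[x xR] : ~~ (R \subset [set x in R | ~~ P x]).
  by apply/negP => /subset_leq_card; lia.
by rewrite inE xR /= negbK => Px; exists x.
Qed.

Lemma set_pick2 (T : finType) (R : {set T}) (P Q : pred T) t t' :
  #|[set x in R | ~~ P x]| <= t -> #|[set x in R | ~~ Q x]| <= t' ->
  t + t' < #|R| -> exists x, [/\ x \in R, P x & Q x].
Proof.
move=> cP cQ tR.
have [|x xR /andP[Px Qx]] := @set_pick _ R (fun x => P x && Q x) (t + t') _ tR.
  apply: leq_trans (leq_add cP cQ); rewrite -cardsUI.
  apply: leq_trans (leq_addr _ _); apply/subset_leq_card/subsetP => x.
  by rewrite !inE negb_and; case: (x \in R).
by exists x.
Qed.

Lemma count_leq_card (T : finType) (U : {set T}) (P : pred T) s :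
  uniq s -> {subset s <= U} -> count P s <= #|[set x in U | P x]|.
Proof.
move=> us sU; rewrite -size_filter.
have /card_uniqP <- := filter_uniq P us.
apply/subset_leq_card/subsetP => x; rewrite mem_filter !inE => /andP[Px /sU ->].
by rewrite Px.
Qed.

Definition near_complete (T : finType) (g : rel T) (U V : {set T}) t :=
  (forall u, u \in U -> #|[set v in V | ~~ g u v]| <= t) /\
  (forall v, v \in V -> #|[set u in U | ~~ g u v]| <= t).

(** Without loops [u] counts among its own non-neighbours, so [t] is at least 1 as soon as [U] is
    nonempty. *)
Definition near_tournament (T : finType) (g : rel T) (U : {set T}) t :=
  forall u, u \in U -> #|[set v in U | ~~ (g u v || g v u)]| <= t.

Lemma subset_filter_card (T : finType) (U V : {set T}) (P : pred T) t :
  U \subset V -> #|[set x in V | P x]| <= t -> #|[set x in U | P x]| <= t.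
Proof.
move=> UV; apply: leq_trans; apply/subset_leq_card/subsetP => x; rewrite !inE.
by move=> /andP[/(subsetP UV)-> ->].
Qed.

(* A nonempty directed path is a pair: its first vertex and the list of the
   following ones. *)
Section Dipaths.
Variable T : finType.
Implicit Types (g : rel T) (u v : T * seq T) (us vs : seq (T * seq T)).

Definition first u : T := u.1.
Definition final u : T := last u.1 u.2.
Definition verts u : seq T := u.1 :: u.2.
Definition dipath g u := path g u.1 u.2.
Definition join u v : T * seq T := (u.1, u.2 ++ verts v).
Definition all_verts us : seq T := flatten (map verts us).
Definition single (x : T) : T * seq T := (x, [::]).

Lemma verts_join u v : verts (join u v) = verts u ++ verts v.
Proof. by []. Qed.

Lemma final_join u v : final (join u v) = final v.
Proof. by rewrite /final last_cat. Qed.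

Lemma dipath_join g u v :
  dipath g (join u v) = [&& dipath g u, g (final u) (first v) & dipath g v].
Proof. by rewrite /dipath /join cat_path. Qed.

Lemma final_verts u : final u \in verts u.
Proof. exact: mem_last. Qed.

Lemma all_verts_single (s : seq T) : all_verts (map single s) = s.
Proof. by elim: s => //= x s; rewrite /all_verts /= => ->. Qed.

Lemma all_verts_cons u us : all_verts (u :: us) = verts u ++ all_verts us.
Proof. by []. Qed.

Lemma all_verts_cat us vs : all_verts (us ++ vs) = all_verts us ++ all_verts vs.
Proof. by rewrite /all_verts map_cat flatten_cat. Qed.

Lemma perm_all_verts us vs : perm_eq us vs -> perm_eq (all_verts us) (all_verts vs).
Proof. by move=> p; apply/perm_flatten/perm_map. Qed.

Lemma sub_all_verts us (f : T * seq T -> T) :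
  (forall u, f u \in verts u) -> {subset map f us <= all_verts us}.
Proof.
move=> fv x /mapP[u uus ->]; apply/flattenP; exists (verts u) => //.
exact: map_f.
Qed.

Lemma uniq_all_verts us (f : T * seq T -> T) :
  (forall u, f u \in verts u) -> uniq (all_verts us) -> uniq (map f us).
Proof.
move=> fv; elim: us => // u us IH.
rewrite all_verts_cons cat_uniq => /and3P[_ /hasPn h /IH us_uniq] /=; rewrite us_uniq.
by rewrite andbT; apply/negP => /(sub_all_verts fv) /h; rewrite /= fv.
Qed.

Lemma all_verts_pairs (ps : seq ((T * seq T) * (T * seq T))) :
  perm_eq (all_verts [seq join p.1 p.2 | p <- ps])
          (all_verts (unzip1 ps) ++ all_verts (unzip2 ps)).
Proof.
elim: ps => // p ps IH; rewrite /unzip1 /unzip2 !map_cons.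
rewrite !all_verts_cons verts_join -!catA perm_cat2l.
apply: (@perm_trans _ (verts p.2 ++ (all_verts (unzip1 ps) ++ all_verts (unzip2 ps)))).
  by rewrite perm_cat2l.
by rewrite perm_catCA.
Qed.

(** Paths act as vertices of an auxiliary digraph, with arcs from last to first vertices; a cycle
    there unfolds into a cycle of [g]. *)
Lemma cycle_all_verts g us : us != [::] ->
  cycle (fun u v => g (final u) (first v)) us -> all (dipath g) us ->
  cycle g (all_verts us).
Proof.
case: us => // u us _.
have pth w s : path (fun u v => g (final u) (first v)) w s -> dipath g w ->
    all (dipath g) s ->
    path g w.1 (w.2 ++ all_verts s) && (last w.1 (w.2 ++ all_verts s) == final (last w s)).
  elim: s w => [|v s IH] w /=; first by rewrite cats0 /final eqxx andbT.
  move=> /andP[wv pv] dw /andP[dv ds]; have /andP[p1 /eqP p2] := IH v pv dv ds.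
  rewrite /dipath in dw; rewrite /final /first in wv.
  by rewrite all_verts_cons cat_path last_cat dw /= wv p1 p2 eqxx.
rewrite /= rcons_path => /andP[pu lu] /andP[du dus].
have /andP[p1 /eqP p2] := pth u us pu du dus.
by rewrite /= rcons_path p1 p2.
Qed.

(** [pairing] is applied to the paths themselves, related through their ends. The ends have to be
    distinct because the bound in [near_complete] counts vertices, while [pairing] counts paths. *)
Lemma join_lists g us vs (U V : {set T}) t :
  near_complete g U V t -> size us = size vs -> (size us = 0 \/ 3 * t + 1 <= size us) ->
  uniq (map final us) -> uniq (map first vs) ->
  {subset map final us <= U} -> {subset map first vs <= V} ->
  all (dipath g) us -> all (dipath g) vs ->
  exists ws, [/\ size ws = size us, perm_eq (all_verts ws) (all_verts us ++ all_verts vs),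
    perm_eq (map first ws) (map first us), perm_eq (map final ws) (map final vs) &
    all (dipath g) ws].
Proof.
move=> [n1 n2] suv [s0|s1] uu uv sU sV du dv.
  have e1 : us = [::] by apply: size0nil.
  have e2 : vs = [::] by apply: size0nil; rewrite -suv.
  by exists [::]; rewrite e1 e2.
have [||ps [p1 p2 al]] := @pairing _ _ (fun u v => g (final u) (first v)) us vs t suv _ _ s1.
- move=> u uus; have fU : final u \in U by apply/sU/map_f.
  rewrite -(count_map first (fun x => ~~ g (final u) x)).
  by apply: leq_trans (n1 _ fU); apply: count_leq_card.
- move=> v vvs; have fV : first v \in V by apply/sV/map_f.
  rewrite -(count_map final (fun x => ~~ g x (first v))).
  by apply: leq_trans (n2 _ fV); apply: count_leq_card.
exists [seq join p.1 p.2 | p <- ps]; split.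
- by rewrite size_map -(perm_size p1) size_map.
- apply: perm_trans (all_verts_pairs _) _.
  by apply: perm_cat; apply: perm_all_verts.
- by rewrite -map_comp; apply: perm_trans (perm_map first p1); rewrite -map_comp.
- rewrite -map_comp; apply: perm_trans (perm_map final p2); rewrite -map_comp.
  by rewrite (eq_map (g := final \o snd)) // => p; rewrite /= final_join.
- rewrite all_map; apply/allP => p pps; rewrite /= dipath_join (allP al p pps) andTb.
  rewrite (allP du) ?(allP dv) //.
    by rewrite -(perm_mem p2); apply: map_f.
  by rewrite -(perm_mem p1); apply: map_f.
Qed.

Lemma close_lists g us (U V : {set T}) t :
  near_complete g U V t -> 5 * t + 5 <= size us ->
  uniq (map final us) -> uniq (map first us) ->
  {subset map final us <= U} -> {subset map first us <= V} ->
  all (dipath g) us ->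
  exists c, [/\ c != [::], cycle g c & perm_eq c (all_verts us)].
Proof.
move=> [n1 n2] st uu uv sU sV du.
have [|||ws pw cw] := @near_complete_cycle _ (fun u v => g (final u) (first v)) us t.
- move=> u uus; have fU : final u \in U by apply/sU/map_f.
  rewrite -(count_map first (fun x => ~~ g (final u) x)).
  by apply: leq_trans (n1 _ fU); apply: count_leq_card.
- move=> v vvs; have fV : first v \in V by apply/sV/map_f.
  rewrite -(count_map final (fun x => ~~ g x (first v))).
  by apply: leq_trans (n2 _ fV); apply: count_leq_card.
- exact: st.
have w0 : ws != [::].
  by apply/negP => /eqP e; move: (perm_size pw) st; rewrite e /=; lia.
exists (all_verts ws); split.
- by case: (ws) w0.
- by apply: cycle_all_verts => //; rewrite (perm_all _ pw).
- exact: perm_all_verts.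
Qed.

Lemma enum_setD1 (A : {set T}) x : x \in A -> perm_eq (enum A) (x :: enum (A :\ x)).
Proof.
move=> xA; apply: uniq_perm; rewrite ?enum_uniq //=.
  by rewrite mem_enum !inE eqxx enum_uniq.
by move=> y; rewrite inE !mem_enum !inE; case: eqVneq => [->|].
Qed.

(* The surplus over [m] is removed by joining vertices three at a time, or two
   when one is left: three pairwise adjacent vertices always carry a path. *)
Lemma tournament_paths g (C D : {set T}) t m :
  irreflexive g -> near_tournament g C t -> D \subset C ->
  m <= #|D| -> #|D| + (6 * t + 9) <= 3 * m ->
  exists us, [/\ size us = m, perm_eq (all_verts us) (enum D) & all (dipath g) us].
Proof.
move=> irr nt; have [j] := ubnP (#|D| - m); elim: j D m => // j IH D m.
rewrite ltnS => dj DC mD tD.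
have adj x (E : {set T}) : x \in C -> E \subset C ->
    #|[set v in E | ~~ (g x v || g v x)]| <= t.
  by move=> xC EC; apply: subset_filter_card EC (nt x xC).
have [e|gt] := leqP #|D| m.
  exists (map single (enum D)); rewrite size_map -cardE all_verts_single; split=> //.
    by lia.
  by rewrite all_map; apply/allP.
have ladj x y : g x y || g y x -> x != y.
  by case: eqVneq => // ->; rewrite irr.
have /card_gt0P[x xD] : 0 < #|D| by lia.
have xC := subsetP DC _ xD.
have [|y yD xy] := set_pick (adj x D xC DC); first by lia.
have yC := subsetP DC _ yD; have nxy := ladj _ _ xy.
have yDx : y \in D :\ x by rewrite !inE yD eq_sym nxy.
have cx := cardsD1 x D; rewrite xD in cx.
have cy := cardsD1 y (D :\ x); rewrite yDx in cy.
have px := enum_setD1 xD; have py := enum_setD1 yDx.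
have [e1|gt1] := leqP #|D| m.+1.
  set F := D :\ x :\ y in cy py.
  have [u [vu du]] : exists u, perm_eq (verts u) [:: x; y] /\ dipath g u.
    case/orP: xy => xy; first by exists (x, [:: y]); rewrite /dipath /= xy.
    exists (y, [:: x]); rewrite /dipath /= xy; split=> //.
    exact/permPl/(perm_catC [:: y] [:: x]).
  exists (u :: map single (enum F)); split.
  - by rewrite /= size_map -cardE; clear - cx cy gt e1; lia.
  - rewrite perm_sym; apply: (perm_trans px).
    apply: (@perm_trans _ (x :: y :: enum F)); first by rewrite perm_cons.
    rewrite all_verts_cons all_verts_single perm_sym.
    exact: (perm_cat vu (perm_refl (enum F))).
  - by rewrite /= du /= all_map; apply/allP.
have [|z [zD xz yz]] := set_pick2 (adj x D xC DC) (adj y D yC DC).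
  by clear - tD gt1; lia.
have zC := subsetP DC _ zD; have nxz := ladj _ _ xz; have nyz := ladj _ _ yz.
have zDxy : z \in D :\ x :\ y by rewrite !inE zD ![z == _]eq_sym nyz nxz.
have cz := cardsD1 z (D :\ x :\ y); rewrite zDxy in cz.
have pz := enum_setD1 zDxy; set F := D :\ x :\ y :\ z in cz pz.
have [u [vu du]] : exists u, perm_eq (verts u) [:: x; y; z] /\ dipath g u.
  have mk a b c : perm_eq [:: a; b; c] [:: x; y; z] -> g a b -> g b c ->
      exists u, perm_eq (verts u) [:: x; y; z] /\ dipath g u.
    by move=> p ab bc; exists (a, [:: b; c]); rewrite /dipath /= ab bc.
  have P a b c : perm_eq [:: a; b; c] [:: a; b; c] by [].
  case/orP: xy => xy; case/orP: yz => yz; case/orP: xz => xz.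
  - exact: (mk x y z).
  - exact: (mk x y z).
  - by apply: (mk x z y) => //; rewrite perm_cons; exact/permPl/(perm_catC [:: z] [:: y]).
  - by apply: (mk z x y) => //; exact/permPl/(perm_catC [:: z] [:: x; y]).
  - by apply: (mk y x z) => //; exact/permPl/(perm_catCA [:: y] [:: x] [:: z]).
  - by apply: (mk y z x) => //; exact/permPl/(perm_catC [:: y; z] [:: x]).
  - by apply: (mk z y x) => //; exact/permPl/(perm_rev [:: x; y; z]).
  - by apply: (mk z y x) => //; exact/permPl/(perm_rev [:: x; y; z]).
(* Three vertices become one path: |D| drops by 3 and m by 1, which preserves |D| + 6t + 9 <= 3m.
   Also m <= |D| survives, because |D| >= m + 2 at this point. *)
have [||||us [su pu al]] := IH F m.-1.
- by clear - cx cy cz gt gt1 dj; lia.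
- by apply: subset_trans DC; apply/subsetP => v; rewrite !inE => /and4P[].
- by clear - cx cy cz gt gt1 tD; lia.
- by clear - cx cy cz gt gt1 tD; lia.
exists (u :: us); split.
- by rewrite /= su; clear - tD; lia.
- rewrite perm_sym; apply: (perm_trans px).
  apply: (@perm_trans _ ([:: x; y; z] ++ enum F)).
    by rewrite /= perm_cons; apply: (perm_trans py); rewrite perm_cons.
  rewrite perm_sym all_verts_cons; exact: (perm_cat vu pu).
- by rewrite /= du.
Qed.

End Dipaths.

(** * Counting arcs under the Ore condition *)

Definition converse (T : finType) (g : rel T) : rel T := fun x y => g y x.

(** The truncated subtraction is harmless: a pair [x != y] forces at least two vertices. *)
Definition ore_condition (T : finType) (g : rel T) :=
  forall x y, x != y -> ~~ g x y -> 3 * #|T| - 3 <= 4 * (outdeg g x + indeg g y).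

Lemma leq_sum_lin (I : finType) (P : pred I) (F G H : I -> nat) a b c :
  (forall i, P i -> a * F i <= b * G i + c * H i) ->
  a * (\sum_(i | P i) F i) <= b * (\sum_(i | P i) G i) + c * (\sum_(i | P i) H i).
Proof. by move=> h; rewrite !big_distrr -big_split /=; apply: leq_sum. Qed.

Section Arcs.
Variables (T : finType) (g : rel T).
Implicit Types (X Y P Q Z D : {set T}).
Local Notation n := #|T|.

Lemma card_set_sum (A : {set T}) (P : pred T) : #|[set x in A | P x]| = \sum_(x in A) P x.
Proof.
rewrite -sum1_card (eq_bigl (fun x => (x \in A) && P x)); last by move=> x; rewrite inE.
by rewrite big_mkcondr; apply: eq_bigr => x _; case: (P x).
Qed.

Lemma arcsE X Y : arcs g X Y = \sum_(x in X) #|[set y in Y | g x y]|.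
Proof.
rewrite /arcs -sum1_card.
rewrite (eq_bigl (fun p => (p.1 \in X) && ((p.2 \in Y) && g p.1 p.2))); last first.
  by case=> x y; rewrite !inE andbA.
rewrite -(pair_big_dep (fun x => x \in X) (fun x y => (y \in Y) && g x y) (fun _ _ => 1)) /=.
apply: eq_bigr => x _; rewrite -sum1_card; apply: eq_bigl => y; by rewrite inE.
Qed.

Lemma arcs_sum X Y : arcs g X Y = \sum_(x in X) \sum_(y in Y) g x y.
Proof. by rewrite arcsE; apply: eq_bigr => x _; rewrite card_set_sum. Qed.

Lemma arcsEr X Y : arcs g X Y = \sum_(y in Y) #|[set x in X | g x y]|.
Proof.
rewrite arcs_sum exchange_big; apply: eq_bigr => y _.
by rewrite card_set_sum.
Qed.

End Arcs.

Section OreSums.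
Variables (T : finType) (g : rel T).
Implicit Types (X Y P Q Z D : {set T}).
Local Notation n := #|T|.

Lemma arcs_converse X Y : arcs (converse g) X Y = arcs g Y X.
Proof. by rewrite arcsE arcsEr. Qed.

Lemma arcs_leq X Y : arcs g X Y <= #|X| * #|Y|.
Proof.
rewrite arcsE -sum_nat_const; apply: leq_sum => x _.
by apply/subset_leq_card/subsetP => y; rewrite inE => /andP[].
Qed.

Lemma arcs_setIr X Y Z : arcs g X Y = arcs g X (Y :&: Z) + arcs g X (Y :\: Z).
Proof.
rewrite !arcs_sum -big_split; apply: eq_bigr => x _ /=.
by rewrite (big_setID Z).
Qed.

Lemma arcs_subset X Y X' Y' : X \subset X' -> Y \subset Y' -> arcs g X Y <= arcs g X' Y'.
Proof.
move=> sX sY; apply/subset_leq_card/subsetP => -[x y]; rewrite !inE /=.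
by move=> /andP[/andP[/(subsetP sX)-> /(subsetP sY)->] ->].
Qed.

Lemma arcs_eq0 X Y : (forall x y, x \in X -> y \in Y -> ~~ g x y) -> arcs g X Y = 0.
Proof.
move=> h; apply/eqP; rewrite cards_eq0; apply/eqP/setP => -[x y]; rewrite !inE /=.
by apply/negP => /andP[/andP[xX yY]]; apply/negP/h.
Qed.

Lemma sum_outdeg X : \sum_(x in X) outdeg g x = arcs g X setT.
Proof. by rewrite arcsE; apply: eq_bigr => x _; apply: eq_card => y; rewrite !inE. Qed.

Lemma sum_indeg Y : \sum_(y in Y) indeg g y = arcs g setT Y.
Proof. by rewrite arcsEr; apply: eq_bigr => x _; apply: eq_card => y; rewrite !inE. Qed.

Hypothesis og : oriented_graph g.

Lemma arcs_oriented X Y : arcs g X Y + arcs g Y X <= #|X| * #|Y|.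
Proof.
rewrite -[arcs g Y X]arcs_converse !arcsE -sum_nat_const -big_split.
apply: leq_sum => x _; rewrite !card_set_sum -big_split -sum1_card.
apply: leq_sum => y _; have := og.2 x y; rewrite /converse.
by case: (g x y); case: (g y x).
Qed.

Lemma arcs_self X : 2 * arcs g X X <= #|X| * #|X|.-1.
Proof.
rewrite mul2n -addnn -{1}[arcs g X X]arcs_converse !arcsE -sum_nat_const -big_split.
apply: leq_sum => x xX /=; rewrite !card_set_sum -big_split (big_setD1 x) //=.
rewrite /converse og.1 (cardsD1 x X) xX /= -sum1_card.
by apply: leq_sum => y _; have := og.2 x y; case: (g x y); case: (g y x).
Qed.

Lemma sum_outdeg_bound P Z : P \subset Z ->
  2 * (\sum_(x in P) outdeg g x) <=
  #|P| * #|P|.-1 + 2 * (#|P| * (#|Z| - #|P|)) + 2 * arcs g P (~: Z).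
Proof.
move=> PZ; rewrite sum_outdeg (arcs_setIr P setT Z) setTI setTD.
rewrite (arcs_setIr P Z P) (setIidPr PZ).
have h1 := arcs_self P; have h2 := arcs_leq P (Z :\: P).
rewrite cardsD (setIidPr PZ) in h2.
by clear - h1 h2; lia.
Qed.

Hypothesis ore : ore_condition g.

(** Sum over all pairs of P and Q: a pair that is no arc contributes its Ore inequality, while an
    arc is charged the whole bound 3n - 3. *)
Lemma ore_average P Q : [disjoint P & Q] ->
  (3 * n - 3) * (#|P| * #|Q|) <=
  4 * (#|Q| * (\sum_(x in P) outdeg g x) + #|P| * (\sum_(y in Q) indeg g y)) +
  (3 * n - 3) * arcs g P Q.
Proof.
move=> dPQ.
have -> : #|Q| * (\sum_(x in P) outdeg g x) + #|P| * (\sum_(y in Q) indeg g y)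
          = \sum_(x in P) \sum_(y in Q) (outdeg g x + indeg g y).
  rewrite [RHS](eq_bigr (fun x => #|Q| * outdeg g x + \sum_(y in Q) indeg g y)).
    by rewrite big_split /= -big_distrr /= sum_nat_const.
  by move=> x _; rewrite big_split /= sum_nat_const.
have -> : #|P| * #|Q| = \sum_(x in P) \sum_(y in Q) 1.
  by rewrite -sum_nat_const; apply: eq_bigr => x _; rewrite sum1_card.
rewrite arcs_sum; apply: leq_sum_lin => x xP; apply: leq_sum_lin => y yQ.
have xy : x != y by apply: contraTneq yQ => <-; rewrite (disjointFr dPQ).
by case: (boolP (g x y)) => [_|/(ore xy)]; rewrite muln1 ?leq_addl // muln0 addn0.
Qed.

(** The sum runs over ordered pairs of distinct vertices, so each degree occurs |D| - 1 times.
    Without 2-cycles a vertex of [D] has at most n - |D| arcs to and from the outside together,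
    which bounds the degree sum. *)
Lemma ore_average_self D :
  (3 * n - 3) * (#|D| * #|D|.-1) <=
  4 * (#|D|.-1 * (#|D| * (n - #|D|) + 2 * arcs g D D)) + (3 * n - 3) * arcs g D D.
Proof.
have h : \sum_(x in D) outdeg g x + \sum_(x in D) indeg g x <=
         #|D| * (n - #|D|) + 2 * arcs g D D.
  rewrite sum_outdeg sum_indeg -[arcs g setT D]arcs_converse.
  rewrite (arcs_setIr D setT D) setTI setTD -arcs_converse.
  have -> : arcs (converse g) D setT = arcs (converse g) D D + arcs (converse g) D (~: D).
    rewrite !arcs_sum -big_split; apply: eq_bigr => x _ /=.
    by rewrite (big_setID D) setTI setTD.
  rewrite !arcs_converse.
  have := arcs_oriented D (~: D); rewrite [#|~: D|]cardsCs setCK.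
  by lia.
apply: leq_trans (leq_add (leq_mul (leqnn 4) (leq_mul (leqnn #|D|.-1) h)) (leqnn _)).
rewrite mulnDr.
have -> : #|D|.-1 * (\sum_(x in D) outdeg g x) + #|D|.-1 * (\sum_(x in D) indeg g x)
   = \sum_(x in D) \sum_(y in D | x != y) (outdeg g x + indeg g y).
  rewrite [RHS](eq_bigr (fun x => #|D|.-1 * outdeg g x + \sum_(y in D | x != y) indeg g y)).
    rewrite big_split /= -big_distrr /=; congr (_ + _).
    rewrite (exchange_big_dep (fun y => y \in D)) /=; last by move=> ? ? _ /andP[].
    rewrite [LHS]big_distrr /=; apply: eq_bigr => y yD.
    rewrite sum_nat_const; congr (_ * _).
    rewrite (cardsD1 y D) yD /=; apply: eq_card => x.
    by rewrite !inE andbC.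
  move=> x xD; rewrite big_split /= sum_nat_const; congr (_ * _ + _).
  rewrite (cardsD1 x D) xD /=; apply: eq_card => y.
  by rewrite !inE andbC eq_sym.
have -> : #|D| * #|D|.-1 = \sum_(x in D) \sum_(y in D | x != y) 1.
  rewrite -sum_nat_const; apply: eq_bigr => x xD; rewrite sum1_card.
  by rewrite (cardsD1 x D) xD /=; apply: eq_card => y; rewrite !inE andbC eq_sym.
rewrite arcs_sum; apply: leq_sum_lin => x xD.
apply: (@leq_trans (4 * (\sum_(y in D | x != y) (outdeg g x + indeg g y)) +
   (3 * n - 3) * \sum_(y in D | x != y) g x y)); last first.
  rewrite leq_add2l leq_mul2l; apply/orP; right.
  by rewrite [leqRHS](bigID (fun y => x != y)) leq_addr.
apply: leq_sum_lin => y /andP[yD xy].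
by case: (boolP (g x y)) => [_|/(ore xy)]; rewrite muln1 ?leq_addl // muln0 addn0.
Qed.

End OreSums.

Section MinDegree.
Variables (T : finType) (g : rel T).
Local Notation n := #|T|.

Lemma oriented_converse : oriented_graph g -> oriented_graph (converse g).
Proof. by move=> [irr asym]; split=> // x y; rewrite andbC; apply: asym. Qed.

Lemma ore_converse : ore_condition g -> ore_condition (converse g).
Proof.
move=> o x y xy nyx; have yx : y != x by rewrite eq_sym.
by rewrite addnC; exact: (o y x yx nyx).
Qed.

Lemma hamilton_converse : has_hamilton_cycle (converse g) -> has_hamilton_cycle g.
Proof.
move=> [c [c0 cc uc ac]]; exists (rev c); split.
- by rewrite -size_eq0 size_rev size_eq0.
- by rewrite rev_cycle.
- by rewrite rev_uniq.
- by move=> x; rewrite mem_rev.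
Qed.

(** Average over [x] and the set [Q] of its non-out-neighbours, whose indegrees sum to at most n(n -
    1)/2. An outdegree s < (n - 1)/8 would make both 3n - 3 - 4s > 5(n - 1)/2 and |Q| > 7(n - 1)/8;
    the product exceeds 35(n - 1)^2/16, but it is at most 2n(n - 1). *)
Lemma outdeg_lower x : oriented_graph g -> ore_condition g -> 50 <= n ->
  n <= 8 * outdeg g x + 1.
Proof.
move=> og ore n50; rewrite leqNgt; apply/negP => lt.
pose Q := [set y | (y != x) && ~~ g x y].
have dQ : [disjoint [set x] & Q] by rewrite disjoints1 inE eqxx.
have := ore_average ore dQ.
have -> : arcs g [set x] Q = 0.
  by apply: arcs_eq0 => ? y /set1P-> ; rewrite inE => /andP[].
rewrite cards1 big_set1 mul1n muln0 addn0 sum_indeg.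
have cQ : #|Q| + outdeg g x + 1 = n.
  have -> : Q = ~: (x |: [set y | g x y]) by apply/setP => y; rewrite !inE negb_or.
  have := cardsC (x |: [set y | g x y]); rewrite cardsU1 inE og.1 /= /outdeg.
  by lia.
have := arcs_subset g (subxx [set: T]) (subsetT Q).
have := arcs_self og [set: T]; rewrite cardsT.
move: (outdeg g x) (arcs g setT setT) (arcs g setT Q) lt cQ n50.
move: #|Q| #|T| => q N s e1 e2 lt cQ n50 h1 h2 h3.
have {}h3 : (3 * N - 3) * q <= 4 * (q * s) + 2 * (N * N.-1) by lia.
clear h1 h2; case: N => [|N] in lt cQ n50 h3 *; first by lia.
have e : 3 * N.+1 - 3 = 3 * N by lia.
rewrite e /= in h3.
have eq : q = N - s by lia.
have : 8 * q >= 7 * N by lia.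
by nia.
Qed.

End MinDegree.

Lemma indeg_lower (T : finType) (g : rel T) x : oriented_graph g -> ore_condition g ->
  50 <= #|T| -> #|T| <= 8 * indeg g x + 1.
Proof.
by move=> og ore; apply: (outdeg_lower x (oriented_converse og) (ore_converse ore)).
Qed.

(** * Averaging against two large sets with almost no arcs between them *)

Section Forest.
Variables (T : finType) (g : rel T) (X Y X1 Y1 : {set T}).
Hypothesis og : oriented_graph g.
Local Notation n := #|T|.
Local Notation D := (X :&: Y).

Hypotheses (X1X : X1 \subset X) (Y1Y : Y1 \subset Y).
Hypothesis no_arc : forall x y, x \in X1 -> y \in Y1 -> g x y -> (x \in D) && (y \in D).

(** A vertex of [X1] outside [Y] sends nothing into [Y1], so its out-neighbours lie in the
    complement of [Y1]. This complement contains [X1 :\: Y] itself, where each pair carries at most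
    one arc. *)
Lemma sum_outdeg_left :
  2 * (\sum_(x in X1 :\: Y) outdeg g x) <=
  #|X1 :\: Y| * (#|X1 :\: Y|.-1 + 2 * (n - #|Y1| - #|X1 :\: Y|)).
Proof.
have sZ : X1 :\: Y \subset ~: Y1.
  by apply/subsetP => x; rewrite !inE => /andP[xY _]; apply: contra xY => /(subsetP Y1Y).
have := sum_outdeg_bound og sZ; rewrite setCK.
have -> : arcs g (X1 :\: Y) Y1 = 0.
  apply: arcs_eq0 => x y; rewrite !inE => /andP[xY xX1] yY1.
  by apply/negP => /(no_arc xX1 yY1); rewrite !inE (negbTE xY) andbF.
by rewrite muln0 addn0 [#|~: Y1|]cardsCs setCK mulnDr (mulnCA 2).
Qed.

Lemma card_split : #|X1| = #|X1 :\: Y| + #|D :&: X1|.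
Proof.
rewrite -(cardsID Y X1) addnC; congr (_ + #|pred_of_set _|).
by apply/setP => x; rewrite !inE; case: (boolP (x \in X1)) => [/(subsetP X1X)->|_];
  rewrite ?andbF ?andbT.
Qed.

Lemma card_left_leq : #|X1 :\: Y| + #|Y1| <= n.
Proof.
have dj : [disjoint X1 :\: Y & Y1].
  rewrite -setI_eq0; apply/eqP/setP => x; rewrite !inE.
  by apply/negP => /andP[/andP[xY _] /(subsetP Y1Y)]; rewrite (negbTE xY).
have := cardsUI (X1 :\: Y) Y1; rewrite (eqP (etrans (setI_eq0 _ _) dj)) cards0 addn0.
by move=> <-; apply: max_card.
Qed.

End Forest.

Lemma no_arc_converse (T : finType) (g : rel T) (X Y X1 Y1 : {set T}) :
  (forall x y, x \in X1 -> y \in Y1 -> g x y -> (x \in X :&: Y) && (y \in X :&: Y)) ->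
  forall y x, y \in Y1 -> x \in X1 -> converse g y x ->
    (y \in Y :&: X) && (x \in Y :&: X).
Proof. by move=> h y x yY xX gxy; rewrite setIC andbC; apply: h. Qed.

Section ForestCount.
Variables (T : finType) (g : rel T) (X Y X1 Y1 : {set T}) (w b : nat).
Hypotheses (og : oriented_graph g) (ore : ore_condition g).
Local Notation n := #|T|.
Local Notation D := (X :&: Y).
Hypotheses (X1X : X1 \subset X) (Y1Y : Y1 \subset Y).
Hypothesis no_arc : forall x y, x \in X1 -> y \in Y1 -> g x y -> (x \in D) && (y \in D).
Hypothesis size1 : n + 1 <= #|X1| + #|Y1|.
Hypothesis sizeD1 : #|D :&: X1| + #|D :&: Y1| + w <= 2 * #|D|.
Hypothesis sizeD : 4 * #|D| <= n + 3 + w.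

Let no_arc' := no_arc_converse no_arc.

Lemma sum_indeg_right :
  2 * (\sum_(y in Y1 :\: X) indeg g y) <=
  #|Y1 :\: X| * (#|Y1 :\: X|.-1 + 2 * (n - #|X1| - #|Y1 :\: X|)).
Proof. exact: (sum_outdeg_left (oriented_converse og) X1X no_arc'). Qed.

(** Let a, c be the sizes of [X1 :\: Y] and [Y1 :\: X], and d1, d2 those of [X1] and [Y1] inside
    [D]. Averaging between the two differences gives 3n - 3 <= 8n - 4(|X1| + |Y1|) - 2(a + c) - 4.
    With a + c = |X1| + |Y1| - d1 - d2 and |X1| + |Y1| > n this becomes n + 7 <= 2(d1 + d2), against
    2(d1 + d2) <= 4|D| - 2w <= n + 3 - w. *)
Lemma forest_count_two_sided : 0 < #|X1 :\: Y| -> 0 < #|Y1 :\: X| -> False.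
Proof.
move=> a0 c0.
have dj : [disjoint X1 :\: Y & Y1 :\: X].
  rewrite -setI_eq0; apply/eqP/setP => x; rewrite !inE.
  by apply/negP => /andP[/andP[_ /(subsetP X1X) xX]]; rewrite xX.
have := ore_average ore dj.
have -> : arcs g (X1 :\: Y) (Y1 :\: X) = 0.
  apply: arcs_eq0 => x y; rewrite !inE => /andP[xY xX1] /andP[_ yY1].
  by apply/negP => /(no_arc xX1 yY1); rewrite !inE (negbTE xY) andbF.
have := sum_indeg_right; have := sum_outdeg_left og Y1Y no_arc.
have := card_split Y X1X; have := card_split X Y1Y; rewrite [Y :&: X]setIC.
have := card_left_leq X1 Y1Y; have := card_left_leq Y1 X1X.
move: (\sum_(x in _) _) (\sum_(y in _) _) => so si.
move: #|X1 :\: Y| #|Y1 :\: X| #|X1| #|Y1| #|D :&: X1| #|D :&: Y1| #|D| #|T|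
  size1 sizeD1 sizeD a0 c0.
move=> a c x y d1 d2 d N s1 s2 s3 a0 c0 h1 h2 ey ex ho hi.
rewrite muln0 addn0 => h.
have {}h : a * c * (3 * N - 3) <=
    a * c * (2 * (a.-1 + 2 * (N - y - a)) + 2 * (c.-1 + 2 * (N - x - c))).
  move: (a.-1 + _) (c.-1 + _) (3 * N - 3) ho hi h => U V W ho hi h.
  have := leq_mul (leqnn c) ho; have := leq_mul (leqnn a) hi; clear - h; lia.
by move: h; rewrite leq_pmul2l ?muln_gt0 ?a0 //; clear - s1 s2 s3 a0 c0 h1 h2 ex ey; lia.
Qed.

Hypothesis arcsD : arcs g D D <= 4 * (w * b).
Hypothesis largeD1 : 16 * b <= #|D :&: X1|.
Hypothesis posD1 : 0 < #|D :&: X1|.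

(** Now [X1] lies in [D] and is averaged against [Y1 :\: X]. Arcs from [X1] to [Y1] stay inside [D],
    so there are at most 4wb of them; as |X1| >= 16b they raise the average bound by at most w,
    which the w in [sizeD1] pays for. *)
Lemma forest_count_one_sided : #|X1 :\: Y| = 0 -> 0 < #|Y1 :\: X| -> False.
Proof.
move=> a0 c0.
have X1D : X1 \subset D.
  apply/subsetP => x xX1; rewrite inE (subsetP X1X) //=; apply/negPn/negP => xY.
  by have := cards0_eq a0; move/setP/(_ x); rewrite !inE xX1 xY.
have dj : [disjoint X1 & Y1 :\: X].
  rewrite -setI_eq0; apply/eqP/setP => x; rewrite !inE.
  by apply/negP => /andP[/(subsetP X1X) xX]; rewrite xX.
have := ore_average ore dj.
have -> : arcs g X1 (Y1 :\: X) = 0.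
  apply: arcs_eq0 => x y xX1; rewrite !inE => /andP[yX yY1].
  by apply/negP => /(no_arc xX1 yY1); rewrite !inE (negbTE yX) andbF.
have so_le : \sum_(x in X1) outdeg g x <= #|X1| * (n - #|Y1|) + 4 * (w * b).
  rewrite sum_outdeg (arcs_setIr g X1 setT Y1) setTI setTD addnC.
  apply: leq_add; first by have := arcs_leq g X1 (~: Y1); rewrite [#|~: Y1|]cardsCs setCK.
  apply: leq_trans arcsD; rewrite (arcs_setIr g X1 Y1 D).
  have -> : arcs g X1 (Y1 :\: D) = 0.
    apply: arcs_eq0 => x y xX1; rewrite inE => /andP[yD yY1].
    by apply/negP => /(no_arc xX1 yY1); rewrite (negbTE yD) andbF.
  by rewrite addn0; apply: arcs_subset => //; apply: subsetIr.
have := sum_indeg_right; move: so_le.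
have := card_split Y X1X; have := card_split X Y1Y; rewrite [Y :&: X]setIC a0.
have := card_left_leq Y1 X1X; have := max_card Y1.
move: (\sum_(x in _) _) (\sum_(y in _) _) => so si.
move: #|Y1 :\: X| #|X1| #|Y1| #|D :&: X1| #|D :&: Y1| #|D| #|T|
  size1 sizeD1 sizeD c0 largeD1 posD1.
move=> c x y d1 d2 d N s1 s2 s3 c0 l1 p1 yN h2 ey ex ho hi.
rewrite muln0 addn0 => h.
have {}h : x * c * (3 * N - 3) <=
    x * c * (4 * (N - y) + w + 2 * (c.-1 + 2 * (N - x - c))).
  have wx : w * (16 * b) <= w * x by rewrite leq_mul2l ex l1 orbT.
  move: (c.-1 + _) (N - y) (3 * N - 3) ho hi h => V U W ho hi h.
  have := leq_mul (leqnn c) ho; have := leq_mul (leqnn x) hi.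
  have := leq_mul (leqnn c) wx; clear - h; lia.
move: h; rewrite leq_pmul2l ?muln_gt0 ?c0 ?andbT; last by lia.
by clear - s1 s2 s3 c0 h2 ex ey yN; lia.
Qed.

End ForestCount.

(** * Linear forests of bad arcs *)

(** For an independent set the degree sums average at most N - d, and Ore gives 4d <= N + 3. The e
    arcs add at most about 6Ne/(d(d - 1)); with e <= 4wb and 5d >= N this is about 600wb/N, at most
    3w/10 because 2000b <= N. *)
Lemma independent_size_numeric (N d w b e : nat) :
  (3 * N - 3) * (d * d.-1) <= 4 * (d.-1 * (d * (N - d) + 2 * e)) + (3 * N - 3) * e ->
  e <= 4 * (w * b) -> 2000 * b <= N -> N <= 5 * d -> 8 * d <= 3 * N -> 1000 <= N ->
  4 * d <= N + 3 + w.
Proof.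
move=> h he hb h5 h8 hN; rewrite leqNgt; apply/negP => lt.
case: d => [|d] in h h5 h8 lt *; first by lia.
rewrite /= in h.
have h1 : d.+1 * d * (4 * (N - d.+1)) <= d.+1 * d * (3 * N - 4 - w).
  by rewrite leq_mul2l; apply/orP; right; lia.
have h2 : (d.+1 * d) * (3 * N - 3) = (d.+1 * d) * (3 * N - 4 - w) + (d.+1 * d) * (1 + w).
  by rewrite -mulnDr; congr (_ * _); lia.
have h3 : d.+1 * d * (1 + w) <= e * (8 * d + 3 * N).
  have : (3 * N - 3) * e <= 3 * N * e by rewrite leq_mul2r; apply/orP; right; lia.
  by clear - h h1 h2; lia.
have h4 : e * (8 * d + 3 * N) <= e * (6 * N) by rewrite leq_mul2l; apply/orP; right; lia.
have h6 : e * (6 * N) <= 4 * (w * b) * (6 * N) by rewrite leq_mul2r he orbT.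
have h7 : N * (N - 5) <= (5 * d.+1) * (5 * d) by apply: leq_mul; lia.
have h8' : N * (N - 5) * (1 + w) <= (5 * d.+1) * (5 * d) * (1 + w) by rewrite leq_mul2r h7 orbT.
have h9 : N * ((N - 5) * (1 + w)) <= N * (600 * (w * b)) by clear - h3 h4 h6 h8'; lia.
rewrite leq_pmul2l in h9; last by lia.
have h10 : w * (2000 * b) <= w * N by rewrite leq_mul2l hb orbT.
have [M eM] : exists M, N = M + 1000 by exists (N - 1000); lia.
subst N; have e5 : M + 1000 - 5 = M + 995 by clear; lia.
by rewrite e5 in h9; clear - h9 h10; nia.
Qed.

Section TypeForest.
Variables (T : finType) (g : rel T) (X Y : {set T}) (b k : nat).
Hypotheses (og : oriented_graph g) (ore : ore_condition g).
Local Notation n := #|T|.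
Local Notation D := (X :&: Y).
Hypothesis outD : forall x, x \in D -> #|[set y in D | g x y]| <= b.
Hypothesis inD : forall x, x \in D -> #|[set y in D | g y x]| <= b.
Hypotheses (b_small : 2000 * b <= n) (D_large : n <= 5 * #|D|) (D_small : 8 * #|D| <= 3 * n).
Hypotheses (n_large : 1000 <= n) (sizeXY : #|X| + #|Y| = n + k) (k_small : 100 * k <= n).

(** Stronger than [is_matching]: the head of one arc also differs from the tail of another, so no
    two of these arcs can follow each other. *)
Definition disjoint_arcs (W : {set T * T}) :=
  (W \subset [set p in setX D D | g p.1 p.2]) &&
  [forall e in W, forall f in W, (e != f) ==>
     [&& e.1 != f.1, e.2 != f.2, e.1 != f.2 & e.2 != f.1]].

Definition endpoints (W : {set T * T}) : {set T} := [set e.1 | e in W] :|: [set e.2 | e in W].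

(** For a maximum [W] every arc inside [D] meets one of the at most 2|W| ends of [W], and each end
    has at most b arcs leaving it and b arcs entering it within [D]. *)
Lemma max_disjoint_arcs :
  exists2 W, disjoint_arcs W & arcs g D D <= 4 * (#|W| * b).
Proof.
have d0 : disjoint_arcs set0.
  by rewrite /disjoint_arcs sub0set; apply/forall_inP => e; rewrite inE.
case: (arg_maxnP (fun W : {set T * T} => #|W|) d0) => W dW mW; exists W => //.
have /andP[/subsetP WD /forall_inP dis] := dW.
set V := endpoints W.
have touch x y : x \in D -> y \in D -> g x y -> (x \in V) || (y \in V).
  move=> xD yD gxy; apply/negPn/negP; rewrite negb_or => /andP[xV yV].
  have xyW : (x, y) \notin W.
    by apply: contra xV => xyW; rewrite inE; apply/orP; left; apply/imsetP; exists (x, y).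
  have nV e : e \in W -> [&& x != e.1, y != e.2, x != e.2 & y != e.1].
    move=> eW; have e1 : e.1 \in V by rewrite inE imset_f.
    have e2 : e.2 \in V by rewrite inE (imset_f snd) ?orbT.
    have ne z u : z \notin V -> u \in V -> z != u by move=> zV uV; apply: contraNneq zV => ->.
    by rewrite !ne.
  have: disjoint_arcs ((x, y) |: W).
    apply/andP; split.
      apply/subsetP => e; rewrite inE => /orP[/set1P->|/WD//].
      by rewrite inE /= gxy in_setX xD yD.
    apply/forall_inP => e eW; apply/forall_inP => f fW; apply/implyP => ef.
    move: eW fW ef; rewrite !in_setU1 => /orP[/eqP->|eW] /orP[/eqP->|fW].
    - by rewrite eqxx.
    - by move=> _; apply: nV.
    - by move=> _; have /and4P[h1 h2 h3 h4] := nV _ eW; rewrite ![e.1 == _]eq_sym ![e.2 == _]eq_sym h1 h2 h3 h4.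
    - by move=> ef; have /forall_inP/(_ f fW)/implyP := dis e eW; apply.
  by move=> /mW; rewrite cardsU1 xyW /= ltnn.
have cV : #|V| <= 2 * #|W|.
  rewrite /V /endpoints cardsU mul2n -addnn; apply: leq_trans (leq_subr _ _) _.
  by apply: leq_add; apply: leq_imset_card.
have le1 : arcs g (D :&: V) D <= #|V| * b.
  rewrite arcsE; apply: (@leq_trans (#|D :&: V| * b)).
    rewrite -sum_nat_const; apply: leq_sum => x; rewrite inE => /andP[xD _].
    exact: outD.
  by rewrite leq_mul2r subset_leq_card ?orbT // subsetIr.
have le2 : arcs g D (D :&: V) <= #|V| * b.
  rewrite arcsEr; apply: (@leq_trans (#|D :&: V| * b)).
    rewrite -sum_nat_const; apply: leq_sum => x; rewrite inE => /andP[xD _].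
    exact: inD.
  by rewrite leq_mul2r subset_leq_card ?orbT // subsetIr.
have le3 : arcs g D D <= arcs g (D :&: V) D + arcs g D (D :&: V).
  rewrite /arcs -cardsUI; apply: leq_trans (leq_addr _ _).
  apply/subset_leq_card/subsetP => -[x y] /setIdP[/setXP[/= xD yD] gxy].
  rewrite in_setU; apply/orP; case/orP: (touch x y xD yD gxy) => vV; [left|right];
    by apply/setIdP; split=> //; apply/setXP; split=> //; apply/setIP.
have := leq_mul cV (leqnn b); clear - le1 le2 le3; lia.
Qed.

(* König's theorem is applied to the bad arcs, of which only the disjoint arcs
   [W] are kept inside [X :&: Y]; then no chosen arcs can close a cycle.  The
   maximality of [W] makes [X :&: Y] small unless [W] is large. *)
Theorem bad_arc_forest : exists (M : {set T * T}) (rk : T -> nat),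
  [/\ #|M| = k, is_matching M &
   forall x y, (x, y) \in M -> [/\ x \in X, y \in Y, g x y & rk x < rk y]].
Proof.
have [W dW eD] := max_disjoint_arcs.
have /andP[/subsetP WD /forall_inP dis] := dW.
have {}dis e f : e \in W -> f \in W -> e != f ->
    [&& e.1 != f.1, e.2 != f.2, e.1 != f.2 & e.2 != f.1].
  by move=> eW fW; have /forall_inP/(_ f fW)/implyP := dis e eW.
pose E := W :|: [set p in setX X Y | g p.1 p.2 && ~~ ((p.1 \in D) && (p.2 \in D))].
have [[M [ME mM cM]]|[Zx [Zy [cov cZ]]]] := konig E k.
  (* Arcs of [W] lead from rank 1 to rank 2, since the head of one is never the tail of another. Any
     other arc of [E] has an end outside [D]: its tail then has rank 0, or its head has rank 3. *)
  pose rk x := if x \in D then (if x \in [set e.1 | e in W] then 1 else 2)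
               else if x \in X then 0 else 3.
  exists M, rk; split=> // x y /(subsetP ME); rewrite in_setU => /orP[xyW|].
    have := WD _ xyW; rewrite inE /= => /andP[/setXP[/= xD yD] gxy].
    move: (xD) (yD); rewrite !inE => /andP[xX _] /andP[_ yY]; split=> //.
    have xW : x \in [set e.1 | e in W] by apply/imsetP; exists (x, y).
    rewrite /rk xD yD xW; case: ifP => // /imsetP[f fW /= yf].
    case: (eqVneq (x, y) f) => [fe|ne].
      by move: gxy; rewrite yf -fe /= og.1.
    by have /and4P[_ _ _] := dis _ _ xyW fW ne; rewrite /= yf eqxx.
  rewrite inE /= => /andP[/setXP[/= xX yY] /andP[gxy nD]]; split=> //.
  move: nD; rewrite /rk !inE xX yY /= andbT.
  case: (boolP (x \in Y)) => xY; case: (boolP (y \in X)) => yX //= _.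
    by case: ifP.
  by case: ifP.
have sD := independent_size_numeric (ore_average_self og ore D) eD b_small D_large D_small n_large.
exfalso; set X1 := X :\: Zx; set Y1 := Y :\: Zy.
have X1X : X1 \subset X by apply: subsetDl.
have Y1Y : Y1 \subset Y by apply: subsetDl.
have no_arc x y : x \in X1 -> y \in Y1 -> g x y -> (x \in D) && (y \in D).
  rewrite !in_setD => /andP[xZ xX] /andP[yZ yY] gxy; apply/negPn/negP => nD.
  have : (x, y) \in E by rewrite in_setU [X in _ || X]inE in_setX /= xX yY gxy nD orbT.
  by move/cov; rewrite (negbTE xZ) (negbTE yZ).
have cX1 : #|X| <= #|X1| + #|Zx|.
  by rewrite -(cardsID Zx X) addnC leq_add2l subset_leq_card ?subsetIr.
have cY1 : #|Y| <= #|Y1| + #|Zy|.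
  by rewrite -(cardsID Zy Y) addnC leq_add2l subset_leq_card ?subsetIr.
have size1 : n + 1 <= #|X1| + #|Y1| by clear - cX1 cY1 cZ sizeXY; lia.
have eX : #|D :&: X1| + #|D :&: Zx| = #|D|.
  rewrite -(cardsID Zx D) addnC; congr (_ + #|pred_of_set _|).
  by apply/setP => x; rewrite !inE; case: (x \in X); rewrite ?andbF ?andbT // andbC.
have eY : #|D :&: Y1| + #|D :&: Zy| = #|D|.
  rewrite -(cardsID Zy D) addnC; congr (_ + #|pred_of_set _|).
  by apply/setP => x; rewrite !inE; case: (x \in Y); rewrite ?andbF ?andbT // andbC.
(* Each arc of [W] uses up its own vertex of the cover, and that vertex lies in [D]. The |W| thus
   lost from the two copies of [D] makes up for the |W| by which [sD] weakens the bound on |D|. *)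
have wZ : #|W| <= #|D :&: Zx| + #|D :&: Zy|.
  rewrite -(cardsID [set e | e.1 \in Zx] W); apply: leq_add.
    rewrite -(card_in_imset (f := @fst T T)); last first.
      move=> e f; rewrite !inE => /andP[eW _] /andP[fW _] ef; apply/eqP/negPn/negP.
      by move/(dis _ _ eW fW); rewrite ef eqxx.
    apply/subset_leq_card/subsetP => x /imsetP[e]; rewrite !inE => /andP[eW eZ] ->.
    by have := WD _ eW; rewrite !inE eZ => /andP[/andP[-> _] _].
  rewrite -(card_in_imset (f := @snd T T)); last first.
    move=> e f; rewrite !inE => /andP[_ eW] /andP[_ fW] ef; apply/eqP/negPn/negP.
    by move/(dis _ _ eW fW); rewrite ef eqxx andbF.
  apply/subset_leq_card/subsetP => x /imsetP[[u v]]; rewrite !inE /= => /andP[uZ eW] ->.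
  have := cov u v; rewrite in_setU eW (negbTE uZ) /= => /(_ isT) ->.
  by have := WD _ eW; rewrite !inE => /andP[/andP[_ ->] _].
have zx : #|D :&: Zx| <= #|Zx| by rewrite subset_leq_card ?subsetIr.
have zy : #|D :&: Zy| <= #|Zy| by rewrite subset_leq_card ?subsetIr.
have sizeD1 : #|D :&: X1| + #|D :&: Y1| + #|W| <= 2 * #|D| by clear - eX eY wZ; lia.
have lx : 16 * b <= #|D :&: X1| by clear - eX zx cZ k_small b_small D_large; lia.
have ly : 16 * b <= #|D :&: Y1| by clear - eY zy cZ k_small b_small D_large; lia.
have px : 0 < #|D :&: X1| by clear - eX zx cZ k_small n_large D_large; lia.
have py : 0 < #|D :&: Y1| by clear - eY zy cZ k_small n_large D_large; lia.
(* If both differences are empty, [X1] and [Y1] lie in [D], which is too small for |X1| + |Y1| > n.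
   The third case is the second one with all arcs reversed. *)
have [a0|a0] := posnP #|X1 :\: Y|; have [c0|c0] := posnP #|Y1 :\: X|.
- have := card_split Y X1X; have := card_split X Y1Y; rewrite a0 c0 [Y :&: X]setIC.
  by clear - size1 eX eY D_small n_large; lia.
- exact: (forest_count_one_sided og ore X1X Y1Y no_arc size1 sizeD1 sD eD lx px a0 c0).
- have no_arc' := no_arc_converse no_arc.
  rewrite addnC [leqRHS]addnC addnC in size1.
  rewrite [_ + #|D :&: Y1|]addnC in sizeD1; rewrite -arcs_converse in eD.
  rewrite [X :&: Y]setIC in sizeD1 sD eD ly py.
  exact: (forest_count_one_sided (oriented_converse og) (ore_converse ore) Y1Y X1X no_arc'
    size1 sizeD1 sD eD ly py c0 a0).
- exact: (forest_count_two_sided og ore X1X Y1Y no_arc size1 sizeD1 sD a0 c0).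
Qed.

End TypeForest.

(** * Closing a balanced path system *)

Lemma enum_setI_setD (T : finType) (U Z : {set T}) :
  perm_eq (enum U) (enum (U :&: Z) ++ enum (U :\: Z)).
Proof.
apply: uniq_perm; rewrite ?enum_uniq // ?cat_uniq ?enum_uniq ?andbT //=.
  by apply/hasPn => x; rewrite !mem_enum !inE => /andP[/negbTE-> _]; rewrite andbF.
by move=> x; rewrite mem_cat !mem_enum !inE; case: (x \in U); case: (x \in Z).
Qed.

Lemma enum_imset_inj (S T : finType) (M : {set S}) (f : S -> T) :
  {in M &, injective f} -> perm_eq (map f (enum M)) (enum (f @: M)).
Proof.
move=> fi; apply: uniq_perm; rewrite ?enum_uniq //.
  rewrite map_inj_in_uniq ?enum_uniq // => x y; rewrite !mem_enum; exact: fi.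
move=> y; rewrite mem_enum; apply/mapP/imsetP => -[x xM ->]; exists x => //.
  by rewrite mem_enum in xM.
by rewrite mem_enum.
Qed.

Lemma first_verts (T : finType) (u : T * seq T) : first u \in verts u.
Proof. exact: mem_head. Qed.

Section Linkage.
Variables (T : finType) (g : rel T) (A B C D : {set T}) (t m : nat) (P : T * seq T).
Variables (A1 B1 C1 D1 : {set T}).
Hypotheses (irr : irreflexive g) (A1A : A1 \subset A) (B1B : B1 \subset B)
  (C1C : C1 \subset C) (D1D : D1 \subset D).
Hypotheses (dP : dipath g P) (fP : first P \in B) (lP : final P \in B).
Hypothesis part : perm_eq (verts P ++ enum A1 ++ enum B1 ++ enum C1 ++ enum D1) (enum T).
Hypotheses (cD1 : #|D1| = m) (cB1 : #|B1|.+1 = m).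
Hypothesis m_large : 5 * t + 5 <= m.

(* A system of [m] disjoint paths from [D] to [B] that covers the special path
   [P] and everything outside [C]. *)
Definition linkage := exists us : seq (T * seq T),
  [/\ size us = m, perm_eq (all_verts us) (verts P ++ enum A1 ++ enum B1 ++ enum D1),
      {subset map (@first T) us <= D}, {subset map (@final T) us <= B} & all (dipath g) us].

Lemma map_first_single (s : seq T) : map (@first T) (map (@single T) s) = s.
Proof. by elim: s => //= x s ->. Qed.

Lemma map_final_single (s : seq T) : map (@final T) (map (@single T) s) = s.
Proof. by elim: s => //= x s ->. Qed.

Lemma dipath_single (s : seq T) : all (dipath g) (map (@single T) s).
Proof. by rewrite all_map; apply/allP. Qed.

Lemma subset_enum_sub (U V : {set T}) : U \subset V -> {subset enum U <= V}.
Proof. by move=> UV x; rewrite mem_enum => /(subsetP UV). Qed.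

Lemma uniq_part : uniq (verts P ++ enum A1 ++ enum B1 ++ enum C1 ++ enum D1).
Proof. by rewrite (perm_uniq part) enum_uniq. Qed.

Lemma verts_P_notin_B1 x : x \in verts P -> x \notin B1.
Proof.
move=> xP; apply/negP => xB; have := uniq_part; rewrite cat_uniq => /and3P[_ /hasPn h _].
have /h : x \in enum A1 ++ enum B1 ++ enum C1 ++ enum D1.
  by rewrite !mem_cat !mem_enum xB orbT.
by rewrite /= xP.
Qed.

(* The special path [P] counts as one more vertex of [B]. *)
Definition P_and (B2 : {set T}) : seq (T * seq T) := P :: map (@single T) (enum B2).

Lemma P_andP (B2 : {set T}) : B2 \subset B1 ->
  [/\ uniq (map (@first T) (P_and B2)), {subset map (@first T) (P_and B2) <= B},
      uniq (map (@final T) (P_and B2)) & {subset map (@final T) (P_and B2) <= B}] /\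
  [/\ all (dipath g) (P_and B2), all_verts (P_and B2) = verts P ++ enum B2 &
      size (P_and B2) = #|B2|.+1].
Proof.
move=> B21; have B2B : B2 \subset B by apply: subset_trans B1B.
rewrite /P_and !map_cons map_first_single map_final_single /=; split; split.
- rewrite enum_uniq andbT mem_enum; apply/negP => /(subsetP B21).
  exact/negP/verts_P_notin_B1/first_verts.
- by move=> x; rewrite inE => /predU1P[->//|]; exact: subset_enum_sub.
- rewrite enum_uniq andbT mem_enum; apply/negP => /(subsetP B21).
  exact/negP/verts_P_notin_B1/final_verts.
- by move=> x; rewrite inE => /predU1P[->//|]; exact: subset_enum_sub.
- by rewrite dP dipath_single.
- by rewrite all_verts_cons all_verts_single.
- by rewrite size_map -cardE.
Qed.

Lemma linkage_direct : A1 = set0 -> near_complete g D B t -> linkage.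
Proof.
move=> A0 nDB; have [[uf sf ul sl] [dB vB zB]] := P_andP (subxx B1).
have [||||||||us [su pu pf pl du]] :=
    @join_lists T g (map (@single T) (enum D1)) (P_and B1) D B t nDB.
- by rewrite zB size_map -cardE cB1.
- by right; rewrite size_map -cardE; clear - m_large cD1; lia.
- by rewrite map_final_single enum_uniq.
- exact: uf.
- by rewrite map_final_single; exact: subset_enum_sub.
- exact: sf.
- exact: dipath_single.
- exact: dB.
exists us; split=> //.
- by rewrite su size_map -cardE.
- apply: perm_trans pu _; rewrite all_verts_single vB A0 enum_set0.
  by apply/permP => p; rewrite !count_cat /=; clear; lia.
- by move=> x; rewrite (perm_mem pf) map_first_single; exact: subset_enum_sub.
- by move=> x; rewrite (perm_mem pl); exact: sl.
Qed.

(** [A1] is cut into exactly m paths; each of them is preceded by a vertex of [D1] and followed by a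
    vertex of [B1] or by [P]. *)
Lemma linkage_merge : near_complete g D A t -> near_complete g A B t ->
  near_tournament g A t -> m <= #|A1| -> #|A1| + (6 * t + 9) <= 3 * m -> linkage.
Proof.
move=> nDA nAB nt mA tA; have [[uf sf ul sl] [dB vB zB]] := P_andP (subxx B1).
have [As [sA pA dA]] := tournament_paths irr nt A1A mA tA.
have uA : uniq (all_verts As) by rewrite (perm_uniq pA) enum_uniq.
have subA (f : T * seq T -> T) : (forall u, f u \in verts u) -> {subset map f As <= A}.
  move=> fv x /(sub_all_verts fv); rewrite (perm_mem pA); exact: subset_enum_sub.
have [||||||||us [su pu pf pl du]] :=
    @join_lists T g (map (@single T) (enum D1)) As D A t nDA.
- by rewrite sA size_map -cardE.
- by right; rewrite size_map -cardE; clear - m_large cD1; lia.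
- by rewrite map_final_single enum_uniq.
- exact: uniq_all_verts (@first_verts T) uA.
- by rewrite map_final_single; exact: subset_enum_sub.
- exact: subA (@first_verts T).
- exact: dipath_single.
- exact: dA.
rewrite size_map -cardE cD1 in su.
have [||||||||vs [sv pv pvf pvl dv]] := @join_lists T g us (P_and B1) A B t nAB.
- by rewrite zB su cB1.
- by right; clear - m_large su; lia.
- by rewrite (perm_uniq pl); exact: uniq_all_verts (@final_verts T) uA.
- exact: uf.
- by move=> x; rewrite (perm_mem pl); exact: subA (@final_verts T) _.
- exact: sf.
- exact: du.
- exact: dB.
exists vs; split=> //.
- by rewrite sv.
- apply: perm_trans pv _; rewrite vB; rewrite all_verts_single in pu.
  apply/permP => p; have /permP/(_ p) := pu; have /permP/(_ p) := pA.
  by rewrite !count_cat; clear; lia.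
- move=> x; rewrite (perm_mem pvf) (perm_mem pf) map_first_single.
  exact: subset_enum_sub.
- by move=> x; rewrite (perm_mem pvl); exact: sl.
Qed.

(** Too small a set [A1] serves only |A1| of the m paths, with one vertex in each; the other m -
    |A1| paths are the arcs of [M], which skip [A]. *)
Lemma linkage_matching (M : {set T * T}) : near_complete g D A t -> near_complete g A B t ->
  3 * t + 1 <= #|A1| -> #|A1| + #|M| = m -> is_matching M ->
  (forall x y, (x, y) \in M -> [/\ x \in D1, y \in B1 & g x y]) -> linkage.
Proof.
move=> nDA nAB tA AM [M1 M2] Marc.
set S := (@fst T T) @: M; set R := (@snd T T) @: M.
have cS : #|S| = #|M| by apply: card_in_imset.
have cR : #|R| = #|M| by apply: card_in_imset.
have SD : S \subset D1 by apply/subsetP => x /imsetP[[u v] /Marc[? _ _] ->].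
have RB : R \subset B1 by apply/subsetP => x /imsetP[[u v] /Marc[_ ? _] ->].
have B21 : B1 :\: R \subset B1 by apply: subsetDl.
have D21 : D1 :\: S \subset D by apply: subset_trans (subsetDl _ _) D1D.
have cD2 : #|D1 :\: S| = #|A1|.
  by have := cardsID S D1; rewrite (setIidPr SD) cS; clear - AM cD1; lia.
have cB2 : #|B1 :\: R|.+1 = #|A1|.
  by have := cardsID R B1; rewrite (setIidPr RB) cR; clear - AM cB1; lia.
have [[uf sf ul sl] [dB vB zB]] := P_andP B21.
have [||||||||us [su pu pf pl du]] :=
    @join_lists T g (map (@single T) (enum (D1 :\: S))) (map (@single T) (enum A1)) D A t nDA.
- by rewrite !size_map -!cardE.
- by right; rewrite size_map -cardE cD2.
- by rewrite map_final_single enum_uniq.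
- by rewrite map_first_single enum_uniq.
- by rewrite map_final_single; exact: subset_enum_sub.
- by rewrite map_first_single; exact: subset_enum_sub.
- exact: dipath_single.
- exact: dipath_single.
rewrite size_map -cardE cD2 in su.
have [||||||||vs [sv pv pvf pvl dv]] := @join_lists T g us (P_and (B1 :\: R)) A B t nAB.
- by rewrite zB su cB2.
- by right; rewrite su.
- by rewrite (perm_uniq pl) map_final_single enum_uniq.
- exact: uf.
- by move=> x; rewrite (perm_mem pl) map_final_single; exact: subset_enum_sub.
- exact: sf.
- exact: du.
- exact: dB.
pose ms : seq (T * seq T) := [seq (e.1, [:: e.2]) | e <- enum M].
have vms : perm_eq (all_verts ms) (enum S ++ enum R).
  have : perm_eq (all_verts ms) (map (@fst T T) (enum M) ++ map (@snd T T) (enum M)).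
    rewrite /ms; elim: (enum M) => // e s IH; rewrite !map_cons all_verts_cons.
    by apply/permP => p; have /permP/(_ p) := IH; rewrite !count_cat /=; clear; lia.
  by move/perm_trans; apply; apply: perm_cat; apply: enum_imset_inj.
exists (vs ++ ms); split.
- by rewrite size_cat sv su size_map -cardE.
- rewrite all_verts_cat; apply/permP => p.
  have /permP/(_ p) := pv; have /permP/(_ p) := vms; have /permP/(_ p) := pu.
  have /permP/(_ p) := enum_setI_setD D1 S; have /permP/(_ p) := enum_setI_setD B1 R.
  rewrite (setIidPr SD) (setIidPr RB) vB !all_verts_single !count_cat; clear; lia.
- move=> x; rewrite map_cat mem_cat (perm_mem pvf) (perm_mem pf) map_first_single.
  case/orP => [/(subset_enum_sub D21)//|/mapP[u /mapP[[y z] yz ->] ->]].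
  by rewrite mem_enum in yz; have [/(subsetP D1D)] := Marc _ _ yz.
- move=> x; rewrite map_cat mem_cat (perm_mem pvl).
  case/orP => [/sl//|/mapP[u /mapP[[y z] yz ->] ->]].
  by rewrite mem_enum in yz; have [_ /(subsetP B1B)] := Marc _ _ yz.
- rewrite all_cat dv; apply/allP => u /mapP[[y z] yz ->]; rewrite mem_enum in yz.
  by have [_ _ gyz] := Marc _ _ yz; rewrite /dipath /= gyz.
Qed.

Hypotheses (nBC : near_complete g B C t) (nCD : near_complete g C D t)
  (nC : near_tournament g C t).

(** [C1] is cut into m paths, each continued by one path of the linkage. The results run from [C] to
    [B], and the nearly complete pair from [B] to [C] closes them up. *)
Lemma hamilton_of_linkage : m <= #|C1| -> #|C1| + (6 * t + 9) <= 3 * m ->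
  linkage -> has_hamilton_cycle g.
Proof.
move=> mC tC [us [su pu sf sl du]].
have [Cs [sC pC dC]] := tournament_paths irr nC C1C mC tC.
have uC : uniq (all_verts Cs) by rewrite (perm_uniq pC) enum_uniq.
have subC (f : T * seq T -> T) : (forall u, f u \in verts u) -> {subset map f Cs <= C}.
  move=> fv x /(sub_all_verts fv); rewrite (perm_mem pC); exact: subset_enum_sub.
have pall : perm_eq (all_verts Cs ++ all_verts us) (enum T).
  apply: perm_trans part; apply/permP => p.
  have /permP/(_ p) := pu; have /permP/(_ p) := pC; rewrite !count_cat; clear; lia.
have uu : uniq (all_verts us).
  by have := enum_uniq T; rewrite -(perm_uniq pall) cat_uniq => /and3P[].
have [||||||||ws [sw pw pf pl dw]] := @join_lists T g Cs us C D t nCD.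
- by rewrite sC su.
- by right; rewrite sC; clear - m_large; lia.
- exact: uniq_all_verts (@final_verts T) uC.
- exact: uniq_all_verts (@first_verts T) uu.
- exact: subC (@final_verts T).
- exact: sf.
- exact: dC.
- exact: du.
have [||||||c [c0 cc pc]] := @close_lists T g ws B C t nBC.
- by rewrite sw sC.
- by rewrite (perm_uniq pl); exact: uniq_all_verts (@final_verts T) uu.
- by rewrite (perm_uniq pf); exact: uniq_all_verts (@first_verts T) uC.
- by move=> x; rewrite (perm_mem pl); exact: sl.
- by move=> x; rewrite (perm_mem pf); exact: subC (@first_verts T) _.
- exact: dw.
have pcT : perm_eq c (enum T) by apply: perm_trans pc (perm_trans pw pall).
exists c; split=> //; first by rewrite (perm_uniq pcT) enum_uniq.
by move=> x; rewrite (perm_mem pcT) mem_enum.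
Qed.

End Linkage.

(** In König's theorem a cover with fewer than f vertices meets at most (f - 1)m arcs, since every
    vertex lies on at most m of them. *)
Lemma matching_of_arcs (T : finType) (g : rel T) (X Y : {set T}) f m :
  0 < m -> #|X| <= m -> #|Y| <= m -> f * m <= arcs g X Y ->
  exists M : {set T * T}, [/\ #|M| = f, is_matching M &
    forall x y, (x, y) \in M -> [/\ x \in X, y \in Y & g x y]].
Proof.
move=> m0 Xm Ym fm; pose E := [set p in setX X Y | g p.1 p.2].
have [[M [/subsetP ME mM cM]]|[Zx [Zy [cov cZ]]]] := konig E f.
  exists M; split=> // x y /ME; rewrite inE in_setX /= => /andP[/andP[xX yY] gxy].
  by split.
have sub : E \subset setX Zx Y :|: setX X Zy.
  apply/subsetP => -[x y] xyE; have := cov _ _ xyE; move: xyE.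
  rewrite !inE /= => /andP[/andP[-> ->] _]; by rewrite andbT.
have := subset_leq_card sub; have := cardsUI (setX Zx Y) (setX X Zy).
rewrite !cardsX => e h.
have l1 : #|Zx| * #|Y| <= #|Zx| * m by rewrite leq_mul2l Ym orbT.
have l2 : #|X| * #|Zy| <= m * #|Zy| by rewrite leq_mul2r Xm orbT.
have l3 : (#|Zx| + #|Zy| + 1) * m <= f * m by rewrite leq_mul2r addn1 cZ orbT.
by exfalso; move: fm; rewrite /arcs -/E; clear - e h l1 l2 l3 m0; lia.
Qed.

Lemma near_complete_converse (T : finType) (g : rel T) (U V : {set T}) t :
  near_complete g U V t -> near_complete (converse g) V U t.
Proof. by case. Qed.

Lemma near_tournament_converse (T : finType) (g : rel T) (U : {set T}) t :
  near_tournament g U t -> near_tournament (converse g) U t.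
Proof.
move=> nt u uU; apply: leq_trans (nt u uU); apply/eq_leq/eq_card => v.
by rewrite !inE /converse orbC.
Qed.

Definition rev_dipath (T : finType) (u : T * seq T) : T * seq T :=
  (last u.1 u.2, rev (belast u.1 u.2)).

Lemma verts_rev_dipath (T : finType) (u : T * seq T) : verts (rev_dipath u) = rev (verts u).
Proof. by rewrite /verts /rev_dipath /= [u.1 :: u.2]lastI rev_rcons. Qed.

Lemma final_rev_dipath (T : finType) (u : T * seq T) : final (rev_dipath u) = first u.
Proof.
rewrite /final -[RHS](last_rcons (first u) (rev u.2)) -rev_cons.
by rewrite -[u.1 :: u.2 in RHS]/(verts u) -verts_rev_dipath.
Qed.

Lemma dipath_rev_dipath (T : finType) (g : rel T) (u : T * seq T) :
  dipath (converse g) (rev_dipath u) = dipath g u.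
Proof. by rewrite /dipath /= rev_path. Qed.

Lemma enum_setU_disjoint (T : finType) (U V : {set T}) : [disjoint U & V] ->
  perm_eq (enum (U :|: V)) (enum U ++ enum V).
Proof.
move=> dUV; apply: perm_trans (enum_setI_setD (U :|: V) U) _.
have -> : (U :|: V) :&: U = U by apply/setIidPr/subsetUl.
suff -> : (U :|: V) :\: U = V by [].
by apply/setP => x; rewrite !inE; case: (boolP (x \in U)) => // /(disjointFr dUV) ->.
Qed.

Section Finish.
Variables (T : finType) (g : rel T) (A B C D : {set T}) (t m : nat).
Hypotheses (irr : irreflexive g) (nAB : near_complete g A B t) (nBC : near_complete g B C t)
  (nCD : near_complete g C D t) (nDA : near_complete g D A t)
  (tA : near_tournament g A t) (tC : near_tournament g C t).
Variables (P : T * seq T) (A1 B1 C1 D1 : {set T}).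
Hypotheses (A1A : A1 \subset A) (B1B : B1 \subset B) (C1C : C1 \subset C) (D1D : D1 \subset D).
Hypotheses (dP : dipath g P) (fP : first P \in B) (lP : final P \in B).
Hypothesis part : perm_eq (verts P ++ enum A1 ++ enum B1 ++ enum C1 ++ enum D1) (enum T).
Hypotheses (cD1 : #|D1| = m) (cB1 : #|B1|.+1 = m) (m_large : 5 * t + 5 <= m).
Hypotheses (A_small : #|A1| + (6 * t + 9) <= 3 * m) (C_small : #|C1| + (6 * t + 9) <= 3 * m).

Lemma finish_C_large : 3 * t + 1 <= #|A1| -> m <= #|C1| ->
  (#|A1| < m -> (m - #|A1|) * m <= arcs g D1 B1) -> has_hamilton_cycle g.
Proof.
move=> A_large mC arcsDB.
apply: (hamilton_of_linkage irr C1C part m_large nBC nCD tC mC C_small).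
have [mA|Am] := leqP m #|A1|.
  exact: (linkage_merge irr A1A B1B D1D dP fP lP part cD1 cB1 m_large nDA nAB tA mA A_small).
have m0 : 0 < m by clear - m_large; lia.
have [||M [cM mM aM]] := matching_of_arcs m0 _ _ (arcsDB Am).
- by rewrite cD1.
- by rewrite -cB1.
apply: (linkage_matching A1A B1B D1D dP fP lP part cD1 cB1 nDA nAB A_large _ mM aM).
by clear - cM Am; lia.
Qed.

End Finish.

(** [finish_C_large] can skip only [A]. If [C] is the class to be skipped, reversing all arcs lets
    C, B, A, D take the roles of A, B, C, D, with [P] traversed backwards. *)
Theorem finish_balanced (T : finType) (g : rel T) (A B C D : {set T}) (t m : nat)
  (P : T * seq T) (A1 B1 C1 D1 : {set T}) :
  irreflexive g -> near_complete g A B t -> near_complete g B C t ->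
  near_complete g C D t -> near_complete g D A t ->
  near_tournament g A t -> near_tournament g C t ->
  A1 \subset A -> B1 \subset B -> C1 \subset C -> D1 \subset D ->
  dipath g P -> first P \in B -> final P \in B ->
  perm_eq (verts P ++ enum A1 ++ enum B1 ++ enum C1 ++ enum D1) (enum T) ->
  #|D1| = m -> #|B1|.+1 = m -> 5 * t + 5 <= m ->
  3 * t + 1 <= #|A1| -> 3 * t + 1 <= #|C1| ->
  #|A1| + (6 * t + 9) <= 3 * m -> #|C1| + (6 * t + 9) <= 3 * m ->
  (m <= #|A1|) || (m <= #|C1|) ->
  (#|A1| < m -> (m - #|A1|) * m <= arcs g D1 B1) ->
  (#|C1| < m -> (m - #|C1|) * m <= arcs g B1 D1) ->
  has_hamilton_cycle g.
Proof.
move=> irr nAB nBC nCD nDA tA tC sA sB sC sD dP fP lP part cD cB m_large lA lC hA hC mAC eA eC.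
have [mC|Cm] := leqP m #|C1|.
  exact: (finish_C_large irr nAB nBC nCD nDA tA tC sA sB sC sD dP fP lP part cD cB
    m_large hA hC lA mC eA).
have mA : m <= #|A1| by move: mAC; rewrite (leqNgt m #|C1|) Cm orbF.
apply: hamilton_converse.
have fP' : first (rev_dipath P) \in B by [].
have lP' : final (rev_dipath P) \in B by rewrite final_rev_dipath.
have dP' : dipath (converse g) (rev_dipath P) by rewrite dipath_rev_dipath.
apply: (@finish_C_large T (converse g) C B A D t m irr _ _ _ _ _ _ (rev_dipath P) C1 B1 A1 D1) => //.
- exact: near_complete_converse.
- exact: near_complete_converse.
- exact: near_complete_converse.
- exact: near_complete_converse.
- exact: near_tournament_converse.
- exact: near_tournament_converse.
- apply: perm_trans part; rewrite verts_rev_dipath; apply/permP => p.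
  by rewrite !count_cat count_rev; clear; lia.
- by rewrite arcs_converse.
Qed.

Theorem finish_direct (T : finType) (g : rel T) (B C D : {set T}) (t m : nat)
  (P : T * seq T) (B1 C1 D1 : {set T}) :
  irreflexive g -> near_complete g B C t -> near_complete g C D t ->
  near_complete g D B t -> near_tournament g C t ->
  B1 \subset B -> C1 \subset C -> D1 \subset D ->
  dipath g P -> first P \in B -> final P \in B ->
  perm_eq (verts P ++ enum B1 ++ enum C1 ++ enum D1) (enum T) ->
  #|D1| = m -> #|B1|.+1 = m -> 5 * t + 5 <= m ->
  m <= #|C1| -> #|C1| + (6 * t + 9) <= 3 * m ->
  has_hamilton_cycle g.
Proof.
move=> irr nBC nCD nDB tC sB sC sD dP fP lP part cD cB m_large mC hC.
have part0 : perm_eq (verts P ++ enum (set0 : {set T}) ++ enum B1 ++ enum C1 ++ enum D1) (enum T).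
  by rewrite enum_set0.
apply: (hamilton_of_linkage irr sC part0 m_large nBC nCD tC mC hC).
exact: (linkage_direct sB sD dP fP lP part0 cD cB m_large (erefl _) nDB).
Qed.

(** * Absorption into a single path *)

Section Absorption.
Variables (T : finType) (g : rel T) (A B C D : {set T}) (sS sY : pred T) (t L : nat).

(* [sS x] tells that the successor of [x] on the cycle is to be searched on the
   side of [C] and [D], and [sY y] that the predecessor of [y] is to be searched
   on the side of [B] and [C]; an arc [xy] is good when [sS x = sY y]. *)
Hypothesis stA : forall x, x \in A -> ~~ sS x /\ ~~ sY x.
Hypothesis stB : forall x, x \in B -> sS x /\ ~~ sY x.
Hypothesis stC : forall x, x \in C -> sS x /\ sY x.
Hypothesis stD : forall x, x \in D -> ~~ sS x /\ sY x.

Local Notation Typ := (A :|: B :|: C :|: D).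

Hypotheses (nAB : near_complete g A B t) (nBC : near_complete g B C t)
  (nCD : near_complete g C D t) (nDA : near_complete g D A t).
Hypotheses (LB : L <= #|B|) (LC : L <= #|C|) (LD : L <= #|D|).
Hypothesis LA : L <= #|A| \/ A = set0 /\ near_complete g D B t.

Hypothesis out_gamma : forall v, sS v -> L <= #|[set y in C :|: D | g v y]|.
Hypothesis out_alpha : forall v, ~~ sS v -> L <= #|[set y in A :|: B | g v y]|.
Hypothesis in_gamma : forall v, sY v -> L <= #|[set y in B :|: C | g y v]|.
Hypothesis in_alpha : forall v, ~~ sY v -> L <= #|[set y in A :|: D | g y v]|.

(* Everything is covered by the special path [P], the paths [ps] still to be
   absorbed, and the vertices of [R]; the last clause says that as many of these
   paths can be left towards [C] and [D] as can be entered from [B] and [C]. *)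
Definition absorbing (P : T * seq T) (ps : seq (T * seq T)) (R : {set T}) :=
  [/\ perm_eq (verts P ++ all_verts ps ++ enum R) (enum T), R \subset Typ,
      dipath g P && all (dipath g) ps, first P \in B &
      sS (final P) + count (fun p => sS (final p)) ps + #|[set x in R | sS x]| =
      count (fun p => sY (first p)) ps + #|[set x in R | sY x]|].

(** A good arc keeps the balance: the departure [sS (final P)] and the arrival [sY x] disappear
    together and are equal, while [sS x] merely moves from the count over [R] to the end of the
    path. *)
Lemma absorb_vertex P ps R x : absorbing P ps R -> x \in R -> g (final P) x ->
  sS (final P) = sY x -> absorbing (join P (single x)) ps (R :\ x).
Proof.
move=> [pe sR /andP[dP dps] fP bal] xR gx st; split.
- apply: perm_trans pe; apply/permP => p; have /permP/(_ p) := enum_setD1 xR.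
  by rewrite verts_join !count_cat /=; clear; lia.
- exact: subset_trans (subsetDl _ _) sR.
- by rewrite dipath_join dP gx dps.
- by [].
- rewrite final_join -[final (single x)]/x.
  have e (s : pred T) : #|[set y in R | s y]| = s x + #|[set y in R :\ x | s y]|.
    rewrite (cardsD1 x) inE xR /=; congr (_ + _); apply: eq_card => y.
    by rewrite !inE andbA.
  by move: bal; rewrite !e st; clear; lia.
Qed.

Lemma absorb_path P p ps R : absorbing P (p :: ps) R -> g (final P) (first p) ->
  sS (final P) = sY (first p) -> absorbing (join P p) ps R.
Proof.
move=> [pe sR /andP[dP /= /andP[dp dps]] fP bal] gx st; split=> //.
- apply: perm_trans pe; apply/permP => q.
  by rewrite verts_join all_verts_cons !count_cat /=; clear; lia.
- by rewrite dipath_join dP gx dp dps.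
- by rewrite final_join; move: bal => /=; rewrite st; clear; lia.
Qed.

(** Only |Typ| - |R| typical vertices are used up; together with [Z] and the [s] failures they are
    fewer than the [L] members of [X]. *)
Lemma pick_free (X R Z : {set T}) (Q : pred T) s : X \subset Typ -> R \subset Typ ->
  L <= #|X| -> #|Typ| + #|Z| + s < #|R| + L -> #|[set x in X | ~~ Q x]| <= s ->
  exists x, [/\ x \in X, x \in R, x \notin Z & Q x].
Proof.
move=> XT RT LX sz cQ.
have c1 : #|X| + #|R| <= #|X :&: R| + #|Typ|.
  rewrite -cardsUI addnC leq_add2l subset_leq_card // subUset XT //.
have c2 : #|X :&: R| <= #|(X :&: R) :\: Z| + #|Z|.
  by rewrite -(cardsID Z (X :&: R)) addnC leq_add2l subset_leq_card ?subsetIr.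
have [||x] := @set_pick _ ((X :&: R) :\: Z) Q s.
- apply: subset_filter_card cQ; exact: subset_trans (subsetDl _ _) (subsetIl _ _).
- by clear - c1 c2 sz LX; lia.
by rewrite !inE => /and3P[xZ xX xR] Qx; exists x.
Qed.

Lemma pick_free2 (X R Z : {set T}) (Q Q' : pred T) : X \subset Typ -> R \subset Typ ->
  L <= #|X| -> #|Typ| + #|Z| + 2 * t < #|R| + L ->
  #|[set x in X | ~~ Q x]| <= t -> #|[set x in X | ~~ Q' x]| <= t ->
  exists x, [/\ x \in X, x \in R, x \notin Z, Q x & Q' x].
Proof.
move=> XT RT LX sz c1 c2.
have [|x [xX xR xZ /andP[Qx Qx']]] := @pick_free X R Z (fun x => Q x && Q' x) (2 * t) XT RT LX sz.
  rewrite mul2n -addnn; apply: leq_trans (leq_add c1 c2); rewrite -cardsUI.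
  apply: leq_trans (leq_addr _ _); apply/subset_leq_card/subsetP => x.
  by rewrite !inE negb_and; case: (x \in X).
by exists x.
Qed.

Let AT : A \subset Typ. Proof. by rewrite -!setUA subsetUl. Qed.
Let BT : B \subset Typ. Proof. by rewrite -!setUA setUCA subsetUl. Qed.
Let CT : C \subset Typ. Proof. by rewrite -setUA setUCA subsetUl. Qed.
Let DT : D \subset Typ. Proof. by rewrite subsetUr. Qed.

Lemma absorbing_sub P ps R : absorbing P ps R -> R \subset Typ.
Proof. by case. Qed.

(** [k] bounds how many vertices of [R] the walk consumes. [Z] holds reserved vertices: walks are
    planned backwards from the target, and what is chosen for the end must not be used earlier. *)
Definition reaches k (P : T * seq T) (ps : seq (T * seq T)) (R Z : {set T}) (u : T) :=
  exists P' R',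
  [/\ absorbing P' ps R', final P' = u, #|R| <= #|R'| + k & R :&: Z \subset R'].

Lemma cardsD1_leq (R : {set T}) x : #|R| <= #|R :\ x| + 1.
Proof. by rewrite [leqLHS](cardsD1 x) addnC leq_add2l leq_b1. Qed.

Lemma reaches_refl P ps R Z : absorbing P ps R -> reaches 0 P ps R Z (final P).
Proof. by move=> aP; exists P, R; split; rewrite ?addn0 ?subsetIl. Qed.

Lemma reaches_step k P ps R Z u v : reaches k P ps R (v |: Z) u -> v \in R -> v \notin Z ->
  g u v -> sS u = sY v -> reaches k.+1 P ps R Z v.
Proof.
move=> [P' [R' [aP' fP' cR sR]]] vR vZ guv st.
have vR' : v \in R' by apply: (subsetP sR); rewrite !inE vR eqxx.
exists (join P' (single v)), (R' :\ v); split.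
- by apply: absorb_vertex; rewrite ?fP'.
- by rewrite final_join.
- by have := cardsD1_leq R' v; clear - cR; lia.
- apply/subsetP => x; rewrite !inE => /andP[xR xZ]; apply/andP; split.
    by apply: contraNneq vZ => <-.
  by apply: (subsetP sR); rewrite !inE xR xZ orbT.
Qed.

Lemma reaches_leq k k' P ps R Z u : k <= k' -> reaches k P ps R Z u -> reaches k' P ps R Z u.
Proof.
move=> kk [P' [R' [aP' fP' cR sR]]]; exists P', R'; split=> //.
by apply: leq_trans cR _; rewrite leq_add2l.
Qed.

Section FromB.
Variables (P : T * seq T) (ps : seq (T * seq T)) (R : {set T}).
Hypotheses (aP : absorbing P ps R) (fB : final P \in B).
Hypothesis room : #|Typ| + 2 * t + 10 < #|R| + L.

Let RT : R \subset Typ. Proof. exact: absorbing_sub aP. Qed.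

(** The walks follow the cyclic order B, C, D, A, B, C, and each of the next lemmas goes one class
    farther. Every additional class reserves one more vertex, whence the bounds 8, 7, 6, 5 on
    |Z|. *)
Lemma reach_D (Z : {set T}) u : #|Z| <= 8 -> u \in D -> u \in R -> u \notin Z -> reaches 2 P ps R Z u.
Proof.
move=> cZ uD uR uZ.
have [|||c [cC cR cZ' gc cu]] :=
    @pick_free2 C R (u |: Z) (g (final P)) (fun c => g c u) CT RT LC.
- by have := cardsU1 u Z; rewrite uZ /=; clear - cZ room; lia.
- exact: nBC.1.
- exact: nCD.2.
rewrite in_setU1 negb_or in cZ'; have /andP[ncu ncZ] := cZ'.
have [s1 s2] := stB fB; have [s3 s4] := stC cC; have [s5 s6] := stD uD.
apply: (reaches_step (u := c)) => //; last by rewrite s3 s6.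
apply: (reaches_step (u := final P)) => //; last by rewrite s1 s4.
- exact: reaches_refl.
- by rewrite in_setU1 negb_or ncu.
Qed.

Lemma reach_A (Z : {set T}) u : #|Z| <= 7 -> u \in A -> u \in R -> u \notin Z -> reaches 3 P ps R Z u.
Proof.
move=> cZ uA uR uZ.
have [||d [dD dR dZ du]] := @pick_free D R (u |: Z) (fun d => g d u) t DT RT LD.
- by have := cardsU1 u Z; rewrite uZ /=; clear - cZ room; lia.
- exact: nDA.2.
have [s1 s2] := stD dD; have [s5 s6] := stA uA.
apply: (reaches_step (u := d)) => //; last by rewrite (negbTE s1) (negbTE s6).
by apply: reach_D => //; have := cardsU1 u Z; rewrite uZ; clear - cZ; lia.
Qed.

Lemma reach_B (Z : {set T}) u : #|Z| <= 6 -> u \in B -> u \in R -> u \notin Z -> reaches 4 P ps R Z u.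
Proof.
move=> cZ uB uR uZ; have [s5 /negbTE s6] := stB uB.
have cuZ : #|u |: Z| <= 7 by have := cardsU1 u Z; rewrite uZ; clear - cZ; lia.
case: LA => [LA'|[A0 nDB]].
  have [||a [aA aR aZ au]] := @pick_free A R (u |: Z) (fun a => g a u) t AT RT LA'.
  - by clear - cuZ room; lia.
  - exact: nAB.2.
  have [/negbTE s1 _] := stA aA.
  by apply: (reaches_step (u := a)) => //; [apply: reach_A | rewrite s1 s6].
have [||d [dD dR dZ du]] := @pick_free D R (u |: Z) (fun d => g d u) t DT RT LD.
- by clear - cuZ room; lia.
- exact: nDB.2.
have [/negbTE s1 _] := stD dD.
apply: (reaches_step (u := d)) => //; last by rewrite s1 s6.
by apply: (@reaches_leq 2) => //; apply: reach_D => //; clear - cuZ; lia.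
Qed.

Lemma reach_C (Z : {set T}) u : #|Z| <= 5 -> u \in C -> u \in R -> u \notin Z -> reaches 5 P ps R Z u.
Proof.
move=> cZ uC uR uZ.
have cuZ : #|u |: Z| <= 6 by have := cardsU1 u Z; rewrite uZ; clear - cZ; lia.
have [||b [bB bR bZ bu]] := @pick_free B R (u |: Z) (fun b => g b u) t BT RT LB.
- by clear - cuZ room; lia.
- exact: nBC.2.
have [s1 _] := stB bB; have [s5 s6] := stC uC.
by apply: (reaches_step (u := b)) => //; [apply: reach_B | rewrite s1 s6].
Qed.

Lemma reach_typical u : u \in R -> reaches 5 P ps R set0 u.
Proof.
move=> uR; have := subsetP RT _ uR; rewrite !inE => /orP[/orP[/orP[]|]|] uX.
- by apply: (@reaches_leq 3) => //; apply: reach_A; rewrite ?cards0 ?inE.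
- by apply: (@reaches_leq 4) => //; apply: reach_B; rewrite ?cards0 ?inE.
- by apply: reach_C; rewrite ?cards0 ?inE.
- by apply: (@reaches_leq 2) => //; apply: reach_D; rewrite ?cards0 ?inE.
Qed.

(** The predecessor [u] is a free in-neighbour on the side prescribed by [sY (first p)], so the arc
    into the path is good; a walk to the typical vertex [u] uses at most 5 vertices. *)
Lemma reach_path p ps' : ps = p :: ps' -> exists P' R',
  [/\ absorbing P' ps' R', final P' = final p & #|R| <= #|R'| + 5].
Proof.
move=> eps; have [u [uR gu su]] : exists u, [/\ u \in R, g u (first p) & sS u = sY (first p)].
  have [sp|sp] := boolP (sY (first p)).
    have NT : [set y in B :|: C | g y (first p)] \subset Typ.
      by apply/subsetP => y; rewrite !inE => /andP[/orP[]-> _]; rewrite ?orbT.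
    have [||u [uN uR _ _]] := @pick_free _ R set0 predT 0 NT RT (in_gamma sp).
    - by rewrite cards0; clear - room; lia.
    - by rewrite leqn0 cards_eq0; apply/eqP/setP => y; rewrite !inE andbF.
    exists u; split=> //; first by move: uN; rewrite inE => /andP[].
    by move: uN; rewrite !inE => /andP[/orP[/stB[-> _]|/stC[-> _]]].
  have NT : [set y in A :|: D | g y (first p)] \subset Typ.
    by apply/subsetP => y; rewrite !inE => /andP[/orP[]-> _]; rewrite ?orbT.
  have [||u [uN uR _ _]] := @pick_free _ R set0 predT 0 NT RT (in_alpha sp).
  - by rewrite cards0; clear - room; lia.
  - by rewrite leqn0 cards_eq0; apply/eqP/setP => y; rewrite !inE andbF.
  exists u; split=> //; first by move: uN; rewrite inE => /andP[].
  by move: uN; rewrite !inE => /andP[/orP[/stA[/negbTE-> _]|/stD[/negbTE-> _]]].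
have [P' [R' [aP' fP' cR _]]] := reach_typical uR.
rewrite eps in aP'; exists (join P' p), R'; split=> //.
- by apply: absorb_path => //; rewrite fP'.
- by rewrite final_join.
Qed.

End FromB.

Definition room k (R : {set T}) := #|Typ| + 2 * t + 10 + k < #|R| + L.

(** An absorbed path may end in an atypical vertex, but its state guarantees many successors in the
    two proper classes. From there the cyclic order leads to [B]; four vertices suffice, so 10 is
    generous. *)
Lemma exit_to_B P ps R : absorbing P ps R -> room 10 R ->
  exists P' R', [/\ absorbing P' ps R', final P' \in B & #|R| <= #|R'| + 10].
Proof.
rewrite /room => aP rm.
have step P1 R1 (X : {set T}) s : absorbing P1 ps R1 -> X \subset Typ -> L <= #|X| ->
    #|R| <= #|R1| + s -> s <= 9 -> #|[set y in X | ~~ g (final P1) y]| <= t ->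
    (forall y, y \in X -> sS (final P1) = sY y) ->
    exists P' R', [/\ absorbing P' ps R', final P' \in X & #|R| <= #|R'| + s.+1].
  move=> aP1 XT LX cR s9 nX st.
  have [||y [yX yR _ gy]] := @pick_free X R1 set0 (g (final P1)) t XT (absorbing_sub aP1) LX.
  - by rewrite cards0; clear - rm cR s9; lia.
  - exact: nX.
  exists (join P1 (single y)), (R1 :\ y); split.
  - by apply: absorb_vertex => //; apply: st.
  - by rewrite final_join.
  - by have := cardsD1_leq R1 y; clear - cR; lia.
have fromA P1 R1 s : absorbing P1 ps R1 -> final P1 \in A -> #|R| <= #|R1| + s -> s <= 9 ->
    exists P' R', [/\ absorbing P' ps R', final P' \in B & #|R| <= #|R'| + s.+1].
  move=> a1 fA cR s9; apply: (@step P1 R1) => //; first exact: nAB.1.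
  by move=> y /stB[_ /negbTE->]; have [/negbTE-> _] := stA fA.
have fromD P1 R1 s : absorbing P1 ps R1 -> final P1 \in D -> #|R| <= #|R1| + s -> s <= 8 ->
    exists P' R', [/\ absorbing P' ps R', final P' \in B & #|R| <= #|R'| + s.+2].
  move=> a1 fD cR s8; have [/negbTE s1 _] := stD fD.
  case: LA => [LA'|[_ nDB]].
    have [|||P2 [R2 [a2 f2 c2]]] := @step P1 R1 A s a1 AT LA' cR.
    - by clear - s8; lia.
    - exact: nDA.1.
    - by move=> y /stA[_ /negbTE->].
    by apply: (fromA P2 R2) => //; clear - s8; lia.
  have [|||P2 [R2 [a2 f2 c2]]] := @step P1 R1 B s a1 BT LB cR.
  - by clear - s8; lia.
  - exact: nDB.1.
  - by move=> y /stB[_ /negbTE->].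
  by exists P2, R2; split=> //; clear - c2; lia.
have fromC P1 R1 s : absorbing P1 ps R1 -> final P1 \in C -> #|R| <= #|R1| + s -> s <= 7 ->
    exists P' R', [/\ absorbing P' ps R', final P' \in B & #|R| <= #|R'| + s.+3].
  move=> a1 fC cR s7; have [s1 _] := stC fC.
  have [|||P2 [R2 [a2 f2 c2]]] := @step P1 R1 D s a1 DT LD cR.
  - by clear - s7; lia.
  - exact: nCD.1.
  - by move=> y /stD[_ ->].
  by apply: (fromD P2 R2) => //; clear - s7; lia.
have weak s P' R' : s <= 10 -> absorbing P' ps R' -> final P' \in B -> #|R| <= #|R'| + s ->
    exists P' R', [/\ absorbing P' ps R', final P' \in B & #|R| <= #|R'| + 10].
  by move=> s10 a' f' c'; exists P', R'; split=> //; apply: leq_trans c' _; rewrite leq_add2l.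
have stepN (X : {set T}) : X \subset Typ -> L <= #|[set y in X | g (final P) y]| ->
    (forall y, y \in X -> sS (final P) = sY y) ->
    exists P' R', [/\ absorbing P' ps R', final P' \in X & #|R| <= #|R'| + 1].
  move=> XT LX st.
  have NT : [set y in X | g (final P) y] \subset Typ.
    by apply: subset_trans XT; apply/subsetP => y; rewrite inE => /andP[].
  have [||||P' [R' [a' f' c']]] := @step P R [set y in X | g (final P) y] 0 aP NT LX.
  - by rewrite addn0.
  - by [].
  - by rewrite (_ : [set _ in _ | _] = set0) ?cards0 //; apply/setP => y; rewrite !inE; case: g; rewrite ?andbF.
  - by move=> y; rewrite inE => /andP[yX _]; apply: st.
  by exists P', R'; split=> //; move: f'; rewrite inE => /andP[].
have [sp|sp] := boolP (sS (final P)).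
  have [|||P1 [R1 [a1 f1 c1]]] := stepN (C :|: D).
  - by rewrite subUset CT.
  - exact: out_gamma.
  - by move=> y; rewrite !inE sp => /orP[/stC[_ ->]|/stD[_ ->]].
  move: f1; rewrite inE => /orP[f1|f1].
    have [|P2 [R2 [a2 f2 c2]]] := fromC P1 R1 1 a1 f1 c1; first by [].
    exact: (weak _ _ _ _ a2 f2 c2).
  have [|P2 [R2 [a2 f2 c2]]] := fromD P1 R1 1 a1 f1 c1; first by [].
  exact: (weak _ _ _ _ a2 f2 c2).
have [|||P1 [R1 [a1 f1 c1]]] := stepN (A :|: B).
- by rewrite subUset AT.
- exact: out_alpha.
- by move=> y; rewrite !inE (negbTE sp) => /orP[/stA[_ /negbTE->]|/stB[_ /negbTE->]].
move: f1; rewrite inE => /orP[f1|f1]; last exact: (weak _ _ _ _ a1 f1 c1).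
have [|P2 [R2 [a2 f2 c2]]] := fromA P1 R1 1 a1 f1 c1; first by [].
exact: (weak _ _ _ _ a2 f2 c2).
Qed.

(** Each path costs at most 5 vertices to be reached and 10 for the return to [B]. *)
Lemma absorb_all P ps R : absorbing P ps R -> final P \in B -> room (15 * size ps + 15) R ->
  exists P' R', [/\ absorbing P' [::] R', final P' \in B & #|R| <= #|R'| + 15 * size ps].
Proof.
rewrite /room; elim: ps P R => [|p ps IH] P R aP fB rm.
  by exists P, R; split=> //; rewrite addn0.
rewrite [size _]/= in rm *.
have [|P1 [R1 [a1 f1 c1]]] := reach_path aP fB _ (erefl (p :: ps)).
  by clear - rm; lia.
have [|P2 [R2 [a2 f2 c2]]] := exit_to_B a1.
  by rewrite /room; clear - rm c1; lia.
have [|P3 [R3 [a3 f3 c3]]] := IH P2 R2 a2 f2.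
  by clear - rm c1 c2; lia.
by exists P3, R3; split=> //; clear - c1 c2 c3; lia.
Qed.

(** The four classes carry four different pairs of states. *)
Lemma classes_exclusive x :
  [&& ~~ ((x \in A) && (x \in B)), ~~ ((x \in A) && (x \in C)), ~~ ((x \in A) && (x \in D)),
      ~~ ((x \in B) && (x \in C)), ~~ ((x \in B) && (x \in D)) & ~~ ((x \in C) && (x \in D))].
Proof.
have := @stA x; have := @stB x; have := @stC x; have := @stD x.
case: (x \in A); case: (x \in B); case: (x \in C); case: (x \in D) => //=;
  by case: (sS x); case: (sY x) => hD hC hB hA //; exfalso;
     do ?[case: hD => // | case: hC => // | case: hB => // | case: hA => //].
Qed.

Ltac by_classes x :=
  have := classes_exclusive x;
  case: (x \in A); case: (x \in B); case: (x \in C); case: (x \in D).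

Lemma enum_classes (R : {set T}) : R \subset Typ -> perm_eq (enum R)
  (enum (A :&: R) ++ enum (B :&: R) ++ enum (C :&: R) ++ enum (D :&: R)).
Proof.
move=> RT.
have -> : A :&: R = R :&: A by apply: setIC.
have -> : B :&: R = (R :\: A) :&: B.
  by apply/setP => x; rewrite !inE; by_classes x; case: (x \in R).
have -> : C :&: R = (R :\: A :\: B) :&: C.
  by apply/setP => x; rewrite !inE; by_classes x; case: (x \in R).
have -> : D :&: R = R :\: A :\: B :\: C.
  apply/setP => x; rewrite !inE; have := subsetP RT x; rewrite !inE.
  by by_classes x; case: (x \in R) => //= _ /(_ isT).
apply/permP => p; have /permP/(_ p) := enum_setI_setD R A.
have /permP/(_ p) := enum_setI_setD (R :\: A) B.
have /permP/(_ p) := enum_setI_setD (R :\: A :\: B) C.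
by rewrite !count_cat; clear; lia.
Qed.

(** Without remaining paths the balance clause compares B and C in [R], plus 1 for the end of [P],
    with C and D in [R]; the contribution of [C] cancels. *)
Lemma absorbing_balance P R : absorbing P [::] R -> final P \in B ->
  #|B :&: R|.+1 = #|D :&: R|.
Proof.
move=> [_ RT _ _ /=] + fB; have [-> _] := stB fB; rewrite add0n addn0.
have cd (U V : {set T}) : (forall x, ~~ ((x \in U) && (x \in V))) ->
    #|(U :&: R) :|: (V :&: R)| = #|U :&: R| + #|V :&: R|.
  move=> h; rewrite -cardsUI (_ : (U :&: R) :&: (V :&: R) = set0) ?cards0 ?addn0 //.
  by apply/setP => x; rewrite !inE; have := h x; case: (x \in U); case: (x \in V);
    rewrite ?andbF.
have -> : [set x in R | sS x] = (B :&: R) :|: (C :&: R).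
  apply/setP => x; rewrite !inE; case xR: (x \in R); rewrite ?andbF // !andbT /=.
  have := subsetP RT _ xR; rewrite !inE => /orP[/orP[/orP[]|]|] xX.
  - have [/negbTE-> _] := stA xX; have := classes_exclusive x; rewrite xX /=.
    by case: (x \in B); case: (x \in C).
  - by have [-> _] := stB xX; rewrite xX.
  - by have [-> _] := stC xX; rewrite xX orbT.
  - have [/negbTE-> _] := stD xX; have := classes_exclusive x; rewrite xX /= !andbT.
    by case: (x \in B); case: (x \in C); rewrite ?andbF.
have -> : [set x in R | sY x] = (C :&: R) :|: (D :&: R).
  apply/setP => x; rewrite !inE; case xR: (x \in R); rewrite ?andbF // !andbT /=.
  have := subsetP RT _ xR; rewrite !inE => /orP[/orP[/orP[]|]|] xX.
  - have [_ /negbTE->] := stA xX; have := classes_exclusive x; rewrite xX /=.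
    by case: (x \in C); case: (x \in D); rewrite ?andbF.
  - have [_ /negbTE->] := stB xX; have := classes_exclusive x; rewrite xX /=.
    by case: (x \in C); case: (x \in D); rewrite ?andbF.
  - by have [_ ->] := stC xX; rewrite xX.
  - by have [_ ->] := stD xX; rewrite xX orbT.
rewrite !cd; first by clear; lia.
  by move=> x; have := classes_exclusive x => /and5P[_ _ _ _ /andP[]].
by move=> x; have := classes_exclusive x => /and5P[_ _ _ + _].
Qed.

Lemma class_step (X R : {set T}) x : x \in R ->
  #|X :&: R| = (x \in X) + #|X :&: (R :\ x)|.
Proof.
move=> xR; rewrite (cardsD1 x) !inE xR andbT; congr (_ + #|pred_of_set _|).
by apply/setP => y; rewrite !inE; case: eqP; rewrite ?andbF ?andbT.
Qed.

(* The round b -> c -> d -> b' avoids [A]. *)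
Lemma extra_round P R d b : absorbing P [::] R -> final P \in B -> room 0 R ->
  d \in D -> b \in B -> d \in R -> b \in R -> g d b ->
  exists P' R', [/\ absorbing P' [::] R', final P' \in B, #|R| <= #|R'| + 3,
    #|A :&: R'| = #|A :&: R| & #|D :&: R'|.+1 = #|D :&: R|].
Proof.
rewrite /room => aP fB rm dD bB dR bR gdb; have RT := absorbing_sub aP.
have [|||c [cC cR _ gc cd]] :=
    @pick_free2 C R set0 (g (final P)) (fun c => g c d) CT RT LC.
- by rewrite cards0; clear - rm; lia.
- exact: nBC.1.
- exact: nCD.2.
have [s1 s2] := stB fB; have [s3 s4] := stC cC; have [s5 s6] := stD dD.
have [s7 s8] := stB bB; have xc := classes_exclusive c.
have xd := classes_exclusive d; have xb := classes_exclusive b.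
rewrite cC in xc; rewrite dD in xd; rewrite bB in xb.
have dc : d != c by apply: contraTneq xc => <-; rewrite dD; rewrite !andbF.
have bd : b != d by apply: contraTneq xd => <-; rewrite bB; rewrite !andbF.
have bc : b != c by apply: contraTneq xc => <-; rewrite bB; rewrite !andbF.
have dRc : d \in R :\ c by rewrite !inE dc dR.
have bRcd : b \in R :\ c :\ d by rewrite !inE bd bc bR.
have a1 := absorb_vertex aP cR gc (etrans s1 (esym s4)).
have a2 : absorbing (join (join P (single c)) (single d)) [::] (R :\ c :\ d).
  by apply: absorb_vertex => //; rewrite ?final_join // [final _]/= s3 s6.
have a3 : absorbing (join (join (join P (single c)) (single d)) (single b)) [::]
    (R :\ c :\ d :\ b).
  apply: absorb_vertex => //; rewrite ?final_join //.
  by rewrite [final _]/= (negbTE s5) (negbTE s8).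
exists (join (join (join P (single c)) (single d)) (single b)), (R :\ c :\ d :\ b).
have e X : #|X :&: R| =
    (c \in X) + ((d \in X) + ((b \in X) + #|X :&: (R :\ c :\ d :\ b)|)).
  by rewrite (class_step X cR) (class_step X dRc) (class_step X bRcd).
split=> //.
- by rewrite final_join.
- have := cardsD1_leq R c; have := cardsD1_leq (R :\ c) d.
  by have := cardsD1_leq (R :\ c :\ d) b; clear; lia.
- rewrite [RHS]e; move: xc xd xb; rewrite !andbT.
  by case: (c \in A) => //; case: (d \in A); rewrite ?andbF //; case: (b \in A); rewrite ?andbF.
- rewrite [RHS]e dD; move: xc xb; rewrite !andbT.
  by case: (c \in D); rewrite ?andbF //; case: (b \in D); rewrite ?andbF.
Qed.

(** [finish_balanced] tolerates only one of A and C being shorter than D. A round takes one vertex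
    from each of B, C, D and none from A, so the lead of D over A drops by 1 and [j] rounds are
    enough. *)
Lemma balance_rounds U j P R :
  (forall R' : {set T}, R' \subset Typ -> #|Typ| <= #|R'| + U ->
     exists d b, [/\ d \in D, b \in B, d \in R', b \in R' & g d b]) ->
  absorbing P [::] R -> final P \in B -> #|Typ| + 3 * j <= #|R| + U ->
  U + 2 * t + 10 < L -> #|D :&: R| <= #|A :&: R| + j ->
  exists P' R', [/\ absorbing P' [::] R', final P' \in B, #|R| <= #|R'| + 3 * j &
    (#|D :&: R'| <= #|A :&: R'|) || (#|D :&: R'| <= #|C :&: R'|)].
Proof.
move=> dense; elim: j P R => [|j IH] P R aP fB rm UL le.
  by exists P, R; rewrite addn0 in le; rewrite addn0 le.
case: (boolP ((#|D :&: R| <= #|A :&: R|) || (#|D :&: R| <= #|C :&: R|))) => [ok|_].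
  by exists P, R; split=> //; rewrite leq_addr.
have [|d [b [dD bB dR bR gdb]]] := dense R (absorbing_sub aP); first by clear - rm; lia.
have [|P1 [R1 [a1 f1 c1 cA cD]]] := extra_round aP fB _ dD bB dR bR gdb.
  by rewrite /room; clear - rm UL; lia.
have [||P2 [R2 [a2 f2 c2 c2']]] := IH P1 R1 a1 f1 _ UL.
- by clear - rm c1; lia.
- by clear - cA cD le; lia.
by exists P2, R2; split=> //; clear - c1 c2; lia.
Qed.

End Absorption.

(** * Balancing the types *)

Lemma first_le_final (T : finType) (r : rel T) (rk : T -> nat) (u : T * seq T) :
  (forall x y, r x y -> rk x < rk y) -> dipath r u -> rk (first u) <= rk (final u).
Proof.
move=> inc; case: u => x s; rewrite /dipath /first /final /=.
by elim: s x => //= y s IH x /andP[/inc/ltnW xy /IH]; apply: leq_trans.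
Qed.

Lemma perm_extract (U V : eqType) (f : U -> V) (s : seq U) (w : seq V) y :
  perm_eq (map f s) w -> y \in w ->
  exists2 u, f u = y & exists2 s', perm_eq s (u :: s') & perm_eq (map f s') (rem y w).
Proof.
move=> p yw; have := yw; rewrite -(perm_mem p) => /mapP[u us ey]; exists u => //.
have pu := perm_to_rem us; exists (rem u s) => //.
have := perm_map f pu; rewrite /= -ey => pf.
have : perm_eq (y :: map f (rem u s)) (y :: rem y w).
  by apply: perm_trans (perm_to_rem yw); apply: perm_trans p; rewrite perm_sym.
by rewrite perm_cons.
Qed.

Lemma rem_enum (T : finType) (Q : {set T}) y : y \in Q -> perm_eq (rem y (enum Q)) (enum (Q :\ y)).
Proof.
move=> yQ; have := enum_setD1 yQ; have := perm_to_rem (_ : y \in enum Q).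
rewrite mem_enum => /(_ yQ) p1 p2; rewrite -(perm_cons y); apply: perm_trans p2.
by rewrite perm_sym.
Qed.

(* The rank [rk] forbids the arcs of [M] to close a cycle. *)
Lemma paths_of_matching (T : finType) (Q : {set T}) (M : {set T * T}) (rk : T -> nat) :
  is_matching M ->
  (forall x y, (x, y) \in M -> [/\ x \in Q, y \in Q & rk x < rk y]) ->
  exists ps : seq (T * seq T),
    [/\ perm_eq (all_verts ps) (enum Q),
        all (dipath (fun x y => (x, y) \in M)) ps,
        perm_eq (map (@final T) ps) (enum (Q :\: [set e.1 | e in M])) &
        perm_eq (map (@first T) ps) (enum (Q :\: [set e.2 | e in M]))].
Proof.
have [j] := ubnP #|M|; elim: j M => // j IH M; rewrite ltnS => Mj [M1 M2] MQ.
have [M0|[[x y] xyM]] := set_0Vmem M.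
  exists (map (@single T) (enum Q)).
  by rewrite all_verts_single map_final_single map_first_single dipath_single M0
    !imset0 !setD0.
pose M' := M :\ (x, y).
have M'M e : e \in M' -> e \in M by rewrite inE => /andP[].
have cM' : #|M'| < j by move: Mj; rewrite (cardsD1 (x, y) M) xyM.
have [||ps [pv dp pl pf]] := IH M' cM'.
- by split=> e f /M'M eM /M'M fM; [apply: M1|apply: M2].
- by move=> u v /M'M; apply: MQ.
have [xQ yQ rxy] := MQ _ _ xyM.
have xl : x \in enum (Q :\: [set e.1 | e in M']).
  rewrite mem_enum inE xQ andbT; apply/imsetP => -[e eM' /= ex].
  have := M1 e (x, y) (M'M _ eM') xyM; rewrite -ex => /(_ erefl) ee.
  by rewrite ee setD11 in eM'.
have yf : y \in enum (Q :\: [set e.2 | e in M']).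
  rewrite mem_enum inE yQ andbT; apply/imsetP => -[e eM' /= ey].
  have := M2 e (x, y) (M'M _ eM') xyM; rewrite -ey => /(_ erefl) ee.
  by rewrite ee setD11 in eM'.
have [u ux [s' ps' ps'l]] := perm_extract pl xl.
have yu : first u != y.
  apply/negP => /eqP uy; have /(allP dp) du : u \in ps by rewrite (perm_mem ps') mem_head.
  have : rk (first u) <= rk (final u).
    by apply: first_le_final du => a b /M'M /MQ[].
  by rewrite uy ux leqNgt rxy.
have [v vy [s'' pvs pfs]] : exists2 v, first v = y & exists2 s'', perm_eq s' (v :: s'') &
    perm_eq (map (@first T) s') (y :: map (@first T) s'').
  have : y \in map (@first T) ps by rewrite (perm_mem pf).
  rewrite (perm_mem (perm_map (@first T) ps')) inE eq_sym (negbTE yu) /= => /mapP[v vs ev].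
  exists v => //; exists (rem v s'); first exact: perm_to_rem.
  by have := perm_map (@first T) (perm_to_rem vs); rewrite /= -ev.
have pall : perm_eq ps (u :: v :: s'').
  by apply: perm_trans ps' _; rewrite perm_cons.
have imE (f : T * T -> T) : [set f e | e in M] = f (x, y) |: [set f e | e in M'].
  by rewrite -imsetU1 setD1K.
exists (join u v :: s''); split.
- apply: perm_trans pv; rewrite perm_sym; apply: perm_trans (perm_all_verts pall) _.
  by rewrite !all_verts_cons verts_join -catA.
- have : all (dipath (fun a b => (a, b) \in M)) ps.
    by apply: sub_all dp => w; apply: sub_path => a b; apply: M'M.
  rewrite (perm_all _ pall) /= dipath_join => /and3P[-> -> ->].
  by rewrite ux vy xyM.
- rewrite /= final_join imE /= -setDDl setDDl setUC -setDDl.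
  apply: perm_trans (rem_enum _); last by rewrite -mem_enum.
  apply: perm_trans ps'l; rewrite perm_sym.
  exact: perm_map pvs.
- rewrite /= imE /= setUC -setDDl.
  apply: perm_trans (rem_enum _); last by rewrite -mem_enum.
  rewrite -(perm_cons y); apply: perm_trans (perm_to_rem yf).
  apply: perm_trans pf; rewrite perm_sym; apply: perm_trans (perm_map (@first T) pall) _.
  by rewrite !map_cons vy; exact/permPl/(perm_catCA [:: first u] [:: y]).
Qed.

(* Vertices with many arcs towards the other side are moved as long as there is a
   surplus; when none is left, the bad arcs have small degrees and
   [bad_arc_forest] applies. *)
Lemma fix_surplus (T : finType) (g : rel T) (X Y UX UY core Ex : {set T}) (k h : nat) :
  oriented_graph g -> ore_condition g ->
  #|X| + #|Y| = #|T| + k -> X \subset UX :|: Ex -> Y \subset UY :|: Ex ->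
  core \subset X :&: Y -> X :&: Y \subset core :|: Ex ->
  2000 * (h + #|Ex|) <= #|T| -> #|T| + 5 * k <= 5 * #|core| ->
  8 * (#|core| + #|Ex|) <= 3 * #|T| -> 100 * k <= #|T| -> 1000 <= #|T| ->
  exists (X' Y' : {set T}) (M : {set T * T}) (rk : T -> nat),
  [/\ [/\ X' \subset X, Y' \subset Y & #|X :\: X'| + #|Y :\: Y'| <= k],
      (forall v, v \in X :\: X' -> h <= #|[set y in UY | g v y]|),
      (forall v, v \in Y :\: Y' -> h <= #|[set y in UX | g y v]|),
      #|X'| + #|Y'| = #|T| + #|M| /\ #|M| <= k &
      is_matching M /\
      (forall x y, (x, y) \in M -> [/\ x \in X', y \in Y', g x y & rk x < rk y])].
Proof.
move=> og ore sXY XU YU cXY XYc b_small c_large c_small k_small n_large.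
pose MX := [set v in X | h <= #|[set y in UY | g v y]|].
pose MY := [set v in Y | h <= #|[set y in UX | g y v]|].
have MXX : MX \subset X by apply/subsetP => v; rewrite inE => /andP[].
have MYY : MY \subset Y by apply/subsetP => v; rewrite inE => /andP[].
have cD (W V : {set T}) : V \subset W -> #|W :\: V| + #|V| = #|W|.
  by move=> VW; rewrite addnC -[RHS](cardsID V W) (setIidPr VW).
have DD (W V : {set T}) : V \subset W -> W :\: (W :\: V) = V.
  by move=> VW; rewrite setDDr setDv set0U (setIidPr VW).
(* With enough movable vertices exactly [k] of them are moved, as many as possible from [MX], and no
   bad arcs are needed. *)
have [le|gt] := leqP k (#|MX| + #|MY|).
  have [RX RXM cRX] := exists_subset_card (geq_minr k #|MX|).
  have kY : k - minn k #|MX| <= #|MY| by clear - le; lia.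
  have [RY RYM cRY] := exists_subset_card kY.
  have RXX := subset_trans RXM MXX; have RYY := subset_trans RYM MYY.
  exists (X :\: RX), (Y :\: RY), set0, (fun=> 0); rewrite !DD ?cards0 //; split.
  - by split; rewrite ?subsetDl // cRX cRY; clear; lia.
  - by move=> v /(subsetP RXM); rewrite inE => /andP[].
  - by move=> v /(subsetP RYM); rewrite inE => /andP[].
  - split=> //; have := cD _ _ RXX; have := cD _ _ RYY; rewrite cRX cRY.
    by clear - sXY le; lia.
  - by split; [split=> e; rewrite inE | move=> x y; rewrite inE].
have cX := cD _ _ MXX; have cY := cD _ _ MYY.
set X' := X :\: MX in cX *; set Y' := Y :\: MY in cY *.
have X'X : X' \subset X by apply: subsetDl.
have Y'Y : Y' \subset Y by apply: subsetDl.
(* A vertex left in [X'] was not movable, so it sends fewer than [h] arcs into [UY]; the part of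
   [Y'] outside [UY] lies in [Ex]. *)
have outD x : x \in X' :&: Y' -> #|[set y in X' :&: Y' | g x y]| <= h + #|Ex|.
  rewrite inE => /andP[]; rewrite inE => /andP[xM xX] _.
  move: xM; rewrite inE xX /= -ltnNge => lt.
  apply: leq_trans (leq_add (ltnW lt) (leqnn #|Ex|)); rewrite -cardsUI.
  apply: leq_trans (leq_addr _ _); apply/subset_leq_card/subsetP => y.
  rewrite inE => /andP[/setIP[_ /(subsetP Y'Y)/(subsetP YU)/setUP[yU|yE]] gxy].
    by rewrite !inE yU gxy.
  by rewrite !inE yE orbT.
have inD x : x \in X' :&: Y' -> #|[set y in X' :&: Y' | g y x]| <= h + #|Ex|.
  rewrite inE => /andP[_]; rewrite inE => /andP[xM xY].
  move: xM; rewrite inE xY /= -ltnNge => lt.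
  apply: leq_trans (leq_add (ltnW lt) (leqnn #|Ex|)); rewrite -cardsUI.
  apply: leq_trans (leq_addr _ _); apply/subset_leq_card/subsetP => y.
  rewrite inE => /andP[/setIP[/(subsetP X'X)/(subsetP XU)/setUP[yU|yE] _] gxy].
    by rewrite !inE yU gxy.
  by rewrite !inE yE orbT.
have c1 : #|core| <= #|X' :&: Y'| + (#|MX| + #|MY|).
  apply: leq_trans (leq_add (leqnn _) (leq_trans (leq_addr _ _) (eq_leq (cardsUI MX MY)))).
  rewrite -cardsUI; apply: leq_trans (leq_addr _ _).
  apply/subset_leq_card/subsetP => x /(subsetP cXY); rewrite !inE => /andP[-> ->].
  by rewrite !andbT /=; case: (_ <= _); case: (_ <= _).
have c2 : #|X' :&: Y'| <= #|core| + #|Ex|.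
  rewrite -cardsUI; apply: leq_trans (leq_addr _ _).
  apply/subset_leq_card; apply: subset_trans XYc; exact: setISS.
have D1 : #|T| <= 5 * #|X' :&: Y'| by clear - c1 gt c_large; lia.
have D2 : 8 * #|X' :&: Y'| <= 3 * #|T| by clear - c2 c_small; lia.
have s' : #|X'| + #|Y'| = #|T| + (k - (#|MX| + #|MY|)) by clear - cX cY sXY gt; lia.
have k' : 100 * (k - (#|MX| + #|MY|)) <= #|T| by clear - k_small; lia.
have [M [rk [cM mM aM]]] := bad_arc_forest og ore outD inD b_small D1 D2 n_large s' k'.
exists X', Y', M, rk; split=> //.
- by split=> //; rewrite !DD //; clear - gt; lia.
- by move=> v; rewrite DD // inE => /andP[].
- by move=> v; rewrite DD // inE => /andP[].
- by rewrite cM; split=> //; clear; lia.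
Qed.

Lemma count_enum (T : finType) (V : {set T}) (p : pred T) :
  count p (enum V) = #|[set x in V | p x]|.
Proof.
rewrite -size_filter; have /card_uniqP <- := filter_uniq p (enum_uniq (mem V)).
by apply: eq_card => x; rewrite mem_filter mem_enum inE andbC.
Qed.

Definition symdiff (T : finType) (U V : {set T}) := (U :\: V) :|: (V :\: U).

(** * Choice of the out-type and the in-type of every vertex *)

Section States.
Variables (T : finType) (g : rel T) (A B C D X Y : {set T}) (L0 h kk : nat).
Hypotheses (og : oriented_graph g) (ore : ore_condition g).
Local Notation n := #|T|.
Local Notation Typ := (A :|: B :|: C :|: D).
Local Notation Ex := (~: Typ).

Hypotheses (XU : X \subset (A :|: D) :|: Ex) (YU : Y \subset (C :|: D) :|: Ex).
Hypotheses (XU' : ~: X \subset (B :|: C) :|: Ex) (YU' : ~: Y \subset (A :|: B) :|: Ex).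
Hypotheses (coreD : D \subset X :&: Y) (coreD' : X :&: Y \subset D :|: Ex).
Hypotheses (coreB : B \subset ~: X :&: ~: Y) (coreB' : ~: X :&: ~: Y \subset B :|: Ex).
Hypotheses (small_h : 2000 * (h + #|Ex|) <= n) (n_large : 1000 <= n) (kk_small : 100 * kk <= n).
Hypotheses (D_large : n + 5 * kk <= 5 * #|D|) (D_small : 8 * (#|D| + #|Ex|) <= 3 * n).
Hypotheses (B_large : n + 5 * kk <= 5 * #|B|) (B_small : 8 * (#|B| + #|Ex|) <= 3 * n).
Hypotheses (diff1 : #|X| + #|Y| <= n + kk) (diff2 : n <= #|X| + #|Y| + kk) (L0h : L0 <= h).

Definition accepting (X Y : {set T}) := forall v,
  [/\ v \in X -> L0 <= #|[set y in A :|: B | g v y]|,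
      v \notin X -> L0 <= #|[set y in C :|: D | g v y]|,
      v \in Y -> L0 <= #|[set y in B :|: C | g y v]| &
      v \notin Y -> L0 <= #|[set y in A :|: D | g y v]|].

(** A deficit of |X| + |Y| is a surplus of the complements, with [B] instead of [D] as core; this
    gives the second alternative. A vertex that changes type has at least h >= L0 arcs on its new
    side, so [accepting] survives. *)
Lemma choose_states : accepting X Y ->
  exists (XF YF : {set T}) (M : {set T * T}) (rk : T -> nat),
  [/\ accepting XF YF, #|symdiff X XF| + #|symdiff Y YF| <= kk, is_matching M /\ #|M| <= kk,
      forall x y, (x, y) \in M -> g x y /\ rk x < rk y &
      (forall x y, (x, y) \in M -> x \in XF /\ y \in YF) /\ #|XF| + #|YF| = n + #|M| \/
      (forall x y, (x, y) \in M -> x \notin XF /\ y \notin YF) /\ #|XF| + #|YF| + #|M| = n].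
Proof.
move=> acc; have [le|lt] := leqP n (#|X| + #|Y|).
  have e : #|X| + #|Y| = n + (#|X| + #|Y| - n) by clear - le; lia.
  have [||XF [YF [M [rk [[XX YY cc] mX mY [cXY cM] [mM aM]]]]]] :=
    fix_surplus og ore e XU YU coreD coreD' small_h _ D_small _ n_large.
  - by clear - D_large diff1; lia.
  - by clear - kk_small diff1; lia.
  exists XF, YF, M, rk; split.
  - move=> v; have [a1 a2 a3 a4] := acc v; split=> [vX|vX|vY|vY].
    + exact/a1/(subsetP XX).
    + case: (boolP (v \in X)) => [vX'|/a2//]; apply: leq_trans L0h _.
      by apply: mX; rewrite inE vX vX'.
    + exact/a3/(subsetP YY).
    + case: (boolP (v \in Y)) => [vY'|/a4//]; apply: leq_trans L0h _.
      by apply: mY; rewrite inE vY vY'.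
  - have dX : XF :\: X = set0 by apply/eqP; rewrite setD_eq0.
    have dY : YF :\: Y = set0 by apply/eqP; rewrite setD_eq0.
    by rewrite /symdiff dX dY !setU0; apply: leq_trans cc _; clear - diff1; lia.
  - by split=> //; apply: leq_trans cM _; clear - diff1; lia.
  - by move=> x y /aM[].
  - by left; split=> // x y /aM[].
have e : #|~: X| + #|~: Y| = n + (n - (#|X| + #|Y|)).
  by have := cardsC X; have := cardsC Y; clear - lt; lia.
have [||S [R [M [rk [[XX YY cc] mX mY [cXY cM] [mM aM]]]]]] :=
  fix_surplus og ore e XU' YU' coreB coreB' small_h _ B_small _ n_large.
- by clear - B_large diff2; lia.
- by clear - kk_small diff2; lia.
have sd (U V : {set T}) : V \subset ~: U -> symdiff U (~: V) = ~: U :\: V.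
  move=> VU; apply/setP => x; rewrite !inE negbK.
  case xV: (x \in V); last by case: (x \in U).
  by have := subsetP VU x xV; rewrite inE => /negbTE->.
exists (~: S), (~: R), M, rk; split.
- move=> v; have [a1 a2 a3 a4] := acc v; split; rewrite inE ?negbK => vS.
  + case: (boolP (v \in X)) => [/a1//|vX']; apply: leq_trans L0h _.
    by apply: mX; rewrite inE vS inE.
  + by apply/a2; have := subsetP XX _ vS; rewrite inE.
  + case: (boolP (v \in Y)) => [/a3//|vY']; apply: leq_trans L0h _.
    by apply: mY; rewrite inE vS inE.
  + by apply/a4; have := subsetP YY _ vS; rewrite inE.
- by rewrite !sd //; apply: leq_trans cc _; clear - diff2; lia.
- by split=> //; apply: leq_trans cM _; clear - diff2; lia.
- by move=> x y /aM[].
- right; split=> [x y /aM[xS yR _ _]|]; first by rewrite !inE xS yR.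
  by have := cardsC S; have := cardsC R; clear - cXY; lia.
Qed.

End States.

(** * The initial path system *)

Section Start.
Variables (T : finType) (g : rel T) (A B C D X Y XF YF : {set T}) (L0 kk : nat).
Local Notation n := #|T|.
Local Notation Typ := (A :|: B :|: C :|: D).

Variables (M : {set T * T}) (rk : T -> nat).
Hypotheses (cX : #|symdiff X XF| + #|symdiff Y YF| <= kk) (mM : is_matching M) (cM : #|M| <= kk).
Hypothesis aM : forall x y, (x, y) \in M -> g x y /\ rk x < rk y.
Hypothesis bal :
  (forall x y, (x, y) \in M -> x \in XF /\ y \in YF) /\ #|XF| + #|YF| = n + #|M| \/
  (forall x y, (x, y) \in M -> x \notin XF /\ y \notin YF) /\ #|XF| + #|YF| + #|M| = n.
Hypotheses (sA : forall x, x \in A -> x \in X /\ x \notin Y)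
  (sB : forall x, x \in B -> x \notin X /\ x \notin Y)
  (sC : forall x, x \in C -> x \notin X /\ x \in Y)
  (sD : forall x, x \in D -> x \in X /\ x \in Y).

Let A' := [set x in A | (x \in XF) && (x \notin YF)].
Let B' := [set x in B | (x \notin XF) && (x \notin YF)].
Let C' := [set x in C | (x \notin XF) && (x \in YF)].
Let D' := [set x in D | (x \in XF) && (x \in YF)].
Let Typ' := A' :|: B' :|: C' :|: D'.

(** A typical vertex is dropped only if its out-type or its in-type was changed, which puts it into
    one of the two symmetric differences. *)
Lemma kept_classes : #|Typ :\: Typ'| <= kk.
Proof.
apply: leq_trans cX; rewrite -cardsUI; apply: leq_trans (leq_addr _ _).
apply/subset_leq_card/subsetP => x; rewrite /Typ' !inE => /andP[].
have := @sA x; have := @sB x; have := @sC x; have := @sD x.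
case: (x \in A); case: (x \in B); case: (x \in C); case: (x \in D) => //=;
 case: (x \in X); case: (x \in Y); case: (x \in XF); case: (x \in YF) => //= h1 h2 h3 h4 _ _;
 by do ?[case: h1 => // | case: h2 => // | case: h3 => // | case: h4 => //].
Qed.

(** The paths to absorb are built from the arcs of [M] and cover all vertices outside [Typ'] and all
    ends of [M]. The special path starts as a single vertex of [B'], found because at most |~: Typ|
    + 3kk vertices are covered so far. *)
Lemma start_absorbing : 4 * kk + #|~: Typ| < #|B| ->
  exists P ps R,
    [/\ absorbing g A' B' C' D' (fun x => x \notin XF) (fun x => x \in YF) P ps R,
        final P \in B', size ps <= #|~: Typ| + 3 * kk & #|Typ'| <= #|R| + 2 * kk + 1].
Proof.
move=> B_large; pose E1 := [set e.1 | e in M]; pose E2 := [set e.2 | e in M].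
pose Q := ~: Typ' :|: (E1 :|: E2).
have cE1 : #|E1| = #|M| by apply: card_in_imset; exact: mM.1.
have cE2 : #|E2| = #|M| by apply: card_in_imset; exact: mM.2.
have cE : #|E1 :|: E2| <= 2 * kk.
  by have := cardsUI E1 E2; rewrite cE1 cE2; clear - cM; lia.
have cT' : #|~: Typ'| <= #|~: Typ| + kk.
  apply: leq_trans (leq_add (leqnn _) kept_classes); rewrite -cardsUI.
  apply: leq_trans (leq_addr _ _); apply/subset_leq_card/subsetP => x.
  by rewrite inE [x \in _ :|: _]inE ![x \in ~: _]inE [x \in _ :\: _]inE => ->; rewrite orNb.
have [|ps [pv dp pl pf]] := @paths_of_matching T Q M rk mM.
  move=> x y xyM; split; last exact: (aM xyM).2.
    by rewrite !in_setU (_ : x \in E1) ?orbT //; apply/imsetP; exists (x, y).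
  by rewrite !in_setU (_ : y \in E2) ?orbT //; apply/imsetP; exists (x, y).
have sps : size ps <= #|Q|.
  have <- : size (map (@final T) ps) = size ps by rewrite size_map.
  by rewrite (perm_size pl) -cardE subset_leq_card ?subsetDl.
have cQ : #|Q| <= #|~: Typ| + 3 * kk.
  by have := cardsUI (~: Typ') (E1 :|: E2); rewrite -/Q; clear - cE cT'; lia.
have /card_gt0P[b] : 0 < #|B :\: Q|.
  have := cardsID Q B; have := subset_leq_card (subsetIr B Q); clear - cQ B_large; lia.
rewrite inE => /andP[bQ bB].
have bT' : b \in Typ'.
  have : b \notin ~: Typ' by apply: contra bQ => bT; rewrite /Q in_setU bT.
  by rewrite in_setC negbK.
have bB' : b \in B'.
  have [/negbTE bX /negbTE bY] := sB bB.
  move: bT'; rewrite !in_setU => /orP[/orP[/orP[|//]|]|]; rewrite inE => /andP[bZ _].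
  - by have [] := sA bZ; rewrite bX.
  - by have [_] := sC bZ; rewrite bY.
  - by have [] := sD bZ; rewrite bX.
have [bXF bYF] : b \notin XF /\ b \notin YF by move: bB'; rewrite inE => /and3P[].
pose R := (~: Q) :\ b.
have bQ' : b \in ~: Q by rewrite inE.
have RT : R \subset Typ'.
  by apply/subsetP => x; rewrite !inE negb_or => /andP[_ /andP[]]; rewrite negbK.
have pQ := enum_setD1 bQ'.
exists (single b), ps, R; split; last 1 first.
- have : #|Typ'| <= #|R| + #|(E1 :|: E2)| + 1.
    have h1 := cardsD1 b (~: Q); rewrite bQ' in h1.
    have h2 : #|Typ'| <= #|~: Q| + #|E1 :|: E2|.
      rewrite -cardsUI; apply: leq_trans (leq_addr _ _).
      apply/subset_leq_card/subsetP => x xT; rewrite in_setU in_setC.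
      case: (boolP (x \in E1 :|: E2)) => [_|nE]; rewrite ?orbT // orbF.
      by rewrite /Q in_setU (negbTE nE) orbF in_setC xT.
    by rewrite /R; clear - h1 h2; lia.
  by clear - cE; lia.
- split=> //.
  + apply: (@perm_trans _ (enum (~: Q) ++ enum Q)).
      apply/permP => p; have /permP/(_ p) := pQ; have /permP/(_ p) := pv.
      by rewrite !count_cat /= -/R; clear; lia.
    have -> : enum T = enum [set: T] by apply: eq_enum => x; rewrite in_setT.
    rewrite -(setUCr Q) setUC perm_sym; apply: enum_setU_disjoint.
    by rewrite -setI_eq0 setIC setICr.
  + apply/andP; split=> //; apply: sub_all dp => w; apply: sub_path => x y xyM.
    exact: (aM xyM).1.
  + rewrite [final _]/= bXF.
    have -> : count (fun p => final p \notin XF) ps = #|[set x in Q :\: E1 | x \notin XF]|.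
      by rewrite -(count_map (@final T) (fun x => x \notin XF)) (permP pl) count_enum.
    have -> : count (fun p => first p \in YF) ps = #|[set x in Q :\: E2 | x \in YF]|.
      by rewrite -(count_map (@first T) (fun x => x \in YF)) (permP pf) count_enum.
    have part (p : pred T) : #|[set x | p x]| =
        p b + #|[set x in R | p x]| + #|[set x in Q | p x]|.
      rewrite -(cardsID Q [set x | p x]) addnC; congr (_ + _); last first.
        by apply: eq_card => x; rewrite in_setI [RHS]in_set in_set andbC.
      rewrite (cardsD1 b); have -> : b \in [set x | p x] :\: Q = p b by rewrite in_setD bQ inE.
      congr (_ + #|pred_of_set _|).
      apply/setP => x; rewrite in_setD1 in_setD /R [RHS]in_set in_setD1 in_setC in_set.
      by rewrite andbA.
    have split (E : {set T}) (p : pred T) : E \subset Q ->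
        #|[set x in Q | p x]| = #|[set x in Q :\: E | p x]| + #|[set x in E | p x]|.
      move=> EQ; rewrite -(cardsID E [set x in Q | p x]) addnC; congr (_ + _).
        by apply: eq_card => x; rewrite !inE andbA.
      apply: eq_card => x; rewrite !inE; case: (boolP (x \in E)) => [/(subsetP EQ)|].
        by rewrite !inE => ->; rewrite andbT.
      by rewrite andbF.
    have E1Q : E1 \subset Q by apply/subsetP => x xE; rewrite !in_setU xE orbT.
    have E2Q : E2 \subset Q by apply/subsetP => x xE; rewrite !in_setU xE !orbT.
    have pS := part (fun x => x \notin XF); have pY := part (fun x => x \in YF).
    rewrite (split _ _ E1Q) bXF in pS; rewrite (split _ _ E2Q) (negbTE bYF) in pY.
    have eS : #|[set x | x \notin XF]| + #|XF| = n.
      by rewrite -(cardsC XF) addnC; congr (_ + _); apply: eq_card => x; rewrite !inE.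
    have eY : #|[set x | x \in YF]| = #|YF| by apply: eq_card => x; rewrite inE.
    have full (E : {set T}) (p : pred T) : {in E, forall x, p x} -> #|[set x in E | p x]| = #|E|.
      by move=> h; apply: eq_card => x; rewrite inE; case xE: (x \in E) => //=; rewrite h.
    have none (E : {set T}) (p : pred T) : {in E, forall x, ~~ p x} -> #|[set x in E | p x]| = 0.
      by move=> h; apply: eq_card0 => x; rewrite inE; apply/negP => /andP[/h/negP].
    (* Tails of [M] end no path and heads of [M] start none. Leaving them out removes 0 departures
       and |M| arrivals in the first case, |M| departures and 0 arrivals in the second; this is
       exactly the surplus or the deficit in [bal]. *)
    case: bal => -[bM bc].
      rewrite (none E1) in pS; last by move=> x /imsetP[[u v] uvM ->]; have [? ?] := bM _ _ uvM; rewrite negbK.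
      rewrite (full E2) in pY; last by move=> x /imsetP[[u v] uvM ->]; have [? ?] := bM _ _ uvM.
      by rewrite cE2 in pY; clear - pS pY bc eS eY; lia.
    rewrite (full E1) in pS; last by move=> x /imsetP[[u v] uvM ->]; have [? ?] := bM _ _ uvM.
    rewrite (none E2) in pY; last by move=> x /imsetP[[u v] uvM ->]; have [? ?] := bM _ _ uvM.
    by rewrite cE1 in pS; clear - pS pY bc eS eY; lia.
- exact: bB'.
- exact: leq_trans sps cQ.
Qed.

End Start.

Lemma card_shrink (T : finType) (U V SD : {set T}) (p : pred T) k : U :\: V \subset SD ->
  #|SD| <= k -> #|[set x in U | p x]| <= #|[set x in V | p x]| + k.
Proof.
move=> UV SDk; apply: leq_trans (leq_add (leqnn _) SDk); rewrite -cardsUI.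
apply: leq_trans (leq_addr _ _); apply/subset_leq_card/subsetP => x.
rewrite !inE => /andP[xU ->]; rewrite andbT; case: (boolP (x \in V)) => //= xV.
by apply: (subsetP UV); rewrite inE xV.
Qed.

Lemma arcs_shrink (T : finType) (g : rel T) (X Y X1 Y1 : {set T}) w :
  X1 \subset X -> Y1 \subset Y -> #|X :\: X1| + #|Y :\: Y1| <= w ->
  arcs g X Y <= arcs g X1 Y1 + w * #|T|.
Proof.
move=> XX YY cw.
have := arcs_setIr g X Y Y1; rewrite (setIidPr YY) => ->.
have := arcs_setIr (converse g) Y1 X X1; rewrite (setIidPr XX) 3!(arcs_converse g) => ->.
have h1 := leq_trans (arcs_leq g (X :\: X1) Y1) (leq_mul (leqnn _) (max_card (mem Y1))).
have h2 := leq_trans (arcs_leq g X (Y :\: Y1)) (leq_mul (max_card (mem X)) (leqnn _)).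
have h3 := leq_mul cw (leqnn #|T|).
by clear - h1 h2 h3; lia.
Qed.

(** * From typical classes to a Hamilton cycle *)

Section Typical.
Variables (T : finType) (g : rel T) (A B C D : {set T}) (t h kk L0 L : nat).
Hypotheses (og : oriented_graph g) (ore : ore_condition g).
Local Notation n := #|T|.
Local Notation Typ := (A :|: B :|: C :|: D).
Local Notation ex := #|~: Typ|.
Hypotheses (dAB : [disjoint A & B]) (dAC : [disjoint A & C]) (dAD : [disjoint A & D])
  (dBC : [disjoint B & C]) (dBD : [disjoint B & D]) (dCD : [disjoint C & D]).
Hypotheses (nAB : near_complete g A B t) (nBC : near_complete g B C t)
  (nCD : near_complete g C D t) (nDA : near_complete g D A t).
Hypotheses (n_large : 1000 <= n) (h_small : 2000 * (h + ex) <= n) (kk_small : 100 * kk <= n).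
Hypotheses (diff1 : #|D| + ex <= #|B| + kk) (diff2 : #|B| + ex <= #|D| + kk).
Hypotheses (B_large : n + 5 * kk <= 5 * #|B|) (B_small : 8 * (#|B| + ex) <= 3 * n).
Hypotheses (D_large : n + 5 * kk <= 5 * #|D|) (D_small : 8 * (#|D| + ex) <= 3 * n).
Hypotheses (L0h : L0 <= h) (LB : L0 + t <= #|B|) (LC : L0 + t <= #|C|) (LD : L0 + t <= #|D|).
Hypothesis LA : L0 + t <= #|A| \/ A = set0 /\ near_complete g D B t.
Hypotheses (LL0 : L + kk <= L0) (L_large : 2 * t + 47 * kk + 15 * ex + 30 < L).

Let dis (U V : {set T}) x : [disjoint U & V] -> x \in U -> x \in V = false.
Proof. by move=> /disjointFr h' /h'. Qed.

(** [SD] collects the vertices whose type is changed to reduce the imbalance; the primed classes are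
    the typical vertices that keep theirs. The hypothesis [LL0] pays for this loss in the
    degrees. *)
Lemma typical_start : exists (A' B' C' D' : {set T}) (sS sY : pred T) P ps R (SD : {set T}),
  [/\ [/\ A' \subset A, B' \subset B, C' \subset C & D' \subset D],
      [/\ A :\: A' \subset SD, B :\: B' \subset SD, C :\: C' \subset SD,
          D :\: D' \subset SD & #|SD| <= kk],
      [/\ (forall x, x \in A' -> ~~ sS x /\ ~~ sY x), (forall x, x \in B' -> sS x /\ ~~ sY x),
          (forall x, x \in C' -> sS x /\ sY x) & (forall x, x \in D' -> ~~ sS x /\ sY x)],
      [/\ (forall v, sS v -> L <= #|[set y in C' :|: D' | g v y]|),
          (forall v, ~~ sS v -> L <= #|[set y in A' :|: B' | g v y]|),
          (forall v, sY v -> L <= #|[set y in B' :|: C' | g y v]|) &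
          (forall v, ~~ sY v -> L <= #|[set y in A' :|: D' | g y v]|)] &
      [/\ absorbing g A' B' C' D' sS sY P ps R, final P \in B', size ps <= ex + 3 * kk &
          #|A' :|: B' :|: C' :|: D'| <= #|R| + 2 * kk + 1]].
Proof.
pose X := A :|: D :|: [set v in ~: Typ | h <= #|[set y in A :|: B | g v y]|].
pose Y := C :|: D :|: [set v in ~: Typ | h <= #|[set y in B :|: C | g y v]|].
have notTyp v : v \in Typ -> v \in ~: Typ = false by move=> vT; rewrite inE vT.
have Atyp v : v \in A -> v \in Typ by move=> vA; rewrite !inE vA.
have Btyp v : v \in B -> v \in Typ by move=> vB; rewrite !inE vB !orbT.
have Ctyp v : v \in C -> v \in Typ by move=> vC; rewrite !inE vC !orbT.
have Dtyp v : v \in D -> v \in Typ by move=> vD; rewrite !inE vD !orbT.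
have dis' (U V : {set T}) x : [disjoint U & V] -> x \in V -> x \in U = false.
  by rewrite disjoint_sym; exact: dis.
have sA v : v \in A -> v \in X /\ v \notin Y.
  move=> vA; split; first by rewrite !inE vA.
  by rewrite /Y !in_setU [v \in [set _ in _ | _]]inE (notTyp v (Atyp v vA)) (dis dAC vA) (dis dAD vA).
have sB v : v \in B -> v \notin X /\ v \notin Y.
  move=> vB; rewrite /X /Y !in_setU ![v \in [set _ in _ | _]]inE (notTyp v (Btyp v vB)).
  by rewrite (dis dBC vB) (dis dBD vB) (dis' _ _ _ dAB vB).
have sC v : v \in C -> v \notin X /\ v \in Y.
  move=> vC; split; last by rewrite !inE vC.
  by rewrite /X !in_setU [v \in [set _ in _ | _]]inE (notTyp v (Ctyp v vC)) (dis dCD vC)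
    (dis' _ _ _ dAC vC).
have sD v : v \in D -> v \in X /\ v \in Y by move=> vD; rewrite !inE vD !orbT.
have cases v : [|| v \in A, v \in B, v \in C, v \in D | v \in ~: Typ].
  by rewrite !inE; case: (v \in A); case: (v \in B); case: (v \in C); case: (v \in D).
have n50 : 50 <= n by clear - n_large; lia.
(* The outdegree is at least (n - 1)/8, more than 2h + ex, so an atypical vertex refused by [X] has
   enough arcs on the other side. *)
have outE v : h <= #|[set y in A :|: B | g v y]| \/ h <= #|[set y in C :|: D | g v y]|.
  have := outdeg_lower v og ore n50; rewrite /outdeg => od.
  have : #|[set y | g v y]| <= #|[set y in A :|: B | g v y]| +
      #|[set y in C :|: D | g v y]| + ex.
    apply: leq_trans (leq_add (leq_trans (leq_addr _ _) (eq_leq (cardsUI _ _))) (leqnn _)).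
    apply: leq_trans (leq_trans (leq_addr _ _) (eq_leq (cardsUI _ _))).
    apply/subset_leq_card/subsetP => y; rewrite !inE => ->; rewrite !andbT.
    by case: (y \in A); case: (y \in B); case: (y \in C); case: (y \in D).
  by clear - od h_small n_large; lia.
have inE' v : h <= #|[set y in B :|: C | g y v]| \/ h <= #|[set y in A :|: D | g y v]|.
  have := indeg_lower v og ore n50; rewrite /indeg => od.
  have : #|[set y | g y v]| <= #|[set y in B :|: C | g y v]| +
      #|[set y in A :|: D | g y v]| + ex.
    apply: leq_trans (leq_add (leq_trans (leq_addr _ _) (eq_leq (cardsUI _ _))) (leqnn _)).
    apply: leq_trans (leq_trans (leq_addr _ _) (eq_leq (cardsUI _ _))).
    apply/subset_leq_card/subsetP => y; rewrite !inE => ->; rewrite !andbT.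
    by case: (y \in A); case: (y \in B); case: (y \in C); case: (y \in D).
  by clear - od h_small n_large; lia.
have large (U V : {set T}) (p : pred T) : U \subset V -> #|[set y in U | ~~ p y]| <= t ->
    L0 + t <= #|U| -> L0 <= #|[set y in V | p y]|.
  move=> UV cU LU; apply: (@leq_trans #|[set y in U | p y]|).
    have e : #|U| = #|[set y in U | p y]| + #|[set y in U | ~~ p y]|.
      rewrite -(cardsID [set y | p y] U); congr (_ + _); apply: eq_card => y;
        by rewrite !inE // andbC.
    by clear - e cU LU; lia.
  by apply/subset_leq_card/subsetP => y; rewrite !inE => /andP[/(subsetP UV)-> ->].
have acc : accepting g A B C D L0 X Y.
  have subl (U V : {set T}) : U \subset U :|: V by apply: subsetUl.
  have subr (U V : {set T}) : V \subset U :|: V by apply: subsetUr.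
  move=> v; split=> vX.
  - move: vX; rewrite /X !in_setU => /orP[/orP[vA|vD]|].
    + exact: (large B _ _ (subr _ _) (nAB.1 _ vA) LB).
    + case: LA => [LA'|[_ nDB]]; first exact: (large A _ _ (subl _ _) (nDA.1 _ vD) LA').
      exact: (large B _ _ (subr _ _) (nDB.1 _ vD) LB).
    + by rewrite inE => /andP[_]; apply: leq_trans L0h.
  - have /or4P[vA|vB|vC|/orP[vD|vE]] := cases v.
    + by have [vX' _] := sA v vA; rewrite vX' in vX.
    + exact: (large C _ _ (subl _ _) (nBC.1 _ vB) LC).
    + exact: (large D _ _ (subr _ _) (nCD.1 _ vC) LD).
    + by have [vX' _] := sD v vD; rewrite vX' in vX.
    + apply: leq_trans L0h _; case: (outE v) => // hv; case/negP: vX.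
      by rewrite /X in_setU [v \in [set _ in _ | _]]inE vE hv orbT.
  - move: vX; rewrite /Y !in_setU => /orP[/orP[vC|vD]|].
    + exact: (large B _ _ (subl _ _) (nBC.2 _ vC) LB).
    + exact: (large C _ _ (subr _ _) (nCD.2 _ vD) LC).
    + by rewrite inE => /andP[_]; apply: leq_trans L0h.
  - have /or4P[vA|vB|vC|/orP[vD|vE]] := cases v.
    + exact: (large D _ _ (subr _ _) (nDA.2 _ vA) LD).
    + case: LA => [LA'|[_ nDB]]; first exact: (large A _ _ (subl _ _) (nAB.2 _ vB) LA').
      exact: (large D _ _ (subr _ _) (nDB.2 _ vB) LD).
    + by have [_ vX'] := sC v vC; rewrite vX' in vX.
    + by have [_ vX'] := sD v vD; rewrite vX' in vX.
    + apply: leq_trans L0h _; case: (inE' v) => // hv; case/negP: vX.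
      by rewrite /Y in_setU [v \in [set _ in _ | _]]inE vE hv orbT.
have cTyp : n = #|A| + #|B| + #|C| + #|D| + ex.
  rewrite -(cardsC Typ); congr (_ + _).
  have cu (U V : {set T}) : [disjoint U & V] -> #|U :|: V| = #|U| + #|V|.
    by move=> d; rewrite -cardsUI (eqP (etrans (setI_eq0 _ _) d)) cards0 addn0.
  have dU (U V W : {set T}) : [disjoint U & W] -> [disjoint V & W] -> [disjoint U :|: V & W].
    by move=> d1 d2; rewrite -!setI_eq0 in d1 d2 *; rewrite setIUl (eqP d1) (eqP d2) setU0.
  by rewrite cu ?cu ?cu ?dU //; rewrite dU.
pose EX := [set v in ~: Typ | h <= #|[set y in A :|: B | g v y]|].
pose EY := [set v in ~: Typ | h <= #|[set y in B :|: C | g y v]|].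
have cEX : #|EX| <= ex by apply/subset_leq_card/subsetP => v; rewrite inE => /andP[].
have cEY : #|EY| <= ex by apply/subset_leq_card/subsetP => v; rewrite inE => /andP[].
have cu (U V : {set T}) : [disjoint U & V] -> #|U :|: V| = #|U| + #|V|.
  by move=> d; rewrite -cardsUI (eqP (etrans (setI_eq0 _ _) d)) cards0 addn0.
have cXU : #|A| + #|D| <= #|X| by rewrite -(cu _ _ dAD) subset_leq_card ?subsetUl.
have cYU : #|C| + #|D| <= #|Y| by rewrite -(cu _ _ dCD) subset_leq_card ?subsetUl.
have cXL : #|X| <= #|A| + #|D| + #|EX|.
  by rewrite -(cu _ _ dAD) -[X]/((A :|: D) :|: EX) cardsU leq_subr.
have cYL : #|Y| <= #|C| + #|D| + #|EY|.
  by rewrite -(cu _ _ dCD) -[Y]/((C :|: D) :|: EY) cardsU leq_subr.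
have XU : X \subset (A :|: D) :|: ~: Typ.
  by apply: setUS; apply/subsetP => v; rewrite inE => /andP[].
have YU : Y \subset (C :|: D) :|: ~: Typ.
  by apply: setUS; apply/subsetP => v; rewrite inE => /andP[].
have XU' : ~: X \subset (B :|: C) :|: ~: Typ.
  apply/subsetP => v; rewrite inE => vX; have /or4P[vA|vB|vC|/orP[vD|vE]] := cases v.
  - by have [vX' _] := sA v vA; rewrite vX' in vX.
  - by rewrite !in_setU vB.
  - by rewrite !in_setU vC orbT.
  - by have [vX' _] := sD v vD; rewrite vX' in vX.
  - by rewrite in_setU vE orbT.
have YU' : ~: Y \subset (A :|: B) :|: ~: Typ.
  apply/subsetP => v; rewrite inE => vY; have /or4P[vA|vB|vC|/orP[vD|vE]] := cases v.
  - by rewrite !in_setU vA.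
  - by rewrite !in_setU vB orbT.
  - by have [_ vY'] := sC v vC; rewrite vY' in vY.
  - by have [_ vY'] := sD v vD; rewrite vY' in vY.
  - by rewrite in_setU vE orbT.
have coreD : D \subset X :&: Y by apply/subsetP => v /sD[vX vY]; rewrite inE vX.
have coreD' : X :&: Y \subset D :|: ~: Typ.
  apply/subsetP => v; rewrite inE => /andP[vX vY].
  have /or4P[vA|vB|vC|/orP[vD|vE]] := cases v.
  - by have [_] := sA v vA; rewrite vY.
  - by have [_] := sB v vB; rewrite vY.
  - by have [] := sC v vC; rewrite vX.
  - by rewrite in_setU vD.
  - by rewrite in_setU vE orbT.
have coreB : B \subset ~: X :&: ~: Y.
  by apply/subsetP => v /sB[vX vY]; rewrite in_setI !in_setC vX vY.
have coreB' : ~: X :&: ~: Y \subset B :|: ~: Typ.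
  apply/subsetP => v; rewrite in_setI !in_setC => /andP[vX vY].
  have /or4P[vA|vB|vC|/orP[vD|vE]] := cases v.
  - by have [vX' _] := sA v vA; rewrite vX' in vX.
  - by rewrite in_setU vB.
  - by have [_ vY'] := sC v vC; rewrite vY' in vY.
  - by have [vX' _] := sD v vD; rewrite vX' in vX.
  - by rewrite in_setU vE orbT.
(* |X| + |Y| - n is |D| - |B| - ex plus the number of atypical vertices in [X] and in [Y], which
   lies between 0 and 2ex. *)
have df1 : #|X| + #|Y| <= n + kk by clear - cXL cYL cEX cEY cTyp diff1; lia.
have df2 : n <= #|X| + #|Y| + kk by clear - cXU cYU cTyp diff2; lia.
have [XF [YF [M [rk [accF cSD [mM cM] aM bal]]]]] := choose_states og ore XU YU XU' YU'
  coreD coreD' coreB coreB' h_small n_large kk_small D_large D_small B_large B_small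
  df1 df2 L0h acc.
have B4 : 4 * kk + ex < #|B| by clear - h_small n_large kk_small B_large; lia.
have [P [ps [R [aP fP sps cR]]]] := start_absorbing cSD mM cM aM bal sA sB sC sD B4.
set A' := [set x in A | _] in aP fP cR; set B' := [set x in B | _] in aP fP cR.
set C' := [set x in C | _] in aP fP cR; set D' := [set x in D | _] in aP fP cR.
pose SD := symdiff X XF :|: symdiff Y YF.
have cSD' : #|SD| <= kk.
  apply: leq_trans cSD; rewrite -cardsUI; exact: leq_addr.
have lA : A :\: A' \subset SD.
  apply/subsetP => v; rewrite !in_setD inE => /andP[+ vA]; have [vX vY] := sA v vA.
  rewrite /SD /symdiff !in_setU !in_setD vA vX (negbTE vY).
  by case: (v \in XF); case: (v \in YF).
have lB : B :\: B' \subset SD.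
  apply/subsetP => v; rewrite !in_setD inE => /andP[+ vB]; have [vX vY] := sB v vB.
  rewrite /SD /symdiff !in_setU !in_setD vB (negbTE vX) (negbTE vY).
  by case: (v \in XF); case: (v \in YF).
have lC : C :\: C' \subset SD.
  apply/subsetP => v; rewrite !in_setD inE => /andP[+ vC]; have [vX vY] := sC v vC.
  rewrite /SD /symdiff !in_setU !in_setD vC (negbTE vX) vY.
  by case: (v \in XF); case: (v \in YF).
have lD : D :\: D' \subset SD.
  apply/subsetP => v; rewrite !in_setD inE => /andP[+ vD]; have [vX vY] := sD v vD.
  rewrite /SD /symdiff !in_setU !in_setD vD vX vY.
  by case: (v \in XF); case: (v \in YF).
have shr (U V U' V' : {set T}) (p : pred T) : U :\: U' \subset SD -> V :\: V' \subset SD ->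
    L0 <= #|[set y in U :|: V | p y]| -> L <= #|[set y in U' :|: V' | p y]|.
  move=> lU lV le; have lUV : (U :|: V) :\: (U' :|: V') \subset SD.
    apply/subsetP => v; rewrite !inE negb_or => /andP[/andP[vU' vV'] /orP[vU|vV]].
      by move: (subsetP lU v); rewrite !inE vU' vU => /(_ isT).
    by move: (subsetP lV v); rewrite !inE vV' vV => /(_ isT).
  by have := card_shrink p lUV cSD'; clear - le LL0; lia.
exists A', B', C', D', (fun x => x \notin XF), (fun x => x \in YF), P, ps, R, SD; split.
- by split; apply/subsetP => v; rewrite inE => /andP[].
- by split.
- split=> v; rewrite inE => /and3P[_ vX vY] //; first by rewrite vX vY.
  by rewrite vX vY.
- split=> v hv; have [h1 h2 h3 h4] := accF v.
  + exact: shr lC lD (h2 hv).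
  + by apply: shr lA lB (h1 _); rewrite -[_ \in _]negbK.
  + exact: shr lB lC (h3 hv).
  + exact: shr lA lD (h4 hv).
- by split.
Qed.

(** The start costs 2kk + 1 vertices and each of the at most ex + 3kk paths costs 15 more: together
    47kk + 15ex + 1. *)
Lemma typical_absorbed : exists (A' B' C' D' : {set T}) (sS sY : pred T) P R (SD : {set T}),
  [/\ [/\ A' \subset A, B' \subset B, C' \subset C & D' \subset D],
      [/\ A :\: A' \subset SD, B :\: B' \subset SD, C :\: C' \subset SD,
          D :\: D' \subset SD & #|SD| <= kk],
      [/\ (forall x, x \in A' -> ~~ sS x /\ ~~ sY x), (forall x, x \in B' -> sS x /\ ~~ sY x),
          (forall x, x \in C' -> sS x /\ sY x) & (forall x, x \in D' -> ~~ sS x /\ sY x)],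
      L <= #|C'| &
      [/\ absorbing g A' B' C' D' sS sY P [::] R, final P \in B' &
          #|A' :|: B' :|: C' :|: D'| <= #|R| + (47 * kk + 15 * ex + 1)]].
Proof.
have [A' [B' [C' [D' [sS [sY [P [ps [R [SD [subs [lA lB lC lD cSD] [st1 st2 st3 st4]
  [a1 a2 a3 a4] [aP fP sps cR]]]]]]]]]]]] := typical_start.
have [sA sB sC sD] := subs.
have size_class (Z Z' : {set T}) : Z :\: Z' \subset SD -> L0 + t <= #|Z| -> L <= #|Z'|.
  move=> lZ LZ; have := subset_leq_card lZ; rewrite cardsD.
  have := subset_leq_card (subsetIr Z Z').
  by clear - LL0 LZ cSD; lia.
have sub_near (U V U' V' : {set T}) : U' \subset U -> V' \subset V ->
    near_complete g U V t -> near_complete g U' V' t.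
  move=> sU sV [n1 n2]; split=> x xU.
    by apply: subset_filter_card sV (n1 _ (subsetP sU _ xU)).
  by apply: subset_filter_card sU (n2 _ (subsetP sV _ xU)).
have LA' : L <= #|A'| \/ A' = set0 /\ near_complete g D' B' t.
  case: LA => [/(size_class _ _ lA)|[A0 nDB]]; first by left.
  right; split; last exact: sub_near nDB.
  by apply/eqP; rewrite -subset0 -A0.
have rm : room A' B' C' D' t L (15 * size ps + 15) R.
  by rewrite /room; clear - L_large sps cR; lia.
have LB' := size_class _ _ lB LB; have LC' := size_class _ _ lC LC.
have LD' := size_class _ _ lD LD.
have [P1 [R1 [aP1 fP1 cR1]]] := absorb_all st1 st2 st3 st4 (sub_near _ _ _ _ sA sB nAB)
  (sub_near _ _ _ _ sB sC nBC) (sub_near _ _ _ _ sC sD nCD) (sub_near _ _ _ _ sD sA nDA)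
  LB' LC' LD' LA' a1 a2 a3 a4 aP fP rm.
exists A', B', C', D', sS, sY, P1, R1, SD; split; [by split|by split|by split|exact: LC'|].
by split=> //; clear - cR cR1 sps; lia.
Qed.

Section Losses.
Variables (A' B' C' D' SD R : {set T}) (U : nat).
Hypotheses (cSD : #|SD| <= kk) (RT : R \subset A' :|: B' :|: C' :|: D').
Hypothesis cR : #|A' :|: B' :|: C' :|: D'| <= #|R| + U.

Lemma card_lost : #|SD :|: ((A' :|: B' :|: C' :|: D') :\: R)| <= kk + U.
Proof.
have h1 := cardsUI SD ((A' :|: B' :|: C' :|: D') :\: R).
have h2 := cardsD (A' :|: B' :|: C' :|: D') R; rewrite (setIidPr RT) in h2.
by clear - h1 h2 cSD cR; lia.
Qed.

Lemma class_lost (Z Z' : {set T}) : Z :\: Z' \subset SD -> Z' \subset A' :|: B' :|: C' :|: D' ->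
  Z :\: (Z' :&: R) \subset SD :|: ((A' :|: B' :|: C' :|: D') :\: R).
Proof.
move=> lZ ZT; apply/subsetP => x; rewrite in_setD in_setI negb_and => /andP[+ xZ].
rewrite in_setU in_setD; case: (boolP (x \in Z')) => [/(subsetP ZT)->|xZ' _].
  by rewrite orFb => ->; rewrite orbT.
by rewrite (subsetP lZ) // in_setD xZ'.
Qed.

Lemma class_lost_card (Z Z' : {set T}) : Z :\: Z' \subset SD ->
  Z' \subset A' :|: B' :|: C' :|: D' -> #|Z| <= #|Z' :&: R| + (kk + U).
Proof.
move=> lZ ZT; have lost := leq_trans (subset_leq_card (class_lost lZ ZT)) card_lost.
have := cardsID (Z' :&: R) Z; have := subset_leq_card (subsetIr Z (Z' :&: R)).
by clear - lost; lia.
Qed.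

(** Both losses are disjoint parts of one set of at most kk + U vertices, so the bound does not
    double. *)
Lemma two_classes_lost (Z1 Z1' Z2 Z2' : {set T}) : [disjoint Z1 & Z2] ->
  Z1 :\: Z1' \subset SD -> Z2 :\: Z2' \subset SD ->
  Z1' \subset A' :|: B' :|: C' :|: D' -> Z2' \subset A' :|: B' :|: C' :|: D' ->
  #|Z1 :\: (Z1' :&: R)| + #|Z2 :\: (Z2' :&: R)| <= kk + U.
Proof.
move=> d12 l1 l2 s1 s2; rewrite -cardsUI.
rewrite [X in _ + #|pred_of_set X|](_ : _ = set0) ?cards0 ?addn0; last first.
  apply/setP => x; rewrite in_setI !in_setD !inE.
  by case: (boolP (x \in Z1)) => [/(dis d12)->|]; rewrite ?andbF.
apply: leq_trans card_lost; apply: subset_leq_card.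
by rewrite subUset !class_lost.
Qed.

End Losses.

Lemma subset_classes (A' B' C' D' : {set T}) :
  [/\ A' \subset A' :|: B' :|: C' :|: D', B' \subset A' :|: B' :|: C' :|: D',
      C' \subset A' :|: B' :|: C' :|: D' & D' \subset A' :|: B' :|: C' :|: D'].
Proof.
by split; apply/subsetP => x xX; rewrite !inE xX ?orbT.
Qed.

(** [w] bounds the loss of a class: 47kk + 15ex + 1 vertices used in the absorption and kk vertices
    of changed type. *)
Theorem hamilton_without_A w : A = set0 -> near_complete g D B t -> near_tournament g C t ->
  w = 48 * kk + 15 * ex + 1 -> #|D| + w <= #|C| -> #|C| + 6 * t + 9 + 3 * w <= 3 * #|D| ->
  5 * t + 5 + w <= #|D| -> has_hamilton_cycle g.
Proof.
move=> A0 nDB tC ew h1 h2 h3.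
have [A' [B' [C' [D' [sS [sY [P [R [SD [[sA sB sC sD] [lA lB lC lD cSD] [st1 st2 st3 st4]
  _ [aP fP cR]]]]]]]]]]] := typical_absorbed.
have RT := absorbing_sub aP; have [tA' tB' tC' tD'] := subset_classes A' B' C' D'.
have eB := absorbing_balance st1 st2 st3 st4 aP fP.
have cC := class_lost_card cSD RT cR lC tC'; have cD := class_lost_card cSD RT cR lD tD'.
have [pe _ /andP[dP _] fP' _] := aP.
have uC : #|C' :&: R| <= #|C| by apply/subset_leq_card/(subset_trans (subsetIl _ _)).
have uD : #|D' :&: R| <= #|D| by apply/subset_leq_card/(subset_trans (subsetIl _ _)).
have subR (Z Z' : {set T}) : Z' \subset Z -> Z' :&: R \subset Z.
  by move=> s; apply: subset_trans (subsetIl _ _) s.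
apply: (@finish_direct T g B C D t #|D' :&: R| P (B' :&: R) (C' :&: R) (D' :&: R) og.1
  nBC nCD nDB tC (subR _ _ sB) (subR _ _ sC) (subR _ _ sD) dP) => //.
- exact: (subsetP sB).
- exact: (subsetP sB).
- apply: perm_trans pe; apply/permP => p.
  have /permP/(_ p) := enum_classes st1 st2 st3 st4 RT.
  have -> : A' = set0 by apply/eqP; rewrite -subset0 -A0.
  by rewrite set0I enum_set0 !count_cat /=; clear; lia.
- by clear - cD ew h3; lia.
- by clear - cC uD ew h1; lia.
- by clear - cD uC ew h2; lia.
Qed.

(** Here [w] also contains the 3J vertices of J extra rounds. The two product conditions survive the
    losses: at most |D| + w - |A| rounds have to skip [A], likewise for [C], and at most wn arcs
    between [D] and [B] disappear. *)
Theorem hamilton_with_A w J : near_tournament g A t -> near_tournament g C t ->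
  w = 48 * kk + 15 * ex + 1 + 3 * J ->
  2 * #|D| + 2 * w <= #|A| + #|C| + 7 * J -> w + 2 * t + 10 < L ->
  w * n < arcs g D B ->
  (#|D| + w - #|A|) * #|D| + w * n <= arcs g D B ->
  (#|D| + w - #|C|) * #|D| + w * n <= arcs g B D ->
  3 * t + 1 + w <= #|A| -> 3 * t + 1 + w <= #|C| -> 5 * t + 5 + w <= #|D| ->
  #|A| + 6 * t + 9 + 3 * w <= 3 * #|D| -> #|C| + 6 * t + 9 + 3 * w <= 3 * #|D| ->
  has_hamilton_cycle g.
Proof.
move=> tA tC ew hJ hL dense hDB hBD hA hC hD hA3 hC3.
have [A' [B' [C' [D' [sS [sY [P [R [SD [[sA sB sC sD] [lA lB lC lD cSD] [st1 st2 st3 st4]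
  LC' [aP fP cR]]]]]]]]]]] := typical_absorbed.
have RT := absorbing_sub aP; have [tA' tB' tC' tD'] := subset_classes A' B' C' D'.
set U := 47 * kk + 15 * ex + 1 + 3 * J.
have wU : w = kk + U by clear - ew; rewrite /U; lia.
have shrink (R' : {set T}) : R' \subset A' :|: B' :|: C' :|: D' ->
    #|A' :|: B' :|: C' :|: D'| <= #|R'| + U ->
    arcs g D B <= arcs g (D' :&: R') (B' :&: R') + w * n /\
    arcs g B D <= arcs g (B' :&: R') (D' :&: R') + w * n.
  move=> RT' cR'; have subR (Z Z' : {set T}) : Z' \subset Z -> Z' :&: R' \subset Z.
    by move=> s; apply: subset_trans (subsetIl _ _) s.
  rewrite wU; split; apply: arcs_shrink; rewrite ?subR //.
    by apply: (two_classes_lost cSD RT' cR'); rewrite // disjoint_sym.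
  exact: (two_classes_lost cSD RT' cR').
have sub_near (V W V' W' : {set T}) : V' \subset V -> W' \subset W ->
    near_complete g V W t -> near_complete g V' W' t.
  move=> sV sW [n1 n2]; split=> x xV.
    by apply: subset_filter_card sW (n1 _ (subsetP sV _ xV)).
  by apply: subset_filter_card sV (n2 _ (subsetP sW _ xV)).
have [P1 [R1 [aP1 fP1 cR1 alt]]] : exists P1 R1, [/\ absorbing g A' B' C' D' sS sY P1 [::] R1,
    final P1 \in B', #|A' :|: B' :|: C' :|: D'| <= #|R1| + U &
    (#|D' :&: R1| <= #|A' :&: R1|) || (#|D' :&: R1| <= #|C' :&: R1|)].
  case: (boolP ((#|D' :&: R| <= #|A' :&: R|) || (#|D' :&: R| <= #|C' :&: R|))) => [ok|].
    by exists P, R; split=> //; rewrite /U; clear - cR; lia.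
  rewrite negb_or -!ltnNge => /andP[ltA ltC].
  have cA := class_lost_card cSD RT cR lA tA'; have cC := class_lost_card cSD RT cR lC tC'.
  have uD : #|D' :&: R| <= #|D| by apply/subset_leq_card/(subset_trans (subsetIl _ _)).
  have [||||P1 [R1 [a1 f1 c1 al]]] := @balance_rounds T g A' B' C' D' sS sY t L st1 st2 st3 st4
    (sub_near _ _ _ _ sB sC nBC) (sub_near _ _ _ _ sC sD nCD) LC' U J P R _ aP fP.
  - move=> R' RT' cR'; have [hs _] := shrink R' RT' cR'.
    have : 0 < arcs g (D' :&: R') (B' :&: R') by clear - hs dense; lia.
    rewrite /arcs card_gt0 => /set0Pn[[d b]]; rewrite !inE /= => /andP[/andP[]].
    by move=> /andP[dD dR] /andP[bB bR] gdb; exists d, b.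
  - by rewrite /U; clear - cR; lia.
  - by clear - hL wU; lia.
  (* J rounds suffice. Before them a class has lost at most w - 3J vertices, so by [hJ] at least
     2|D| - J vertices of A and C are left together, fewer than |D| of them in C. *)
  - by clear - cA cC uD ltA ltC hJ ew; lia.
  by exists P1, R1; split=> //; rewrite /U; clear - cR c1; lia.
have RT1 := absorbing_sub aP1.
have eB := absorbing_balance st1 st2 st3 st4 aP1 fP1.
have cA := class_lost_card cSD RT1 cR1 lA tA'; have cC := class_lost_card cSD RT1 cR1 lC tC'.
have cD := class_lost_card cSD RT1 cR1 lD tD'.
have [pe _ /andP[dP _] fP' _] := aP1; have [sDB sBD] := shrink R1 RT1 cR1.
rewrite -wU in cA cC cD.
have uC : #|C' :&: R1| <= #|C| by apply/subset_leq_card/(subset_trans (subsetIl _ _)).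
have uD : #|D' :&: R1| <= #|D| by apply/subset_leq_card/(subset_trans (subsetIl _ _)).
have uA : #|A' :&: R1| <= #|A| by apply/subset_leq_card/(subset_trans (subsetIl _ _)).
have subR (Z Z' : {set T}) : Z' \subset Z -> Z' :&: R1 \subset Z.
  by move=> s; apply: subset_trans (subsetIl _ _) s.
apply: (@finish_balanced T g A B C D t #|D' :&: R1| P1 (A' :&: R1) (B' :&: R1) (C' :&: R1)
  (D' :&: R1) og.1 nAB nBC nCD nDA tA tC (subR _ _ sA) (subR _ _ sB) (subR _ _ sC)
  (subR _ _ sD) dP) => //.
- exact: (subsetP sB).
- exact: (subsetP sB).
- apply: perm_trans pe; apply/permP => p.
  have /permP/(_ p) := enum_classes st1 st2 st3 st4 RT1.
  by rewrite !count_cat /=; clear; lia.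
- by clear - cD hD; lia.
- by clear - cA hA; lia.
- by clear - cC hC; lia.
- by clear - cD uA hA3; lia.
- by clear - cD uC hC3; lia.
- move=> _; rewrite -(leq_add2r (w * n)); apply: leq_trans sDB; apply: leq_trans hDB.
  by rewrite leq_add2r; apply: leq_mul; [clear - uD cA; lia|exact: uD].
- move=> _; rewrite -(leq_add2r (w * n)); apply: leq_trans sBD; apply: leq_trans hBD.
  by rewrite leq_add2r; apply: leq_mul; [clear - uD cC; lia|exact: uD].
Qed.

End Typical.

(** * Typical vertices *)

(** Markov's inequality, with t + 1 because exceeding t means at least t + 1. *)
Lemma markov_card (T : finType) (U : {set T}) (f : T -> nat) t w :
  \sum_(u in U) f u <= w -> #|[set u in U | t < f u]| * t.+1 <= w.
Proof.
apply: leq_trans; rewrite -sum_nat_const (eq_bigl (fun u => (u \in U) && (t < f u))); last first.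
  by move=> u; rewrite inE.
rewrite big_mkcondr; apply: leq_sum => u _; by case: ifP.
Qed.

Definition bad_out (T : finType) (g : rel T) (U V : {set T}) t :=
  [set u in U | t < #|[set v in V | ~~ g u v]|].

Definition bad_tournament (T : finType) (g : rel T) (U : {set T}) t :=
  [set u in U | t < #|[set v in U | ~~ (g u v || g v u)]|].

Section BadSets.
Variables (T : finType) (g : rel T).
Implicit Types (U V Z : {set T}).

Lemma bad_out_card U V t w : #|U| * #|V| <= arcs g U V + w -> #|bad_out g U V t| * t.+1 <= w.
Proof.
move=> h; apply: markov_card.
have : \sum_(u in U) #|[set v in V | ~~ g u v]| + arcs g U V = #|U| * #|V|.
  rewrite arcsE -big_split -sum_nat_const; apply: eq_bigr => u _ /=.
  rewrite addnC -(cardsID [set v | g u v] V); congr (_ + _);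
    by apply: eq_card => v; rewrite !inE // andbC.
by clear - h; lia.
Qed.

Lemma bad_in_card U V t w : #|U| * #|V| <= arcs g U V + w ->
  #|bad_out (converse g) V U t| * t.+1 <= w.
Proof.
move=> h; apply: (leq_trans _ (leqnn w)); rewrite /bad_out.
apply: markov_card.
have : \sum_(v in V) #|[set u in U | ~~ converse g v u]| + arcs g U V = #|U| * #|V|.
  rewrite arcsEr -big_split mulnC -sum_nat_const; apply: eq_bigr => u _ /=.
  rewrite addnC -(cardsID [set v | g v u] U); congr (_ + _);
    by apply: eq_card => v; rewrite !inE // andbC.
by clear - h; lia.
Qed.

Lemma bad_tournament_card U t w : oriented_graph g ->
  #|U| * #|U| <= 2 * arcs g U U + w -> #|bad_tournament g U t| * t.+1 <= w.
Proof.
move=> og h; apply: markov_card.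
have : \sum_(u in U) #|[set v in U | ~~ (g u v || g v u)]| + 2 * arcs g U U = #|U| * #|U|.
  rewrite mul2n -addnn {1}arcsE arcsEr -!big_split -sum_nat_const; apply: eq_bigr => u _ /=.
  rewrite -(cardsID [set v | g u v || g v u] U) addnC; congr (_ + _).
    rewrite -cardsUI -[RHS]addn0; congr (_ + _).
      by apply: eq_card => v; rewrite !inE -andb_orr.
    apply: eq_card0 => v; rewrite !inE; apply/negP => /andP[/andP[_ g1] /andP[_ g2]].
    by have := og.2 u v; rewrite g1 g2.
  by apply: eq_card => v; rewrite !inE andbC.
by clear - h; lia.
Qed.

Lemma near_complete_off_bad U V Z t : bad_out g U V t \subset Z ->
  bad_out (converse g) V U t \subset Z -> near_complete g (U :\: Z) (V :\: Z) t.
Proof.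
move=> b1 b2; split=> x; rewrite inE => /andP[xZ xU].
  apply: subset_filter_card (subsetDl V Z) _; rewrite leqNgt; apply: contra xZ => lt.
  by apply: (subsetP b1); rewrite inE xU.
apply: subset_filter_card (subsetDl U Z) _; rewrite leqNgt; apply: contra xZ => lt.
by apply: (subsetP b2); rewrite inE xU.
Qed.

Lemma near_tournament_off_bad U Z t : bad_tournament g U t \subset Z ->
  near_tournament g (U :\: Z) t.
Proof.
move=> b1 x; rewrite inE => /andP[xZ xU].
apply: subset_filter_card (subsetDl U Z) _; rewrite leqNgt; apply: contra xZ => lt.
by apply: (subsetP b1); rewrite inE xU.
Qed.

End BadSets.

(** The integer [q] is to satisfy both q >= K eta n and q^2 >= K eta n^2, so that it measures the
    errors in sizes and, squared, those in arc numbers. *)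
Definition nat_extremal (T : finType) (g : rel T) (A B C D : {set T}) q :=
  [/\ [/\ [disjoint A & B], [disjoint A & C] & [disjoint A & D]],
      [/\ [disjoint B & C], [disjoint B & D] & [disjoint C & D]],
      [/\ #|T| <= 2 * (#|A| + #|C|) + 2 * q, 2 * (#|A| + #|C|) <= #|T| + 2 * q,
          #|T| <= 4 * #|B| + 4 * q, 4 * #|B| <= #|T| + 4 * q &
          #|T| <= 4 * #|D| + 4 * q /\ 4 * #|D| <= #|T| + 4 * q],
      [/\ #|A| * #|B| <= arcs g A B + q * q, #|B| * #|C| <= arcs g B C + q * q,
          #|C| * #|D| <= arcs g C D + q * q & #|D| * #|A| <= arcs g D A + q * q] &
      [/\ #|A| * #|T| <= 8 * arcs g B D + 8 * (q * q),
          #|C| * #|T| <= 8 * arcs g D B + 8 * (q * q),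
          #|A| * #|A| <= 2 * arcs g A A + 2 * (q * q) &
          #|C| * #|C| <= 2 * arcs g C C + 2 * (q * q)]].

Lemma nat_extremal_converse (T : finType) (g : rel T) (A B C D : {set T}) q :
  nat_extremal g A B C D q -> nat_extremal (converse g) C B A D q.
Proof.
move=> [[dAB dAC dAD] [dBC dBD dCD] [s1 s2 s3 s4 [s5 s6]] [e1 e2 e3 e4] [f1 f2 f3 f4]].
split; rewrite ?(arcs_converse g).
- by split=> //; rewrite disjoint_sym.
- by split=> //; rewrite disjoint_sym.
- by split=> //; rewrite [#|C| + _]addnC.
- by split; rewrite mulnC.
- by split.
Qed.

(* [DB] is about [c * n / 8], [d1] about [n / 4] and [c] about [n / 2 - a]; the
   slack [a * n / 8] absorbs the errors, which are multiples of [q * n]. *)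
Lemma arcs_enough (n q w a a1 c d1 DB DB1 : nat) :
  0 < q -> 100 * (1000 * (1000 * q)) <= n -> w <= 21 * (1000 * q) ->
  400 * (1000 * q) <= a -> a <= a1 + 20 * q -> n <= 2 * (a + c) + 2 * q ->
  400 * (1000 * q) <= c -> 4 * d1 <= n + 4 * q ->
  c * n <= 8 * DB + 8 * (q * q) -> DB <= DB1 + 40 * q * n ->
  (d1 + w - a1) * d1 + w * n <= DB1.
Proof.
move=> q0 nq hw ha ha1 hac hc hd hDB hDB1.
have qn : 100 * (1000 * (1000 * (q * q))) <= q * n.
  by have := leq_mul (leqnn q) nq; clear; lia.
have wn : w * n <= 21 * (1000 * (q * n)) by have := leq_mul hw (leqnn n); clear; lia.
have an : 400 * (1000 * (q * n)) <= a * n by have := leq_mul ha (leqnn n); clear; lia.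
have cn : 400 * (1000 * (q * n)) <= c * n by have := leq_mul hc (leqnn n); clear; lia.
have nn : n * n <= 2 * (a * n + c * n) + 2 * (q * n).
  by have := leq_mul hac (leqnn n); clear; lia.
have [le|lt] := leqP (d1 + w) a1.
  have -> : d1 + w - a1 = 0 by clear - le; lia.
  by clear - hDB hDB1 wn cn qn; lia.
have [Y eY] : exists Y, Y + 4 * a = n + 84 * q + 4 * w.
  by exists (n + 84 * q + 4 * w - 4 * a); clear - lt ha1 hd; lia.
have hX : 4 * (d1 + w - a1) <= Y by clear - lt eY ha1 hd; lia.
have h1 := leq_mul hX hd.
have h2 : Y * n + 4 * (a * n) = n * n + 84 * (q * n) + 4 * (w * n).
  by have := congr1 (fun x => x * n) eY; clear; lia.
have h3 : Y * q + 4 * (a * q) = n * q + 84 * (q * q) + 4 * (w * q).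
  by have := congr1 (fun x => x * q) eY; clear; lia.
have wq : w * q <= 21 * (1000 * (q * q)) by have := leq_mul hw (leqnn q); clear; lia.
by clear - h1 h2 h3 wq wn an qn nn hDB hDB1; lia.
Qed.

Lemma cardsDsub (T : finType) (U Z : {set T}) k : #|Z| <= k ->
  #|U| <= #|U :\: Z| + k /\ #|U :\: (U :\: Z)| <= k.
Proof.
move=> Zk; have h : #|U :&: Z| <= k by apply: leq_trans (subset_leq_card (subsetIr U Z)) Zk.
by split; [have := cardsID Z U; clear - h; lia | rewrite setDDr setDv set0U].
Qed.

Lemma card_off_classes (T : finType) (A B C D Z : {set T}) q k :
  [/\ [disjoint A & B], [disjoint A & C] & [disjoint A & D]] ->
  [/\ [disjoint B & C], [disjoint B & D] & [disjoint C & D]] ->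
  #|T| <= 2 * (#|A| + #|C|) + 2 * q -> #|T| <= 4 * #|B| + 4 * q ->
  #|T| <= 4 * #|D| + 4 * q -> #|Z| <= k ->
  #|~: (A :\: Z :|: B :\: Z :|: C :\: Z :|: D :\: Z)| <= 3 * q + k.
Proof.
move=> [dAB dAC dAD] [dBC dBD dCD] h1 h2 h3 Zk.
have cu (U V : {set T}) : [disjoint U & V] -> #|U :|: V| = #|U| + #|V|.
  by move=> d; rewrite -cardsUI (eqP (etrans (setI_eq0 _ _) d)) cards0 addn0.
have dU (U V W : {set T}) : [disjoint U & W] -> [disjoint V & W] -> [disjoint U :|: V & W].
  by move=> d1 d2; rewrite -!setI_eq0 in d1 d2 *; rewrite setIUl (eqP d1) (eqP d2) setU0.
have e : #|A :|: B :|: C :|: D| = #|A| + #|B| + #|C| + #|D|.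
  by rewrite cu ?cu ?cu ?dU //; rewrite dU.
rewrite -!setDUl; have := cardsC (A :|: B :|: C :|: D); rewrite e => e2.
have e3 : #|~: ((A :|: B :|: C :|: D) :\: Z)| <= #|~: (A :|: B :|: C :|: D)| + #|Z|.
  rewrite -cardsUI; apply: leq_trans (leq_addr _ _); apply/subset_leq_card/subsetP => x.
  by rewrite in_setU !in_setC in_setD negb_and negbK orbC.
by clear - h1 h2 h3 e2 e3 Zk; lia.
Qed.

Lemma card_leq_of_muln (x t q : nat) : q <= t -> x * t.+1 <= 2 * (q * q) -> 0 < q -> x <= 2 * q.
Proof.
move=> qt h q0; rewrite leqNgt; apply/negP => lt.
by have := leq_mul lt (_ : q <= t.+1); rewrite (leqW qt) => /(_ isT); clear - h q0; nia.
Qed.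

Section Cores.
Variables (T : finType) (g : rel T) (A B C D : {set T}) (q t : nat).
Hypotheses (og : oriented_graph g) (ext : nat_extremal g A B C D q).
Hypotheses (q0 : 0 < q) (qt : q <= t).

Definition bad_vertices : {set T} :=
  bad_out g A B t :|: bad_out (converse g) B A t :|: bad_out g B C t :|:
  bad_out (converse g) C B t :|: bad_out g C D t :|: bad_out (converse g) D C t :|:
  bad_out g D A t :|: bad_out (converse g) A D t :|: bad_tournament g A t :|:
  bad_tournament g C t.

(** Each of the ten sets belongs to a total defect of at most 2q^2, to which each of its vertices
    contributes more than t >= q; hence at most 2q vertices in each. *)
Lemma bad_vertices_card : #|bad_vertices| <= 20 * q.
Proof.
have [_ _ _ [e1 e2 e3 e4] [_ _ e5 e6]] := ext.
have s w x : w <= 2 * (q * q) -> x * t.+1 <= w -> x <= 2 * q.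
  by move=> hw hx; apply: (card_leq_of_muln qt _ q0); apply: leq_trans hw.
have q2 : q * q <= 2 * (q * q) by clear; lia.
have b1 := s _ _ q2 (bad_out_card t e1); have b2 := s _ _ q2 (bad_in_card t e1).
have b3 := s _ _ q2 (bad_out_card t e2); have b4 := s _ _ q2 (bad_in_card t e2).
have b5 := s _ _ q2 (bad_out_card t e3); have b6 := s _ _ q2 (bad_in_card t e3).
have b7 := s _ _ q2 (bad_out_card t e4); have b8 := s _ _ q2 (bad_in_card t e4).
have b9 := s _ _ (leqnn _) (bad_tournament_card t og e5).
have b10 := s _ _ (leqnn _) (bad_tournament_card t og e6).
have u (U V : {set T}) x y : #|U| <= x -> #|V| <= y -> #|U :|: V| <= x + y.
  by move=> hx hy; rewrite cardsU; apply: leq_trans (leq_subr _ _) (leq_add hx hy).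
have := u _ _ _ _ (u _ _ _ _ (u _ _ _ _ (u _ _ _ _ (u _ _ _ _ (u _ _ _ _ (u _ _ _ _
  (u _ _ _ _ (u _ _ _ _ b1 b2) b3) b4) b5) b6) b7) b8) b9) b10.
by rewrite -/bad_vertices; clear; lia.
Qed.

Lemma cores_near (Z : {set T}) : bad_vertices \subset Z ->
  [/\ near_complete g (A :\: Z) (B :\: Z) t, near_complete g (B :\: Z) (C :\: Z) t,
      near_complete g (C :\: Z) (D :\: Z) t, near_complete g (D :\: Z) (A :\: Z) t &
      near_tournament g (A :\: Z) t /\ near_tournament g (C :\: Z) t].
Proof.
rewrite !subUset => /andP[/andP[/andP[/andP[/andP[/andP[/andP[/andP[/andP[]]]]]]]]].
move=> b1 b2 b3 b4 b5 b6 b7 b8 b9 b10.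
by split; [ | | | | split]; do ?[apply: near_complete_off_bad|apply: near_tournament_off_bad].
Qed.

End Cores.

(** * The two ranges for the size of [A] *)

Lemma disjointDD (T : finType) (U V Z : {set T}) : [disjoint U & V] ->
  [disjoint U :\: Z & V :\: Z].
Proof.
move=> d; apply: disjointWl (subsetDl U Z) _; exact: disjointWr (subsetDl V Z) d.
Qed.

(** There are at most 3q + 20q = 23q atypical vertices, and with at most 22q for the difference of
    |B| and |D| this explains kk = 50q. J = 6000q is chosen for 2|D| + 2w <= |A| + |C| + 7J: the
    part of 2w outside the rounds is below 5500q and 2|D| - |A| - |C| is at most 43q. Then w <=
    21000q fits below L = 25000q. *)
Theorem hamilton_A_large (T : finType) (g : rel T) (A B C D : {set T}) q :
  oriented_graph g -> ore_condition g -> nat_extremal g A B C D q -> 0 < q ->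
  100 * (1000 * (1000 * q)) <= #|T| -> #|A| <= #|C| -> 400 * (1000 * q) <= #|A| ->
  has_hamilton_cycle g.
Proof.
move=> og ore ext q0 nq AC Al.
have [dis1 dis2 [s1 s2 s3 s4 [s5 s6]] _ [f1 f2 _ _]] := ext.
have [dAB dAC dAD] := dis1; have [dBC dBD dCD] := dis2.
set Z := bad_vertices g A B C D q.
have cZ : #|Z| <= 20 * q by exact: (bad_vertices_card og ext q0 (leqnn q)).
have [nAB nBC nCD nDA [tA tC]] := cores_near (subxx Z).
have [lA _] := cardsDsub A cZ; have [lB oB] := cardsDsub B cZ.
have [lC _] := cardsDsub C cZ; have [lD oD] := cardsDsub D cZ.
have ex := card_off_classes dis1 dis2 s1 s3 s5 cZ.
have uA : #|A :\: Z| <= #|A| by rewrite subset_leq_card ?subsetDl.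
have uB : #|B :\: Z| <= #|B| by rewrite subset_leq_card ?subsetDl.
have uC : #|C :\: Z| <= #|C| by rewrite subset_leq_card ?subsetDl.
have uD : #|D :\: Z| <= #|D| by rewrite subset_leq_card ?subsetDl.
have DB1 : arcs g D B <= arcs g (D :\: Z) (B :\: Z) + 40 * q * #|T|.
  by apply: arcs_shrink; rewrite ?subsetDl //; clear - oB oD; lia.
have BD1 : arcs g B D <= arcs g (B :\: Z) (D :\: Z) + 40 * q * #|T|.
  by apply: arcs_shrink; rewrite ?subsetDl //; clear - oB oD; lia.
have Cl := leq_trans Al AC.
set e := #|~: _| in ex; pose w := 48 * (50 * q) + 15 * e + 1 + 3 * (6 * (1000 * q)).
have ew : w = 48 * (50 * q) + 15 * e + 1 + 3 * (6 * (1000 * q)) by [].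
have hw : w <= 21 * (1000 * q) by clear - ew ex q0; lia.
have dD : 4 * #|D :\: Z| <= #|T| + 4 * q by clear - uD s6; lia.
have hDB := arcs_enough q0 nq hw Al lA s1 Cl dD f2 DB1.
have s1' : #|T| <= 2 * (#|C| + #|A|) + 2 * q by rewrite [#|C| + _]addnC.
have hBD := arcs_enough q0 nq hw Cl lC s1' Al dD f1 BD1.
have dense : w * #|T| < arcs g (D :\: Z) (B :\: Z).
  have cn := leq_mul Cl (leqnn #|T|); have wn := leq_mul hw (leqnn #|T|).
  have qn := leq_mul (leqnn q) nq; have n0 : 0 < q * #|T| by rewrite muln_gt0 q0; clear - nq q0; lia.
  by clear - cn wn qn n0 f2 DB1; lia.
have n1 : 999 < #|T| by clear - nq q0; lia.
apply: (@hamilton_with_A T g (A :\: Z) (B :\: Z) (C :\: Z) (D :\: Z) q (26 * (1000 * q))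
  (50 * q) (25 * (1000 * q) + 50 * q) (25 * (1000 * q)) og ore (disjointDD _ dAB)
  (disjointDD _ dAC) (disjointDD _ dAD) (disjointDD _ dBC) (disjointDD _ dBD) (disjointDD _ dCD)
  nAB nBC nCD nDA n1 _ _ _ _ _ _ _ _ _ _ _ _ _ _ _ w (6 * (1000 * q)) tA tC ew
  _ _ dense hDB hBD); rewrite -/e.
all: by clear - ex nq q0 uA uB uC uD lA lB lC lD s1 s2 s3 s4 s5 s6 AC Al hw; lia.
Qed.

(** For small [A] the size of [C] is close to n/2, and e(D,B) of about |C|n/8 is nearly |D||B|, with
    at most dl n arcs missing. All of [A] joins the exceptional set [Z], and [E] bounds the number
    of exceptional vertices. *)
Theorem hamilton_A_small (T : finType) (g : rel T) (A B C D : {set T}) q E :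
  oriented_graph g -> ore_condition g -> nat_extremal g A B C D q -> 0 < q ->
  E = 50 * (1000 * (400 * (1000 * q))) -> 100 * (1000 * (1000 * E)) <= #|T| ->
  #|A| <= 400 * (1000 * q) -> has_hamilton_cycle g.
Proof.
move=> og ore ext q0 eE nE Al.
have [dis1 dis2 [s1 s2 s3 s4 [s5 s6]] _ [f1 f2 _ _]] := ext.
have [dAB dAC dAD] := dis1; have [dBC dBD dCD] := dis2.
(* The dl n missing arcs are not quadratic in [q], so the tolerance is of order n: large enough to
   leave at most 20000 dl bad vertices on either side, small enough compared with the classes. *)
have [t tn nt] : exists2 t, 20 * (1000 * t) <= #|T| & #|T| <= 20 * (1000 * t.+1).
  by exists (#|T| %/ (20 * 1000)); clear; lia.
have qt : q <= t by clear - nE eE nt; lia.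
have nq : 100 * (1000 * (1000 * q)) <= #|T| by clear - nE eE; lia.
set dl := 400 * (1000 * q) in eE Al *.
have dldef : dl = 400 * (1000 * q) by [].
have defDB : #|D| * #|B| <= arcs g D B + dl * #|T|.
  have h1 := leq_mul s6 s4; have h2 := leq_mul s1 (leqnn #|T|).
  have h3 := leq_mul Al (leqnn #|T|); have h4 := leq_mul (leqnn q) nq.
  by rewrite dldef in h3 *; clear - h1 h2 h3 h4 f2; lia.
have bd x : x * t.+1 <= dl * #|T| -> x <= 20 * (1000 * dl).
  move=> h; rewrite -(leq_pmul2r (ltn0Sn t)); apply: leq_trans h _.
  by have := leq_mul (leqnn dl) nt; clear; lia.
have b1 := bd _ (bad_out_card t defDB); have b2 := bd _ (bad_in_card t defDB).
set Z := bad_vertices g A B C D t :|: A :|: bad_out g D B t :|: bad_out (converse g) B D t.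
have cZ : #|Z| <= 20 * q + dl + 40 * (1000 * dl).
  have u (U V : {set T}) x y : #|U| <= x -> #|V| <= y -> #|U :|: V| <= x + y.
    by move=> hx hy; rewrite cardsU; apply: leq_trans (leq_subr _ _) (leq_add hx hy).
  have := u _ _ _ _ (u _ _ _ _ (u _ _ _ _ (bad_vertices_card og ext q0 qt) Al) b1) b2.
  by rewrite -/Z; clear; lia.
have [Z1 Z2 Z3 Z4] : [/\ bad_vertices g A B C D t \subset Z, A \subset Z,
    bad_out g D B t \subset Z & bad_out (converse g) B D t \subset Z].
  by have := subxx Z; rewrite {1}/Z 3!subUset => /andP[/andP[/andP[]]].
have [nAB nBC nCD nDA [tA tC]] := cores_near Z1.
have nDB := near_complete_off_bad Z3 Z4.
have A0 : A :\: Z = set0 by apply/eqP; rewrite setD_eq0.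
have [lB _] := cardsDsub B cZ; have [lC _] := cardsDsub C cZ; have [lD _] := cardsDsub D cZ.
have ex := card_off_classes dis1 dis2 s1 s3 s5 cZ.
have uB : #|B :\: Z| <= #|B| by rewrite subset_leq_card ?subsetDl.
have uC : #|C :\: Z| <= #|C| by rewrite subset_leq_card ?subsetDl.
have uD : #|D :\: Z| <= #|D| by rewrite subset_leq_card ?subsetDl.
set e := #|~: _| in ex.
have eE' : e <= E by clear - ex eE dldef q0; lia.
set k := _ + _ + _ in cZ lB lC lD ex.
have kE : k <= E by rewrite /k; clear - eE dldef q0; lia.
have E0 : 100 * q <= E by clear - eE dldef q0; lia.
have E1 : 100 <= E by clear - E0 q0; lia.
have AE : #|A| <= E by clear - Al eE dldef; lia.
have n1 : 999 < #|T| by clear - nE E1; lia.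
pose w := 48 * (3 * E) + 15 * e + 1.
have ew : w = 48 * (3 * E) + 15 * e + 1 by [].
have hw : w <= 160 * E by clear - ew eE' E1; lia.
apply: (@hamilton_without_A T g (A :\: Z) (B :\: Z) (C :\: Z) (D :\: Z) t (2 * t + 163 * E)
  (3 * E) (2 * t + 163 * E) (2 * t + 160 * E) og ore (disjointDD _ dAB)
  (disjointDD _ dAC) (disjointDD _ dAD) (disjointDD _ dBC) (disjointDD _ dBD) (disjointDD _ dCD)
  nAB nBC nCD nDA n1 _ _ _ _ _ _ _ _ _ _ _ _ _ _ _ w A0 nDB tC ew _ _ _); rewrite -/e.
all: try by clear - eE' kE E0 E1 AE nE tn uB uC uD lB lC lD s1 s2 s3 s4 s5 s6 hw; lia.
by right.
Qed.

Theorem hamilton_nat_extremal (T : finType) (g : rel T) (A B C D : {set T}) q E :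
  oriented_graph g -> ore_condition g -> nat_extremal g A B C D q -> 0 < q ->
  E = 50 * (1000 * (400 * (1000 * q))) -> 100 * (1000 * (1000 * E)) <= #|T| ->
  has_hamilton_cycle g.
Proof.
move=> og ore ext q0 eE nE.
have nq : 100 * (1000 * (1000 * q)) <= #|T| by clear - eE nE; lia.
have [AC|/ltnW CA] := leqP #|A| #|C|.
  have [le|/ltnW lt] := leqP (400 * (1000 * q)) #|A|.
    exact: hamilton_A_large og ore ext q0 nq AC le.
  exact: hamilton_A_small og ore ext q0 eE nE lt.
apply: hamilton_converse; have og' := oriented_converse og; have ore' := ore_converse ore.
have ext' := nat_extremal_converse ext.
have [le|/ltnW lt] := leqP (400 * (1000 * q)) #|C|.
  exact: hamilton_A_large og' ore' ext' q0 nq CA le.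
exact: hamilton_A_small og' ore' ext' q0 eE nE lt.
Qed.

Unset Implicit Arguments.

Import Order.TTheory GRing.Theory Num.Theory.

Local Open Scope ring_scope.

(** * From reals to natural numbers *)

(** From n <= 2Cq and 4C^2 K eta <= 1 follow K eta n^2 <= q^2 and, as C >= 1, also K eta n <= q. *)
Lemma nat_extremal_of_extremal (R : realType) (K eta : R) (C q : nat) (T : finType)
  (g : rel T) (A B C' D : {set T}) :
  0 < eta -> 0 < K -> K * eta * (4 * C%:R ^+ 2) <= 1 -> (0 < C)%N ->
  (#|T| <= 2 * (C * q))%N ->
  extremal_partition K eta g A B C' D -> nat_extremal g A B C' D q.
Proof.
move=> eta0 K0 KC C0 nq; rewrite /extremal_partition /=.
move=> [dis1 dis2 [s1 s2 s3] [e1 e2 e3 e4] [[f1 f2] f3 f4 _ _]].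
have C1 : (1 : R) <= C%:R by rewrite ler1n.
have q0 : (0 : R) <= q%:R by rewrite ler0n.
have k0 : 0 < K * eta by rewrite mulr_gt0.
have nR : #|T|%:R <= 2 * (C%:R * q%:R) :> R by rewrite -!natrM ler_nat.
have n0 : (0 : R) <= #|T|%:R by rewrite ler0n.
have err1 : K * eta * #|T|%:R <= q%:R.
  have h1 : K * eta * #|T|%:R <= K * eta * (2 * (C%:R * q%:R)) by rewrite ler_pM2l.
  have h2 : K * eta * (2 * (C%:R * q%:R)) <= K * eta * (4 * C%:R ^+ 2) * q%:R.
    have hc : 0 <= 2 * C%:R * (2 * C%:R - 1) :> R by rewrite mulr_ge0 //; lra.
    by have := mulr_ge0 (mulr_ge0 (ltW k0) q0) hc; rewrite expr2; lra.
  have h3 : K * eta * (4 * C%:R ^+ 2) * q%:R <= 1 * q%:R by rewrite ler_wpM2r.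
  by lra.
have err2 : K * eta * #|T|%:R ^+ 2 <= q%:R * q%:R.
  have h1 : K * eta * #|T|%:R ^+ 2 <= K * eta * (2 * (C%:R * q%:R)) ^+ 2.
    by rewrite ler_pM2l // ler_sqr // ?nnegrE //; rewrite !mulr_ge0 // ler0n.
  have -> : q%:R * q%:R = 1 * (q%:R * q%:R) :> R by rewrite mul1r.
  apply: (le_trans h1).
  have -> : K * eta * (2 * (C%:R * q%:R)) ^+ 2 = K * eta * (4 * C%:R ^+ 2) * (q%:R * q%:R).
    by rewrite !expr2; lra.
  by rewrite ler_wpM2r // mulr_ge0.
move: s1 s2 s3; rewrite !ler_norml => /andP[s1 s1'] /andP[s2 s2'] /andP[s3 s3'].
split=> //.
- by split; [| | | |split]; rewrite -(ler_nat R) !(natrD, natrM); lra.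
- by split; rewrite -(ler_nat R) !(natrD, natrM); lra.
- by rewrite !expr2 in f3 f4; split; rewrite -(ler_nat R) !(natrD, natrM); lra.
Qed.

Theorem theorem1p6 (R : realType) (K : R) :
  0 < K ->
  exists eta0 : R, 0 < eta0 /\
    forall eta : R, 0 < eta -> eta <= eta0 ->
    exists n0 : nat, forall n : nat, (n0 <= n)%N ->
    forall (T : finType) (g : rel T),
      #|T| = n ->
      oriented_graph g ->
      (forall x y : T, x != y -> ~~ g x y ->
         (3 * n%:R - 3) / 4 <= (outdeg g x + indeg g y)%:R :> R) ->
      extremal K eta g ->
      has_hamilton_cycle g.
Proof.
(* [C] multiplies the constants of [hamilton_nat_extremal], whose lower bound on n reads Cq <= n. It
   is then made opaque so that it is never computed with. *)
move=> K0; pose C := (100 * (1000 * (1000 * (50 * (1000 * (400 * 1000))))))%N.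
have eC q : (C * q = 100 * (1000 * (1000 * (50 * (1000 * (400 * (1000 * q)))))))%N.
  by rewrite /C -!mulnA.
have C0 : (0 < C)%N by rewrite /C !muln_gt0.
move: C eC C0 => C eC C0.
have CR : (0 : R) < C%:R by rewrite ltr0n.
have d0 : 0 < 4 * C%:R ^+ 2 * K by rewrite !mulr_gt0 // exprn_gt0.
exists (4 * C%:R ^+ 2 * K)^-1; split; first by rewrite invr_gt0.
(* The threshold [C] is there to make the integer quotient q of n by C positive, which also yields n
   <= 2Cq; it does not depend on eta. *)
move=> eta eta0 etale; exists C => n Cn T g Tn og ore [A [B [C' [D ext]]]].
pose q := (n %/ C)%N.
have q0 : (0 < q)%N by rewrite divn_gt0.
have Cq : (C * q <= n)%N by rewrite mulnC leq_trunc_div.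
have nq : (n <= 2 * (C * q))%N.
  have h1 := ltn_ceil n C0; have h2 := leq_mul (leqnn C) q0.
  by rewrite -/q in h1; clear - h1 h2; lia.
apply: (@hamilton_nat_extremal T g A B C' D q (50 * (1000 * (400 * (1000 * q)))) og).
- move=> x y xy ngxy; have := ore x y xy ngxy; rewrite leq_subLR -(ler_nat R) Tn.
  by rewrite !(natrD, natrM); lra.
- apply: (@nat_extremal_of_extremal R K eta C) => //; last by rewrite Tn.
  have -> : K * eta * (4 * C%:R ^+ 2) = 4 * C%:R ^+ 2 * K * eta by lra.
  by rewrite -ler_pdivlMl ?mulr1.
- exact: q0.
- by [].
- by rewrite -eC Tn.
Qed.
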